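(* Let $E$ be a Drinfeld $A$-module over $\operatorname{Spec}K$ of finite residual characteristic $\mathfrak{p}_0$ and rank $r$. Suppose that the local period lattice of $E$ has rank $1$. Then for each maximal ideal $\mathfrak{p}\ne\mathfrak{p}_0$ of $A$ there is a closed subgroup scheme $U$ of the group scheme $\mathrm{GL}(T_\mathfrak{p}E)$ over $A_\mathfrak{p}$, with $U\cong(\mathbb{G}_a)^{\times(r-1)}$, such that the image of $I_K$ in $\mathrm{GL}(T_\mathfrak{p}E)$ is commensurable with $U(A_\mathfrak{p})$ (their intersection has finite index in both).
   Context: Let $\mathbb{F}_q$ be a finite field of characteristic $p$; $K\supset\mathbb{F}_q$ a local field of characteristic $p$ with ring of integers $\mathcal{O}_K$, maximal ideal $\mathfrak{p}_K$ and normalized valuation $v$; $K^s$ a separable closure, $G_K$ its Galois group, $I_K$ the inertia subgroup. Let $F$ be a global function field over $\mathbb{F}_q$, $\infty$ a place, $A\subset F$ the ring of elements regular outside $\infty$, $A_\mathfrak{p}$ the $\mathfrak{p}$-adic completion. A Drinfeld $A$-module over a ring $R$ ($R=K$ or $\mathcal{O}_K$ or a finite extension) is an $\mathbb{F}_q$-algebra homomorphism $\varphi\colon A\to R[\tau]$ ($\tau\alpha=\alpha^q\tau$) with $\varphi(a)$ of positive $\tau$-degree for some $a$; over $\mathcal{O}_K$ one also requires that the reduction modulo $\mathfrak{p}_K$ has the same rank, i.e. the leading coefficients of all $\varphi(a)$ are units. The rank $r$ is defined by $\deg_\tau\varphi(a)=r\,\log_q|A/aA|$. Characteristic homomorphism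 $\iota(a)$ = constant coefficient of $\varphi(a)$; finite residual characteristic means $\iota(A)\subset\mathcal{O}_K$, and then $\mathfrak{p}_0=\iota^{-1}(\mathfrak{p}_K)$. $T_\mathfrak{p}E=\varprojlim_n E[\mathfrak{p}^n]$, where $E[\mathfrak{p}^n]\subset K^s$ is the $\mathfrak{p}^n$-torsion, a free $A_\mathfrak{p}$-module of rank $r$ with $G_K$-action. Stable reduction and period lattice (Drinfeld's Tate uniformization): a Drinfeld module $E$ over a local field $L$ has stable reduction if $E$ is the analytic quotient of a Drinfeld module $D$ over $\mathcal{O}_L$ by a Galois-stable finitely generated projective $A$-submodule $\Lambda\subset D(L^s)$ which is discrete for the valuation topology, i.e. there is an analytic $A$-linear surjection $e_\Lambda\colon D\to E$ with kernel $\Lambda$; $\Lambda$ is determined by $E$ and $\operatorname{rank}E=\operatorname{rank}D+\operatorname{rank}_A\Lambda$. Every $E$ over $K$ acquires stable reduction over a finite separable extension $L/K$; the local period lattice of $E$ is the lattice $\Lambda$ obtained this way, and its rank does not depend on $L$. *)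

(* Defs.v *)
From HB Require Import structures.
From mathcomp Require Import all_boot all_order all_algebra.
From mathcomp Require Import separable.
From mathcomp Require Import boolp functions.
From mathcomp Require mpoly.
From mathcomp Require Import ring.

Set Implicit Arguments.
Unset Strict Implicit.
Unset Printing Implicit Defensive.

Import Order.TTheory GRing.Theory Num.Theory.
Local Open Scope ring_scope.

(** * Ideals and completions *)

Definition maximal_ideal (A : comNzRingType) (p : idealr A) : Prop :=
  forall J : idealr A, {subset p <= J} -> {subset J <= p}.

Fixpoint ideal_pow (A : comNzRingType) (p : idealr A) (n : nat) : A -> Prop :=
  if n is m.+1 then fun x => exists2 s : seq (A * A),
      (forall t, t \in s -> t.1 \in p /\ ideal_pow p m t.2) &
      x = \sum_(t <- s) t.1 * t.2
  else fun=> True.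

Section IdealPow.
Variables (A : comNzRingType) (p : idealr A).

Lemma ideal_pow0 n : ideal_pow p n 0.
Proof. by case: n => //= n; exists [::] => //; rewrite big_nil. Qed.

Lemma ideal_powD n x y :
  ideal_pow p n x -> ideal_pow p n y -> ideal_pow p n (x + y).
Proof.
case: n => //= n [s hs ->] [t ht ->]; exists (s ++ t); last by rewrite big_cat.
by move=> u; rewrite mem_cat => /orP[/hs|/ht].
Qed.

Lemma ideal_powMl n a x : ideal_pow p n x -> ideal_pow p n (a * x).
Proof.
case: n => //= n [s hs ->]; exists [seq (a * t.1, t.2) | t <- s].
  by move=> _ /mapP[t /hs[t1 t2] ->] /=; split => //; apply: idealMr.
by rewrite big_map mulr_sumr; apply: eq_bigr => t _; rewrite mulrA.
Qed.

Lemma ideal_powB n x y :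
  ideal_pow p n x -> ideal_pow p n y -> ideal_pow p n (x - y).
Proof.
by move=> hx hy; apply: ideal_powD => //; rewrite -mulN1r; apply: ideal_powMl.
Qed.

Lemma ideal_pow1 x : ideal_pow p 1 x -> x \in p.
Proof.
case=> s hs ->; rewrite big_seq; apply: rpred_sum => t /hs[t1 _].
by rewrite mulrC idealMr.
Qed.

(** [completion p] is the inverse limit of the rings [A / p ^ n], realized as
    the ring of coherent sequences of representatives modulo the ideal of
    sequences whose [n]-th term lies in [p ^ n] for all [n]. *)
Definition coherent : pred (nat -> A) :=
  fun a => `[< forall n, ideal_pow p n (a n.+1 - a n) >].

Lemma coherent_subring : subring_closed coherent.
Proof.
split.
- by apply/asboolP => n; rewrite subrr; apply: ideal_pow0.
- move=> a b /asboolP ha /asboolP hb; apply/asboolP => n.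
  have -> : (a - b) n.+1 - (a - b) n = (a n.+1 - a n) - (b n.+1 - b n).
    by rewrite -[(a - b) n.+1]/(a n.+1 - b n.+1) -[(a - b) n]/(a n - b n); ring.
  exact: ideal_powB.
- move=> a b /asboolP ha /asboolP hb; apply/asboolP => n.
  have -> : (a * b) n.+1 - (a * b) n
     = a n.+1 * (b n.+1 - b n) + b n * (a n.+1 - a n).
    by rewrite -[(a * b) n.+1]/(a n.+1 * b n.+1) -[(a * b) n]/(a n * b n); ring.
  by apply: ideal_powD; apply: ideal_powMl.
Qed.

HB.instance Definition _ :=
  GRing.isSubringClosed.Build (nat -> A) coherent coherent_subring.

Record coherent_seq :=
  CoherentSeq { seq_of :> nat -> A; seq_ofP : coherent seq_of }.
HB.instance Definition _ := [isSub for seq_of].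
HB.instance Definition _ := [Choice of coherent_seq by <:].
HB.instance Definition _ :=
  GRing.SubChoice_isSubComPzRing.Build _ _ coherent_seq (subringClosedP _).

Lemma coherent_seq1_neq0 : 1 != 0 :> coherent_seq.
Proof.
apply/eqP => /(congr1 (fun a : coherent_seq => seq_of a 0)).
by move/eqP; rewrite oner_eq0.
Qed.
HB.instance Definition _ :=
  GRing.PzSemiRing_isNonZero.Build coherent_seq coherent_seq1_neq0.

Definition null_seq : {pred coherent_seq} :=
  fun a => `[< forall n, ideal_pow p n (seq_of a n) >].

Lemma null_seq_idealr : idealr_closed null_seq.
Proof.
split.
- by apply/asboolP => n; apply: ideal_pow0.
- by apply/asboolP => /(_ 1) /ideal_pow1; rewrite idealr1.
- move=> a b c /asboolP hb /asboolP hc; apply/asboolP => n.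
  by apply: ideal_powD => //; apply: ideal_powMl.
Qed.

HB.instance Definition _ :=
  isIdealr.Build coherent_seq null_seq null_seq_idealr.

Definition completion := {ideal_quot null_seq}.

(** A representative in [A] of the image of [al] in [A / p ^ n]. It is only
    ever applied to [p ^ n]-torsion elements, where the choice is immaterial. *)
Definition residue (al : completion) (n : nat) : A := seq_of (repr al) n.

End IdealPow.

(** * Valuations, function fields and local fields *)

(** A normalized discrete valuation; by convention [v 0 = 0], so that
    [0 <= v x] defines the valuation ring. *)
Record normalized_valuation (F : fieldType) (v : F -> int) : Prop := {
  val0 : v 0 = 0;
  valM : forall x y, x != 0 -> y != 0 -> v (x * y) = v x + v y;
  valD : forall x y, x != 0 -> y != 0 -> x + y != 0 ->
           Num.min (v x) (v y) <= v (x + y);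
  val_surj : exists2 x, x != 0 & v x = 1
}.

Definition val_ge (F : fieldType) (v : F -> int) (m : int) (x : F) : Prop :=
  x = 0 \/ m <= v x.

Record local_field (K : fieldType) (v : K -> int) : Prop := {
  local_val : normalized_valuation v;
  local_complete : forall u : nat -> K,
    (forall m, exists N, forall i j, (N <= i)%N -> (N <= j)%N ->
       val_ge v m (u i - u j)) ->
    exists l, forall m, exists N, forall i, (N <= i)%N -> val_ge v m (u i - l);
  local_residue : exists s : seq K, forall x, val_ge v 0 x ->
    exists2 y, y \in s & val_ge v 1 (x - y)
}.

(** [F] is a finite extension of a rational function field [k(t)]. *)
Definition global_function_field (k : finFieldType) (F : fieldType)
    (i : {rmorphism k -> F}) : Prop :=
  exists t : F,
    (forall f : {poly k}, f != 0 -> (map_poly i f).[t] != 0) /\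
    exists s : seq F, forall x, exists (d : {poly k}) (c : nat -> {poly k}),
      d != 0 /\ (map_poly i d).[t] * x
                  = \sum_(j < size s) (map_poly i (c j)).[t] * s`_j.

(** [AF] identifies [A] with the elements of [F] regular outside the place
    [vinf]; places are given by their normalized valuations. *)
Definition regular_outside (A : comNzRingType) (F : fieldType)
    (AF : {rmorphism A -> F}) (vinf : F -> int) : Prop :=
  injective AF /\
  forall x : F, (exists a, AF a = x) <->
    (forall w : F -> int, normalized_valuation w -> ~ w =1 vinf -> 0 <= w x).

(** * Separable closure, Galois and inertia groups *)

Definition separable_closure (K Ks : fieldType) (i : {rmorphism K -> Ks}) :
    Prop :=
  (forall x, exists2 f : {poly K},
     separable_poly f & root (map_poly i f) x) /\
  (forall f : {poly Ks}, separable_poly f -> (1 < size f)%N ->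
     exists x, root f x).

Section SeparableClosure.
Variables (K Ks : fieldType) (v : K -> int) (i : {rmorphism K -> Ks}).

Definition galois_aut (s : {rmorphism Ks -> Ks}) : Prop :=
  bijective s /\ forall x, s (i x) = i x.

(** The integral closure of the valuation ring of [K], which is the valuation
    ring of the unique extension of [v], and its maximal ideal. *)
Definition sep_integer (x : Ks) : Prop :=
  exists f : {poly K},
    [/\ f \is monic, forall j, 0 <= v f`_j & root (map_poly i f) x].

Definition sep_maximal (x : Ks) : Prop :=
  sep_integer x /\ (x = 0 \/ ~ sep_integer x^-1).

Definition inertia_aut (s : {rmorphism Ks -> Ks}) : Prop :=
  galois_aut s /\ forall x, sep_integer x -> sep_maximal (s x - x).

(** The balls [c * O_Ks], for [c] nonzero in [K], form a basis of
    neighbourhoods of [0] in the valuation topology. *)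
Definition sep_ball (c : K) (x : Ks) : Prop := sep_integer (x / i c).

Definition sep_limit (u : nat -> Ks) (l : Ks) : Prop :=
  forall c, c != 0 ->
    exists N, forall n, (N <= n)%N -> sep_ball c (u n - l).

Definition finite_subext (L : {pred Ks}) : Prop :=
  [/\ divring_closed L, forall x, i x \in L &
      exists2 s : seq Ks, {subset s <= L} &
        forall x, x \in L -> exists c : nat -> K,
          x = \sum_(j < size s) i (c j) * s`_j].

End SeparableClosure.

(** * Drinfeld modules *)

(** The twisted polynomial [\sum_j f_j tau^j] is encoded by the underlying
    polynomial [\sum_j f_j 'X^j]. *)
Section Twisted.
Variables (q : nat) (M : fieldType).
Implicit Types f g : {poly M}.

Definition tau_mul f g : {poly M} :=
  \sum_(i < size f) \sum_(j < size g)
     (f`_i * g`_j ^+ (q ^ i)) *: 'X^(i + j).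

Definition tau_eval f (x : M) : M := \sum_(i < size f) f`_i * x ^+ (q ^ i).

End Twisted.

Record drinfeld_module (k : finFieldType) (A : comNzRingType)
    (kA : {rmorphism k -> A}) (M : fieldType) (kM : {rmorphism k -> M})
    (phi : A -> {poly M}) : Prop := {
  drinfeldD : {morph phi : a b / a + b};
  drinfeldM : forall a b, phi (a * b) = tau_mul #|k| (phi a) (phi b);
  drinfeld_scalar : forall c, phi (kA c) = (kM c)%:P;
  drinfeld_pos : exists a, (1 < size (phi a))%N
}.

(** The ring [A / a A] has exactly [N] elements. *)
Definition quotient_card (A : comNzRingType) (a : A) (N : nat) : Prop :=
  exists s : N.-tuple A, forall x,
    exists! j : 'I_N, exists y, x = tnth s j + a * y.

Definition drinfeld_rank (k : finFieldType) (A : comNzRingType)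
    (M : fieldType) (phi : A -> {poly M}) (r : nat) : Prop :=
  forall a, a != 0 -> exists2 N : nat,
    quotient_card a N & (#|k| ^ (size (phi a)).-1 = N ^ r)%N.

Section DrinfeldLocal.
Variables (k : finFieldType) (A : comNzRingType) (kA : {rmorphism k -> A}).
Variables (K : fieldType) (kK : {rmorphism k -> K}) (v : K -> int).
Variables (Ks : fieldType) (i : {rmorphism K -> Ks}).

Definition finite_residual_char (phi : A -> {poly K}) : Prop :=
  forall a, val_ge v 0 (phi a)`_0.

Definition residual_char (phi : A -> {poly K}) (a : A) : Prop :=
  val_ge v 1 (phi a)`_0.

(** A Drinfeld module over the ring of integers of the finite subextension
    [L]. *)
Definition integral_drinfeld_module (L : {pred Ks}) (D : A -> {poly Ks}) :
    Prop :=
  [/\ drinfeld_module kA (i \o kK) D,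
      forall a j, (D a)`_j \in L /\ sep_integer v i (D a)`_j &
      forall a, a != 0 ->
        lead_coef (D a) != 0 /\ sep_integer v i (lead_coef (D a))^-1].

Section Lattice.
Variables (L : {pred Ks}) (D : A -> {poly Ks}).
Local Notation "a *D x" := (tau_eval #|k| (D a) x) (at level 40).

(** Finitely generated projective modules are presented as retracts of the
    free modules [A ^ n]. *)
Record period_lattice (Lam : Ks -> Prop) : Prop := {
  lattice0 : Lam 0;
  latticeB : forall x y, Lam x -> Lam y -> Lam (x - y);
  latticeZ : forall a x, Lam x -> Lam (a *D x);
  lattice_galois : forall s : {rmorphism Ks -> Ks}, galois_aut i s ->
    (forall x, x \in L -> s x = x) -> forall x, Lam x -> Lam (s x);
  lattice_proj : exists (n : nat) (g : 'I_n -> Ks) (sec : Ks -> 'rV[A]_n),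
    [/\ forall j, Lam (g j),
        forall x y, Lam x -> Lam y -> sec (x + y) = sec x + sec y,
        forall a x, Lam x -> sec (a *D x) = a *: sec x &
        forall x, Lam x -> x = \sum_j (sec x 0 j *D g j)];
  lattice_discrete : exists2 c : K, c != 0 &
    forall x, Lam x -> sep_ball v i c x -> x = 0
}.

Definition independent (m : nat) (x : 'I_m -> Ks) : Prop :=
  forall c : 'I_m -> A, \sum_j (c j *D x j) = 0 -> forall j, c j = 0.

Definition lattice_rank (Lam : Ks -> Prop) (m : nat) : Prop :=
  (exists2 x : 'I_m -> Ks, (forall j, Lam (x j)) & independent x) /\
  (forall x : 'I_m.+1 -> Ks, (forall j, Lam (x j)) -> ~ independent x).

(** The Drinfeld module [E] is the analytic quotient of [D] by [Lam]: there is
    an [A]-linear surjection [e], given by an everywhere convergent power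
    series over [L], with kernel [Lam]. The kernel is étale, which is the
    condition on the linear coefficient. *)
Definition analytic_quotient (E : A -> {poly Ks}) (Lam : Ks -> Prop) : Prop :=
  exists (co : nat -> Ks) (e : Ks -> Ks),
    [/\ forall j, co j \in L,
        co 1%N != 0 &
        forall x, sep_limit v i (fun n => \sum_(j < n) co j * x ^+ j) (e x)] /\
    [/\ {morph e : x y / x + y},
        forall a x, e (a *D x) = tau_eval #|k| (E a) (e x),
        forall y, exists x, e x = y &
        forall x, e x = 0 <-> Lam x].

End Lattice.

Definition local_period_lattice_rank (phi : A -> {poly K}) (m : nat) : Prop :=
  exists (L : {pred Ks}) (D : A -> {poly Ks}) (Lam : Ks -> Prop),
    [/\ finite_subext i L,
        integral_drinfeld_module L D,
        period_lattice L D Lam,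
        analytic_quotient L D (fun a => map_poly i (phi a)) Lam &
        lattice_rank D Lam m].

End DrinfeldLocal.

(** * Tate modules *)

Section Tate.
Variables (k : finFieldType) (A : comNzRingType) (K Ks : fieldType).
Variables (v : K -> int) (i : {rmorphism K -> Ks}) (phi : A -> {poly K}).
Variables (p : idealr A) (pi : A).
Local Notation "a *E x" :=
  (tau_eval #|k| (map_poly i (phi a)) x) (at level 40).

Definition torsion (n : nat) (x : Ks) : Prop :=
  forall a, ideal_pow p n a -> a *E x = 0.

(** The inverse limit of the modules [E[p ^ n]] along multiplication by a fixed
    element [pi] of [p] outside [p ^ 2], which generates [p] locally at [p]. *)
Definition tate_module (x : nat -> Ks) : Prop :=
  forall n, torsion n (x n) /\ pi *E x n.+1 = x n.

Definition tate_lincomb (r : nat) (b : 'I_r -> nat -> Ks)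
    (al : 'I_r -> completion p) (n : nat) : Ks :=
  \sum_j (residue (al j) n *E b j n).

Definition tate_basis (r : nat) (b : 'I_r -> nat -> Ks) : Prop :=
  (forall j, tate_module (b j)) /\
  forall x, tate_module x -> exists! al : 'cV[completion p]_r,
    forall n, x n = tate_lincomb b (al^~ 0) n.

(** The image of inertia in [GL] of the Tate module, written as a set of
    matrices acting on column vectors of coordinates in the basis [b]. *)
Definition inertia_image (r : nat) (b : 'I_r -> nat -> Ks)
    (g : 'M[completion p]_r) : Prop :=
  exists2 s : {rmorphism Ks -> Ks}, inertia_aut v i s &
    forall j n, s (b j n) = tate_lincomb b (g^~ j) n.

End Tate.

(** * Closed subgroup schemes of GL_r *)

Section GroupScheme.
Variables (B : comNzRingType) (r : nat).

(** Elements of this ring represent elements of the coordinate ring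
    [B[x_ij, 1 / det]] of [GL_r], the last variable standing for [1 / det]. A
    set of such polynomials defines a closed subscheme of [GL_r]. *)
Definition GL_poly := mpoly.mpoly (r * r + 1) B.

Definition GL_eval (R : comAlgType B) (g : 'M[R]_r) (d : R) (f : GL_poly) : R :=
  mpoly.mmap (in_alg R) (fun j => row_mx (mxvec g) (const_mx d) 0 j) f.

Definition GL_points (S : GL_poly -> Prop) (R : comAlgType B) (g : 'M[R]_r) :
    Prop :=
  exists2 d : R, d * \det g = 1 & forall f, S f -> GL_eval g d f = 0.

Definition subgroup_scheme (S : GL_poly -> Prop) : Prop :=
  forall R : comAlgType B,
    [/\ GL_points S (1%:M : 'M[R]_r),
        forall g h : 'M[R]_r,
          GL_points S g -> GL_points S h -> GL_points S (g *m h) &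
        forall g h : 'M[R]_r,
          GL_points S g -> g *m h = 1%:M -> GL_points S h].

(** An isomorphism of group schemes from the [m]-th power of the additive
    group, as a natural isomorphism of functors of points. *)
Definition isomorphic_to_Ga (S : GL_poly -> Prop) (m : nat) : Prop :=
  exists u : forall R : comAlgType B, 'rV[R]_m -> 'M[R]_r,
    [/\ forall R x y, u R (x + y) = u R x *m u R y,
        forall R, injective (u R),
        forall R g, GL_points S g <-> exists x, u R x = g &
        forall (R R' : comAlgType B) (h : {lrmorphism R -> R'}) x,
          map_mx h (u R x) = u R' (map_mx h x)].

Definition finite_index (H H' : 'M[B]_r -> Prop) : Prop :=
  exists2 s : seq 'M[B]_r, (forall g, g \in s -> H g) &
    forall h, H h -> exists g h', [/\ g \in s, H' h' & h = g *m h'].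

Definition commensurable (H H' : 'M[B]_r -> Prop) : Prop :=
  finite_index H (fun g => H g /\ H' g) /\
  finite_index H' (fun g => H g /\ H' g).

End GroupScheme.

(* Main.v *)
Require Import Defs.
From HB Require Import structures.
From mathcomp Require Import all_boot all_order all_algebra.
From mathcomp Require Import separable finfield.
From mathcomp Require Import boolp classical_sets.
From mathcomp Require Import -(notations) mpoly.
From mathcomp Require Import ring zify.
Set Implicit Arguments.
Unset Strict Implicit.
Unset Printing Implicit Defensive.
Import Order.TTheory GRing.Theory Num.Theory.
Local Open Scope ring_scope.

(* Fix a local generator [rho] of [p] acting on [E], hence on [D], with unit linear
   coefficient. Inertia then acts trivially on [D[p ^ n]], and [E[p ^ n]] is an extension of
   [Lam / p ^ n Lam] by [D[p ^ n]], generated by [e(x_n)] where [rho ^ n x_n = lam] and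
   [lam] generates [Lam] at [p]. So a finite index subgroup of inertia acts by matrices that
   differ from the identity only in the last column, and [rank D + 1 = r] follows by counting
   torsion points. Conversely, iterating [rho] on an integral [lam] would contradict
   discreteness, so [lam] is not integral; hence [x_n ^ (q ^ deg)] is comparable to [lam],
   where [q ^ deg] is the number of points of the kernel of [rho ^ n] on [D], and [x_n] has
   ramification index at least [q ^ deg / C] with [C] independent of [n]. The inertia orbit
   of [x_n] thus fills the kernel of [rho ^ n] on [D] up to bounded index, and compactness
   of the Galois group, obtained here by extending partial automorphisms with Zorn's lemma,
   turns the bounds at finite levels into a bound for the whole column. *)

(** * The valuation ring of a separable closure *)

(** Ramification is measured by norms: the product of an orbit, taken once more over the group
    fixing the residue field, has the value of an element of [K]. The ring [A] enters as a domain
    with finite quotients by nonzero elements that is completely integrally closed; from this [p] is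
    shown to be locally principal. The given [pi] may act with zero linear coefficient, hence not
    surjectively, since the characteristic homomorphism may have a kernel; [rho] is therefore a
    second local generator. As [rho] may be divisible by maximal ideals other than [p], factors
    [sn n] congruent to 1 modulo [p ^ n] project its torsion to [p]-power torsion. That [D] has the
    linear coefficients of [E] comes from comparing linear terms in the functional equation of
    [e]. *)

Section Valuation.
Variables (K : fieldType) (v : K -> int) (hv : normalized_valuation v).

Lemma val_of1 : v 1 = 0.
Proof.
have := Defs.valM hv (oner_neq0 K) (oner_neq0 K); rewrite mulr1 => h.
by apply: (@addrI _ (v 1)); rewrite -h addr0.
Qed.

Lemma val_ofV x : x != 0 -> v x^-1 = - v x.
Proof.
move=> x0; apply: (@addrI _ (v x)); rewrite -(Defs.valM hv) ?invr_eq0 //.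
by rewrite divff // val_of1 subrr.
Qed.

Lemma val_ofX x n : x != 0 -> v (x ^+ n) = v x *+ n.
Proof.
move=> x0; elim: n => [|n IH]; first by rewrite expr0 mulr0n val_of1.
by rewrite exprS (Defs.valM hv) ?expf_neq0 // IH mulrS.
Qed.

Lemma val_ofN x : v (- x) = v x.
Proof.
have [->|x0] := eqVneq x 0; first by rewrite oppr0.
have n0 : (-1 : K) != 0 by rewrite oppr_eq0 oner_neq0.
have h : v (-1) *+ 2 = 0 by rewrite -(val_ofX 2 n0) expr2 mulrNN mulr1 val_of1.
have h1 : v (-1) = 0 by move/eqP: h; rewrite mulrn_eq0 => /eqP.
by rewrite -mulN1r (Defs.valM hv) // h1 add0r.
Qed.

Lemma val_geE m x : x != 0 -> val_ge v m x <-> m <= v x.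
Proof. by move=> x0; split=> [[x0'|//]|]; [rewrite x0' eqxx in x0 | right]. Qed.

Lemma val_geD m x y : val_ge v m x -> val_ge v m y -> val_ge v m (x + y).
Proof.
have [->|x0] := eqVneq x 0; first by rewrite add0r.
have [->|y0] := eqVneq y 0; first by rewrite addr0.
move=> /val_geE-/(_ x0) hx /val_geE-/(_ y0) hy.
have [->|xy0] := eqVneq (x + y) 0; first by left.
right; apply: le_trans (Defs.valD hv x0 y0 xy0).
by rewrite le_min hx hy.
Qed.

Lemma val_geN m x : val_ge v m x -> val_ge v m (- x).
Proof. by case=> [->|h]; [left; rewrite oppr0 | right; rewrite val_ofN]. Qed.

Lemma val_geB m x y : val_ge v m x -> val_ge v m y -> val_ge v m (x - y).
Proof. by move=> hx hy; apply/val_geD/val_geN. Qed.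

Lemma val_geM m n x y : val_ge v m x -> val_ge v n y -> val_ge v (m + n) (x * y).
Proof.
have [->|x0] := eqVneq x 0; first by rewrite mul0r => *; left.
have [->|y0] := eqVneq y 0; first by rewrite mulr0 => *; left.
move=> /val_geE-/(_ x0) hx /val_geE-/(_ y0) hy; right.
by rewrite (Defs.valM hv) // lerD.
Qed.

Lemma val_geW m n x : n <= m -> val_ge v m x -> val_ge v n x.
Proof. by move=> h [->|hx]; [left | right; apply: le_trans hx]. Qed.

Lemma val_ge_sum m I (r : seq I) (P : pred I) (F : I -> K) :
  (forall i, P i -> val_ge v m (F i)) -> val_ge v m (\sum_(i <- r | P i) F i).
Proof.
move=> h; elim/big_rec: _ => [|i x Pi IH]; first by left.
exact/val_geD/IH/h.
Qed.

Lemma val_ge0P x : val_ge v 0 x <-> 0 <= v x.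
Proof. by split=> [[->|//]|]; [rewrite (Defs.val0 hv) | right]. Qed.

(** The proof of [normalized_valuation v] is a dummy argument, so that the subring structure, which
    depends on it, can be inferred from the predicate alone. *)
Definition valring_pred of normalized_valuation v : {pred K} := fun x => 0 <= v x.

Lemma valring_subring : subring_closed (valring_pred hv).
Proof.
have inE x : (x \in valring_pred hv) = (0 <= v x) by [].
split=> [|x y|x y]; rewrite !inE.
- by rewrite val_of1.
- by move=> /val_ge0P hx /val_ge0P hy; apply/val_ge0P/val_geB.
- move=> /val_ge0P hx /val_ge0P hy; apply/val_ge0P.
  by have := val_geM hx hy; rewrite addr0.
Qed.

HB.instance Definition _ :=
  GRing.isSubringClosed.Build K (valring_pred hv) valring_subring.

Definition valring : Type := {x : K | x \in valring_pred hv}.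
HB.instance Definition _ := SubType.on valring.
HB.instance Definition _ := [Choice of valring by <:].
HB.instance Definition _ :=
  GRing.SubChoice_isSubComPzRing.Build _ _ valring (subringClosedP (valring_pred hv)).
Lemma valring1_neq0 : 1 != 0 :> valring.
Proof. by apply/eqP => /(congr1 val)/eqP; rewrite oner_eq0. Qed.
HB.instance Definition _ :=
  GRing.PzSemiRing_isNonZero.Build valring valring1_neq0.

Definition vr_val : valring -> K := val.
HB.instance Definition _ := GRing.RMorphism.copy vr_val (val : valring -> K).

End Valuation.

Lemma pigeonhole_nat (T : finType) (c : nat -> T) :
  exists i j, (i < j)%N /\ c i = c j.
Proof.
have /injectivePn [a [b ab e]] :
    ~~ injectiveb (fun j : 'I_#|T|.+1 => c j).
  apply/negP => /injectiveP /leq_card.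
  by rewrite card_ord ltnn.
have : val a != val b by [].
rewrite neq_ltn => /orP[h|h]; first by exists a, b.
by exists b, a.
Qed.

Lemma pchar_exprD (R : comNzRingType) (l n : nat) (x y : R) :
  l \in [pchar R] -> (x + y) ^+ (l ^ n) = x ^+ (l ^ n) + y ^+ (l ^ n).
Proof.
move=> hl; apply: exprDn_pchar; rewrite pnatX.
by rewrite (pnatE _ (pcharf_prime hl)) hl.
Qed.

Lemma pchar_exprB (R : comNzRingType) (l n : nat) (x y : R) :
  l \in [pchar R] -> (x - y) ^+ (l ^ n) = x ^+ (l ^ n) - y ^+ (l ^ n).
Proof.
by move=> hl; apply/eqP; rewrite eq_sym subr_eq -pchar_exprD // subrK.
Qed.

(** Multiplying the equation of [x] by the power [n.-1] of its coefficient of degree [n] makes it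
    monic in that coefficient times [x]. *)
Lemma scaled_root (R : fieldType) (f : {poly R}) n x :
  (0 < n)%N -> (size f <= n.+1)%N -> root f x ->
  let g := \poly_(j < n) (f`_j * f`_n ^+ (n.-1 - j)) + 'X^n in
  g \is monic /\ root g (f`_n * x).
Proof.
move=> n0 sf fx /=; set g := \poly_(j < n) _.
have gs : (size g < size ('X^n : {poly R}))%N by rewrite size_polyXn ltnS size_poly.
split; first by rewrite monicE addrC lead_coefDl // lead_coefXn.
rewrite /root hornerD hornerXn (@horner_coef_wide _ n g); last exact: size_poly.
move: fx; rewrite /root (horner_coef_wide _ sf) big_ord_recr /= => /eqP e.
have -> : (f`_n * x) ^+ n = f`_n ^+ n.-1 * (f`_n * x ^+ n).
  by rewrite exprMn mulrA -exprSr prednK.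
have := congr1 ( *%R (f`_n ^+ n.-1)) e; rewrite mulr0 => {}e.
apply/eqP; rewrite -[RHS]e mulrDr mulr_sumr; congr (_ + _); apply: eq_bigr => j _.
rewrite coef_poly ltn_ord exprMn.
have hj : (j <= n.-1)%N by rewrite -ltnS prednK.
by rewrite -[in RHS](subnK hj) exprD; ring.
Qed.

Section Completeness.
Variables (K : fieldType) (v : K -> int) (hK : local_field v).
Let hv := local_val hK.

Lemma uniformizer_exists : exists2 t, t != 0 & v t = 1.
Proof. exact: val_surj hv. Qed.

Variables (t : K) (t0 : t != 0) (vt : v t = 1).

Lemma val_ofXt m : v (t ^+ m) = m.
Proof. by rewrite (val_ofX hv) // vt -mulr_natl mulr1 natz. Qed.

Lemma val_ge_divXt m x : val_ge v m%:Z x -> 0 <= v (x / t ^+ m).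
Proof.
case=> [->|h]; first by rewrite mul0r (Defs.val0 hv).
have [->|x0] := eqVneq x 0; first by rewrite mul0r (Defs.val0 hv).
rewrite (Defs.valM hv) ?invr_eq0 ?expf_neq0 // (val_ofV hv) ?expf_neq0 //.
by rewrite val_ofXt subr_ge0.
Qed.

(** The partial sums are Cauchy; passing to the limit in the tail gives the remainder estimate,
    whose case [m = 0] is integrality. *)
Lemma series_complete (c : nat -> K) : (forall k, 0 <= v (c k)) ->
  exists2 a, 0 <= v a &
    forall m : nat, val_ge v m (a - \sum_(k < m) t ^+ k * c k).
Proof.
move=> hc; pose u m := \sum_(k < m) t ^+ k * c k.
have hu m n : (m <= n)%N -> val_ge v m (u n - u m).
  move=> hmn; rewrite /u -(subnKC hmn) big_split_ord /= addrAC subrr add0r.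
  apply: (val_ge_sum hv) => k _; rewrite -[X in val_ge _ X]addr0.
  apply: (val_geM hv); last by right.
  by right; rewrite val_ofXt; lia.
have [|a ha] := local_complete hK (u := u).
  move=> m; exists `|m|%N => k l hk hl.
  have hm : m <= (`|m|%N : int) by lia.
  apply: val_geW hm _.
  rewrite -(subrK (u `|m|%N) (u k)) -addrA; apply: (val_geD hv); first exact: hu.
  by rewrite -opprB; apply: (val_geN hv); apply: hu.
have ham (m : nat) : val_ge v m (a - u m).
  have [N hN] := ha m.
  have := hN (maxn N m) (leq_maxl _ _) => /(val_geN hv); rewrite opprB => h1.
  have h2 := hu m (maxn N m) (leq_maxr _ _).
  by rewrite -(subrK (u (maxn N m)) a) -addrA; apply: (val_geD hv).
exists a => //; apply/(val_ge0P hv); have := ham 0%N.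
by rewrite /u big_ord0 subr0.
Qed.

End Completeness.

Section IntegralClosure.
Variables (K Ks : fieldType) (v : K -> int) (i : {rmorphism K -> Ks}).
Hypothesis hK : local_field v.
Let hv := local_val hK.
Local Notation O := (sep_integer v i).
Local Notation OK := (valring hv).
Local Notation iota := (i \o @vr_val _ _ hv).

Lemma vr_lift c : 0 <= v c -> exists a : OK, vr_val a = c.
Proof. by move=> hc; exists (exist _ c hc). Qed.

Lemma vr_valP (a : OK) : 0 <= v (vr_val a). Proof. exact: (valP a). Qed.

Lemma vr_lift_poly (f : {poly K}) : (forall j, 0 <= v f`_j) ->
  exists g : {poly OK}, map_poly (@vr_val _ _ hv) g = f.
Proof.
move=> hf; have [g hg] := choice (fun j => vr_lift (hf j)).
exists (\poly_(j < size f) g j); apply/polyP => j.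
rewrite coef_map coef_poly; case: ltnP => h; first exact: hg.
by rewrite [RHS]nth_default.
Qed.

(** Identifies [O] with the integral closure of the ring [valring], whose general theory supplies
    closure under sums and products. *)
Lemma sep_integerP x : O x <-> integralOver iota x.
Proof.
split=> [[f [fm fv fx]]|[g gm gx]].
  have [g hg] := vr_lift_poly fv; exists g; last by rewrite map_poly_comp hg.
  have inj : injective (@vr_val _ _ hv) := val_inj.
  move: fm; rewrite -hg => /monicP; rewrite lead_coef_map_inj ?rmorph0 // => h.
  by apply/monicP/inj; rewrite h rmorph1.
exists (map_poly (@vr_val _ _ hv) g); split.
- exact: monic_map.
- by move=> j; rewrite coef_map; apply: vr_valP.
- by rewrite -map_poly_comp.
Qed.

Lemma O_iota c : 0 <= v c -> O (i c).
Proof.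
move=> /vr_lift[a <-]; apply/sep_integerP; exact: (integral_id iota a).
Qed.
Lemma O0 : O 0. Proof. exact/sep_integerP/integral0. Qed.
Lemma O1 : O 1. Proof. exact/sep_integerP/integral1. Qed.
Lemma ON x : O x -> O (- x).
Proof. by move=> /sep_integerP h; apply/sep_integerP/integral_opp. Qed.
Lemma OD x y : O x -> O y -> O (x + y).
Proof. by move=> /sep_integerP h /sep_integerP h'; apply/sep_integerP/integral_add. Qed.
Lemma OB x y : O x -> O y -> O (x - y).
Proof. by move=> hx hy; apply/OD/ON. Qed.
Lemma OM x y : O x -> O y -> O (x * y).
Proof. by move=> /sep_integerP h /sep_integerP h'; apply/sep_integerP/integral_mul. Qed.
Lemma OX x n : O x -> O (x ^+ n).
Proof.
by move=> hx; elim: n => [|n IH]; rewrite ?expr0 ?exprS; [apply: O1 | apply: OM].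
Qed.
Lemma Osum I (r : seq I) (P : pred I) (F : I -> Ks) :
  (forall j, P j -> O (F j)) -> O (\sum_(j <- r | P j) F j).
Proof.
by move=> h; elim/big_rec: _ => [|j x Pj]; [apply: O0 | apply/OD/h].
Qed.

Lemma O_closed (f : {poly Ks}) x : f \is monic -> root f x ->
  (forall j, O f`_j) -> O x.
Proof.
move=> fm fx hf; apply/sep_integerP; apply: integral_root_monic fm fx _.
by apply/integral_poly => j; apply/sep_integerP.
Qed.

(** The valuation ring of [K] is integrally closed: if [v c] were negative, the top term of a monic
    equation would have strictly smaller valuation than all the others. *)
Lemma O_iotaE c : O (i c) <-> 0 <= v c.
Proof.
split; last exact: O_iota.
case=> f [fm fv fc]; rewrite leNgt; apply/negP => hc.
have c0 : c != 0 by apply: contraTneq hc => ->; rewrite (Defs.val0 hv) ltxx.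
have {fc} : root f c by rewrite -(fmorph_root i).
have sf : (size f).-1.+1 = size f by rewrite prednK // size_poly_gt0 monic_neq0.
rewrite /root horner_coef -sf big_ord_recr /=.
have -> : f`_(size f).-1 = 1 by apply/eqP.
rewrite mul1r addr_eq0 => /eqP e.
have : val_ge v (v c *+ (size f).-1 + 1) (- c ^+ (size f).-1).
  rewrite -e; apply: (val_ge_sum hv) => j _.
  have h1 : val_ge v (0 + v (c ^+ j)) (f`_j * c ^+ j).
    by apply: (val_geM hv); right.
  apply: val_geW h1; rewrite add0r (val_ofX hv) //.
  move: (ltn_ord j); move: (nat_of_ord j) => {}j; move: (_.-1) => n hj.
  rewrite -(subnKC hj) mulrnDr mulrS; have := mulrn_wle0 (n - j.+1) (ltW hc).
  by lia.
rewrite val_geE; last by rewrite oppr_eq0 expf_neq0.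
by rewrite (val_ofN hv) (val_ofX hv) // gerDl.
Qed.

Variables (t : K) (t0 : t != 0) (vt : v t = 1).
Local Notation T := (i t).

Lemma T_neq0 : T != 0. Proof. by rewrite fmorph_eq0. Qed.

Lemma O_TX s : O (T ^+ s).
Proof. by rewrite -rmorphXn; apply: O_iota; rewrite (val_ofXt hK). Qed.

Hypothesis halg : forall x : Ks,
  exists2 f : {poly K}, f != 0 & root (map_poly i f) x.

Lemma val_unit_decomp c : c != 0 -> exists s, 0 <= v (t ^+ s / c).
Proof.
move=> c0; exists `|v c|%N.
rewrite (Defs.valM hv) ?invr_eq0 ?expf_neq0 // (val_ofV hv) // (val_ofXt hK) //.
by lia.
Qed.

(** Clearing denominators gives an equation over the integers of [K]; its leading coefficient [c]
    makes [i c * x] integral, and [c] divides some power of [t]. *)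
Lemma O_absorb x : exists s, O (T ^+ s * x).
Proof.
have [f f0 fx] := halg x.
have [s hs] : exists s, forall j, 0 <= v (t ^+ s * f`_j).
  have : forall j, exists s, 0 <= v (t ^+ s * f`_j).
    move=> j; have [->|h] := eqVneq f`_j 0.
      by exists 0%N; rewrite mulr0 (Defs.val0 hv).
    have h' : (f`_j)^-1 != 0 by rewrite invr_eq0.
    by have [s] := val_unit_decomp h'; rewrite invrK; exists s.
  move=> /choice[s hs]; exists (\sum_(j < size f) s j)%N => j.
  case: (ltnP j (size f)) => [hj|hj]; last by rewrite nth_default // mulr0 (Defs.val0 hv).
  rewrite (bigD1 (Ordinal hj)) //= addnC exprD -mulrA; apply/(val_ge0P hv).
  by rewrite -[X in val_ge _ X]addr0; apply: (val_geM hv); right; rewrite ?(val_ofXt hK).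
pose g := t ^+ s *: f.
have g0 : g != 0 by rewrite scaler_eq0 negb_or expf_neq0.
have gv j : 0 <= v g`_j by rewrite coefZ.
have gx : root (map_poly i g) x by rewrite map_polyZ rootZ // fmorph_eq0 expf_neq0.
have sg1 : (1 < size g)%N.
  rewrite ltn_neqAle size_poly_gt0 g0 andbT eq_sym; apply/negP => /size_poly1P[c c0 e].
  by move: gx; rewrite e map_polyC rootC fmorph_eq0; apply/negP.
move: {hs f f0 fx s} g g0 gv gx sg1 => f f0 fv fx sf.
pose c := lead_coef f; have c0 : c != 0 by rewrite lead_coef_eq0.
pose n := (size f).-1.
have sfn : size f = n.+1 by rewrite /n prednK // ltnW.
have n0 : (0 < n)%N by rewrite /n -subn1 subn_gt0.
suff h : O (i c * x).
  have [s hs] := val_unit_decomp c0; exists s.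
  have -> : T ^+ s * x = i (t ^+ s / c) * (i c * x).
    by rewrite mulrA -rmorphM divfK // rmorphXn.
  exact/OM/h/O_iota.
have ci : i c = (map_poly i f)`_n by rewrite coef_map.
have [] := @scaled_root _ (map_poly i f) n x n0; rewrite ?size_map_poly ?sfn //.
rewrite -ci => gm gx; apply: (O_closed gm gx) => j.
rewrite coefD coef_poly coefXn; apply: OD; last by case: eqP => _; [apply: O1|apply: O0].
case: ifP => _; last exact: O0.
by rewrite coef_map; apply: OM; [apply/O_iota/fv | apply/OX/O_iota/fv].
Qed.

(** Some [T ^+ s / x] is integral; multiplied by [x / T ^+ s.+1] it would make the inverse of [t]
    integral. *)
Lemma T_separated x : (forall s, O (x / T ^+ s)) -> x = 0.
Proof.
move=> h; apply/eqP/negPn/negP => x0.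
have [s hs] := O_absorb x^-1.
have := OM hs (h s.+1).
have -> : T ^+ s / x * (x / T ^+ s.+1) = i t^-1.
  rewrite fmorphV exprS; have hT := T_neq0.
  by move: (expf_neq0 s hT); move: (T ^+ s) => Ts hTs; field; rewrite x0 hT hTs.
by rewrite O_iotaE (val_ofV hv) // vt.
Qed.

Variables (ell : nat) (hell : ell \in [pchar Ks]).

(** * Limits and congruences in a monogenic extension of the integers of [K] *)

Section Monogenic.
Variables (x : Ks) (f : {poly OK}) (fm : f \is monic).
Hypothesis fx : root (map_poly iota f) x.

(* [OK[x]], which is finite over the complete ring [OK]. *)
Let B y := exists g : {poly OK}, (map_poly iota g).[x] = y.

Let BO y : B y -> O y.
Proof.
case=> g <-; apply/sep_integerP; apply: integral_horner.
  by apply/integral_poly => j; rewrite coef_map; apply: (integral_id iota).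
by exists f.
Qed.

Let BD y z : B y -> B z -> B (y + z).
Proof. by move=> [g <-] [h <-]; exists (g + h); rewrite rmorphD hornerD. Qed.
Let BN y : B y -> B (- y).
Proof. by move=> [g <-]; exists (- g); rewrite rmorphN hornerN. Qed.
Let BM y z : B y -> B z -> B (y * z).
Proof. by move=> [g <-] [h <-]; exists (g * h); rewrite rmorphM hornerM. Qed.
Let B1 : B 1. Proof. by exists 1; rewrite rmorph1 hornerC. Qed.
Let BX y n : B y -> B (y ^+ n).
Proof. by move=> h; elim: n => [|n IH]; rewrite ?expr0 ?exprS //; apply: BM. Qed.
Let Bx : B x. Proof. by exists 'X; rewrite map_polyX hornerX. Qed.
Let Biota c : 0 <= v c -> B (i c).
Proof. by move=> /vr_lift[a <-]; exists a%:P; rewrite map_polyC hornerC. Qed.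

Let n := (size f).-1.

Let Bsmall y : B y -> exists c : 'I_n -> K,
  (forall j, 0 <= v (c j)) /\ y = \sum_j i (c j) * x ^+ j.
Proof.
case=> g <-; pose h := Pdiv.Ring.rmodp g f.
have hs : (size h <= n)%N.
  by rewrite -ltnS /n prednK ?size_poly_gt0 ?monic_neq0 // Pdiv.Ring.ltn_rmodpN0 ?monic_neq0.
exists (fun j => vr_val h`_j); split=> [j|]; first exact: vr_valP.
rewrite (Pdiv.RingMonic.rdivp_eq fm g) rmorphD rmorphM hornerD hornerM (rootP fx) mulr0 add0r.
rewrite (horner_coef_wide _ (n := n)); last exact: leq_trans (size_poly _ _) hs.
by apply: eq_bigr => j _; rewrite coef_map.
Qed.

Let Bsum (c : 'I_n -> K) : (forall j, 0 <= v (c j)) ->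
  B (\sum_j i (c j) * x ^+ j).
Proof.
move=> hc; elim/big_rec: _ => [|j y _ hy]; last exact/BD/hy/BM/BX/Bx/Biota.
by exists 0; rewrite rmorph0 horner0.
Qed.

(** The quotient of [B] by [T] is finite: [B] is spanned by [n] powers of [x] over the integers of
    [K], whose residue field is finite. *)
Lemma monogenic_pigeonhole (b : nat -> Ks) : (forall k, B (b k)) ->
  exists k l, (k < l)%N /\ exists2 y, B y & b k - b l = T * y.
Proof.
move=> hb; have [c hc] := choice (fun k => Bsmall (hb k)).
have [s hs] := local_residue hK.
have H k (j : 'I_n) : exists a : 'I_(size s), val_ge v 1 (c k j - s`_a).
  have [y ys hy] := hs (c k j) (or_intror ((hc k).1 j)).
  have h : (index y s < size s)%N by rewrite index_mem.
  by exists (Ordinal h); rewrite /= nth_index.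
have H' k : exists a : 'I_n -> 'I_(size s), forall j, val_ge v 1 (c k j - s`_(a j)).
  by have [a ha] := choice (H k); exists a.
have [a ha] := choice H'.
have [k [l [kl e]]] := pigeonhole_nat (fun k => [ffun j => a k j]).
exists k, l; split=> //.
exists (\sum_j i ((c k j - c l j) / t) * x ^+ j).
  apply: Bsum => j; rewrite -[t]expr1; apply: (val_ge_divXt hK) => //.
  have /ffunP/(_ j) := e; rewrite !ffunE => e'.
  have := ha l j; rewrite -e' => /(val_geN hv) h2.
  have := val_geD hv (ha k j) h2.
  by rewrite opprB addrA subrK.
rewrite (hc k).2 (hc l).2 -sumrB mulr_sumr; apply: eq_bigr => j _.
rewrite -mulrBl -rmorphB mulrA -rmorphM; congr (i _ * _).
by rewrite mulrC divfK.
Qed.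

(** The sum is formed on the coordinates in the powers of [x], where completeness of [K] applies. *)
Lemma monogenic_series (b : nat -> Ks) : (forall k, B (b k)) ->
  exists2 s, B s & forall m, exists2 r, B r &
    s - \sum_(k < m) T ^+ k * b k = T ^+ m * r.
Proof.
move=> hb; have [c hc] := choice (fun k => Bsmall (hb k)).
have H (j : 'I_n) : exists a, 0 <= v a /\
    forall m : nat, val_ge v m (a - \sum_(k < m) t ^+ k * c k j).
  have [a h1 h2] := series_complete hK t0 vt (c := fun k => c k j) (fun k => (hc k).1 j).
  by exists a.
have [a ha] := choice H.
exists (\sum_j i (a j) * x ^+ j); first by apply: Bsum => j; case: (ha j).
move=> m; exists (\sum_j i ((a j - \sum_(k < m) t ^+ k * c k j) / t ^+ m) * x ^+ j).
  by apply: Bsum => j; apply: (val_ge_divXt hK) => //; case: (ha j).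
have -> : \sum_(k < m) T ^+ k * b k = \sum_j i (\sum_(k < m) t ^+ k * c k j) * x ^+ j.
  under eq_bigr => k _ do rewrite (hc k).2 mulr_sumr.
  rewrite exchange_big; apply: eq_bigr => j _; rewrite rmorph_sum mulr_suml.
  by apply: eq_bigr => k _; rewrite rmorphM rmorphXn mulrA.
rewrite -sumrB mulr_sumr; apply: eq_bigr => j _.
rewrite -mulrBl -rmorphB mulrA -rmorphXn -rmorphM; congr (i _ * _).
by rewrite mulrC divfK // expf_neq0.
Qed.

Lemma monogenic_limit (u : nat -> Ks) : B (u 0%N) ->
  (forall k, exists2 r, B r & u k.+1 - u k = T ^+ k * r) ->
  exists2 s, B s & forall m, exists2 r, B r & s - u m = T ^+ m * r.
Proof.
move=> h0 h; have H k : exists r, B r /\ u k.+1 - u k = T ^+ k * r.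
  by have [r] := h k; exists r.
have [r hr] := choice H.
have [s Bs hs] := monogenic_series (fun k => (hr k).1).
exists (u 0%N + s) => [|m]; first exact: BD.
have [y By e] := hs m; exists y => //; rewrite -e.
have -> : \sum_(k < m) T ^+ k * r k = u m - u 0%N; last by ring.
elim: m {y By e} => [|m IH]; first by rewrite big_ord0 subrr.
by rewrite big_ord_recr /= IH -(hr m).2; ring.
Qed.

Let BT k : B (T ^+ k). Proof. by apply/BX/Biota; rewrite vt. Qed.

Lemma monogenic_separated y : (forall m, exists2 r, B r & y = T ^+ m * r) -> y = 0.
Proof.
move=> h; apply: T_separated => s; have [r Br ->] := h s.
by rewrite mulrAC divff ?mul1r ?expf_neq0 ?T_neq0 //; apply: BO.
Qed.

Lemma monogenic_unit r : B r -> exists2 s, B s & (1 - T * r) * s = 1.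
Proof.
move=> Br; have [s Bs hs] := monogenic_series (fun k => BX k Br).
exists s => //; apply/eqP; rewrite -subr_eq0; apply/eqP/monogenic_separated => m.
have [y By e] := hs m.
exists ((1 - T * r) * y - r ^+ m).
  exact: (BD (BM (BD B1 (BN (BM (BT 1) Br))) By) (BN (BX m Br))).
rewrite mulrBr mulrCA -e mulrBr.
under eq_bigr => k _ do rewrite -exprMn.
by rewrite -[in X in _ - X - _](opprB (T * r)) mulNr -subrX1 exprMn; ring.
Qed.

Let C a b := exists2 r, B r & a - b = T * r.
Let Csym a b : C a b -> C b a.
Proof. by case=> r Br e; exists (- r); [apply: BN | rewrite mulrN -e opprB]. Qed.
Let Ctrans a b c : C a b -> C b c -> C a c.
Proof.
case=> r Br e [r' Br' e']; exists (r + r'); first exact: BD.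
by rewrite mulrDr -e -e' addrA subrK.
Qed.
Let CM a b c : B c -> C a b -> C (a * c) (b * c).
Proof.
by move=> Bc [r Br e]; exists (r * c); [apply: BM | rewrite -mulrBl e mulrA].
Qed.
Let Crefl a : C a a.
Proof. by exists 0; [have := BD B1 (BN B1); rewrite subrr | rewrite subrr mulr0]. Qed.

(** A form of Hensel's lemma. Powers of [y] are eventually periodic modulo [T], so one of them is
    idempotent modulo [T]. Its [ell ^ m]-th powers converge, because Frobenius turns a difference
    divisible by [T] into one divisible by [T ^+ (ell ^ m)]; the limit is a true idempotent, which
    in a field is 0 or 1. *)
Lemma monogenic_idempotent y : B y ->
  exists M, (0 < M)%N /\ (C (y ^+ M) 0 \/ C (y ^+ M) 1).
Proof.
move=> By; have [k [l [kl [r0 Br0 e0]]]] := monogenic_pigeonhole (fun k => BX k By).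
pose d := (l - k)%N; have d0 : (0 < d)%N by rewrite subn_gt0.
have h1 m : (k <= m)%N -> C (y ^+ m) (y ^+ (m + d)).
  move=> km; have -> : (m + d = l + (m - k))%N by rewrite /d; lia.
  rewrite -[in X in C X](subnKC km) !exprD.
  by apply: CM; [apply: BX | exists r0].
have h2 m j : (k <= m)%N -> C (y ^+ m) (y ^+ (m + j * d)).
  move=> km; elim: j => [|j IH]; first by rewrite mul0n addn0; apply: Crefl.
  apply: Ctrans IH _; rewrite mulSnr addnA; apply: h1.
  exact: leq_trans km (leq_addr _ _).
(* A positive multiple of the period [d] beyond the preperiod [k], so that all positive powers of
   [y ^+ N] agree modulo [T]. *)
pose N := (k.+1 * d)%N.
have N0 : (0 < N)%N by rewrite muln_gt0.
have hN j : C (y ^+ N) ((y ^+ N) ^+ j.+1).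
  rewrite -exprM mulnS /N [(_ * j)%N]mulnC mulnA; apply: h2.
  by rewrite (leq_trans (leqnSn k)) // leq_pmulr.
pose e1 := y ^+ N; have Be1 : B e1 by apply: BX.
have p1 : (1 < ell)%N by apply/prime_gt1/(pcharf_prime hell).
have [r1 Br1 E1] := hN ell.-1.
have [r2 Br2 E2] := hN 1%N.
have hk m : (m <= ell ^ m)%N by apply/ltnW/ltn_expl.
have [||e Be he] := @monogenic_limit (fun m => e1 ^+ (ell ^ m)).
- by rewrite expn0 expr1.
- move=> m; exists (T ^+ (ell ^ m - m) * (- r1) ^+ (ell ^ m)).
    exact: (BM (BT _) (BX _ (BN Br1))).
  rewrite mulrA -exprD subnKC // -exprMn mulrN -E1 opprB prednK ?(ltnW p1) //.
  by rewrite pchar_exprB // expnS exprM.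
have ee : e * e = e.
  apply/eqP; rewrite -subr_eq0; apply/eqP/monogenic_separated => m.
  have [r Br E] := he m.
  exists (r * (e + e1 ^+ (ell ^ m) - 1) + T ^+ (ell ^ m - m) * (- r2) ^+ (ell ^ m)).
    apply: BD; last exact: (BM (BT _) (BX _ (BN Br2))).
    exact: (BM Br (BD (BD Be (BX _ Be1)) (BN B1))).
  rewrite mulrDr [T ^+ m * (r * _)]mulrA -E [T ^+ m * (T ^+ _ * _)]mulrA -exprD subnKC //.
  rewrite -exprMn mulrN -E2 opprB pchar_exprB //.
  by rewrite -/e1 [_ ^+ 2 ^+ _]exprAC; ring.
have [r Br E] := he 1%N; rewrite expr1 in E.
exists (N * ell ^ 1)%N; split; first by rewrite muln_gt0 N0 expn_gt0 (ltnW p1).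
have /eqP : e * (e - 1) = 0 by rewrite mulrBr ee mulr1 subrr.
rewrite mulf_eq0 subr_eq0 exprM => /orP[] /eqP e01; [left|right];
  by apply: Csym; exists r => //; rewrite -E e01.
Qed.

(** Two Frobenius iterates of [y] agree modulo [T]; up to sign their difference is the [ell ^ k]-th
    power of [y ^+ (ell ^ (l - k)) - y]. *)
Lemma monogenic_residue y : B y -> exists m M, [/\ (0 < m)%N, (0 < M)%N & C ((y ^+ (ell ^ m) - y) ^+ M) 0].
Proof.
move=> By; have [k [l [kl [r0 Br0 e0]]]] := monogenic_pigeonhole (fun k => BX (ell ^ k) By).
exists (l - k)%N, (ell ^ k)%N; split; first by rewrite subn_gt0.
  by rewrite expn_gt0 prime_gt0 // (pcharf_prime hell).
rewrite pchar_exprB // -exprM -expnD subnK ?(ltnW kl) //.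
by exists (- r0); [apply: BN | rewrite subr0 mulrN -e0 opprB].
Qed.

End Monogenic.
End IntegralClosure.

Section ValuationRing.
Variables (K Ks : fieldType) (v : K -> int) (i : {rmorphism K -> Ks}).
Hypothesis hK : local_field v.
Local Notation O := (sep_integer v i).
Local Notation P := (sep_maximal v i).
Variables (t : K) (t0 : t != 0) (vt : v t = 1).
Local Notation T := (i t).
Hypothesis halg : forall x : Ks,
  exists2 f : {poly K}, f != 0 & root (map_poly i f) x.
Variables (ell : nat) (hell : ell \in [pchar Ks]).

Let O0 := O0 i hK.
Let O1 := O1 i hK.
Let OM := @OM _ _ _ i hK.
Let OB := @OB _ _ _ i hK.
Let OD := @OD _ _ _ i hK.
Let ON := @ON _ _ _ i hK.
Let OX := @OX _ _ _ i hK.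
Let T0 : T != 0. Proof. by rewrite fmorph_eq0. Qed.

Lemma O_T : O T.
Proof. by apply: (O_iota i hK); rewrite vt. Qed.

Let sub y : O y -> exists f : {poly valring (local_val hK)}, f \is monic /\
  root (map_poly (i \o @vr_val _ _ (local_val hK)) f) y.
Proof. by move=> /(sep_integerP i hK)[f]; exists f. Qed.

Let OB_sub y (g : {poly valring (local_val hK)}) : O y ->
  O (map_poly (i \o @vr_val _ _ (local_val hK)) g).[y].
Proof.
move=> /(sep_integerP i hK) hy; apply/(sep_integerP i hK); apply: integral_horner => //.
by apply/integral_poly => j; rewrite coef_map; apply: (integral_id (i \o @vr_val _ _ (local_val hK))).
Qed.

Lemma O_geometric_unit r : O r -> exists2 s, O s & (1 - T * r) * s = 1.
Proof.
move=> Or; have [f [fm fr]] := sub Or.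
have [|s [g <-] e] := @monogenic_unit _ _ _ i hK _ t0 vt halg _ _ fm fr r.
  by exists 'X; rewrite map_polyX hornerX.
by eexists; last exact: e; apply: OB_sub.
Qed.

Lemma O_power_dichotomy y : O y -> exists M, (0 < M)%N /\
  (O (y ^+ M / T) \/ O ((y ^+ M - 1) / T)).
Proof.
move=> Oy; have [f [fm fr]] := sub Oy.
have [|M [M0 [[s [g <-] e]|[s [g <-] e]]]] := @monogenic_idempotent _ _ _ i hK _ t0 vt halg _ hell _ _ fm fr y.
- by exists 'X; rewrite map_polyX hornerX.
- exists M; split=> //; left; move: e; rewrite subr0 => ->.
  by rewrite mulrAC divff // mul1r; apply: OB_sub.
- by exists M; split=> //; right; rewrite e mulrAC divff // mul1r; apply: OB_sub.
Qed.

Lemma O_residue_nilpotent y : O y -> exists m M, [/\ (0 < m)%N, (0 < M)%N &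
  O ((y ^+ (ell ^ m) - y) ^+ M / T)].
Proof.
move=> Oy; have [f [fm fr]] := sub Oy.
have [|m [M [m0 M0 [s [g <-] e]]]] := @monogenic_residue _ _ _ i hK _ t0 vt _ hell _ _ fm fr y.
- by exists 'X; rewrite map_polyX hornerX.
- exists m, M; split=> //; move: e; rewrite subr0 => ->.
  by rewrite mulrAC divff // mul1r; apply: OB_sub.
Qed.

Definition ounit x := [/\ x != 0, O x & O x^-1].

Lemma ounitI x y : O x -> O y -> x * y = 1 -> ounit x.
Proof.
move=> Ox Oy e; have x0 : x != 0.
  by apply: contra_eq_neq e => ->; rewrite mul0r eq_sym oner_neq0.
by split=> //; rewrite -[x^-1]mulr1 -e mulKf.
Qed.

Lemma ounit1 : ounit 1. Proof. by split; rewrite ?invr1 ?oner_neq0 //; apply: O1. Qed.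
Lemma ounitM x y : ounit x -> ounit y -> ounit (x * y).
Proof.
by move=> [x0 h1 h2] [y0 h3 h4]; split; rewrite ?mulf_neq0 ?invfM //; apply: OM.
Qed.
Lemma ounitV x : ounit x -> ounit x^-1.
Proof. by move=> [x0 h1 h2]; split; rewrite ?invr_eq0 ?invrK. Qed.
Lemma ounitX x n : ounit x -> ounit (x ^+ n).
Proof.
move=> h; elim: n => [|n IH]; rewrite ?expr0 ?exprS; first exact: ounit1.
exact: ounitM.
Qed.
Lemma ounitMl x y : O x -> O y -> ounit (x * y) -> ounit x.
Proof.
move=> Ox Oy [h1 h2 h3]; apply: (@ounitI _ (y * (x * y)^-1)) => //; first exact: OM.
by rewrite mulrA mulfV.
Qed.

(** If [T] divides [y ^+ M], then [1 - y ^+ M] is a unit and [1 - y] divides it; otherwise [y ^+ M]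
    is 1 plus a multiple of [T], hence a unit divisible by [y]. *)
Lemma O_local y : O y -> ounit y \/ ounit (1 - y).
Proof.
move=> Oy; have [M [M0 h]] := O_power_dichotomy Oy.
have yM : y ^+ M = y * y ^+ M.-1 by rewrite -exprS prednK.
case: h => h; [right|left].
  have [s Os] := O_geometric_unit h; rewrite (mulrC T) divfK // => e.
  apply: (@ounitI _ ((\sum_(k < M) y ^+ k) * s)).
  - exact: OB.
  - by apply: OM => //; apply: (Osum hK) => k _; apply: OX.
  - by rewrite mulrA -[1 - y]opprB mulNr -subrX1 opprB.
have [s Os] := O_geometric_unit (ON h).
rewrite mulrN opprK (mulrC T) divfK // subrKC => e.
apply: (@ounitI _ (y ^+ M.-1 * s)) => //; first by apply/OM/Os/OX.
by rewrite mulrA -yM.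
Qed.

Lemma ounitD u z : ounit u -> O z -> ~ ounit z -> ounit (u + z).
Proof.
move=> hu Oz hz; have [u0 Ou Ou'] := hu.
have -> : u + z = u * (1 - - (z / u)) by rewrite opprK mulrDr mulr1 mulrCA divff ?mulr1.
apply: ounitM => //.
have [h|//] := O_local (ON (OM Oz Ou')).
case: hz; have -> : z = (-1) * u * - (z / u) by field.
apply: ounitM h; apply: ounitM hu.
by split; rewrite ?invrN1 ?oppr_eq0 ?oner_neq0 //; apply/ON/O1.
Qed.

(* Seidenberg's argument: one lowers the degree of the equation, the leading
   coefficient times [x] being integral. *)
Lemma O_root_total n (f : {poly Ks}) j x : (size f <= n.+1)%N ->
  (forall j, O f`_j) -> ounit f`_j -> root f x -> x != 0 ->
  O x \/ O x^-1.
Proof.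
elim: n f j => [|m IH] f j sf Of hj fx x0.
  move: fx; rewrite (size1_polyC sf) rootC => /eqP c0.
  by case: hj; rewrite (size1_polyC sf) c0 polyC0 coef0 eqxx.
have [gm gx] := scaled_root (ltn0Sn m) sf fx.
have Oz : O (f`_m.+1 * x).
  apply: (O_closed hK gm gx) => l.
  rewrite coefD coef_poly coefXn; apply: OD; last by case: eqP => _; [apply: O1|apply: O0].
  by case: ifP => _; [apply/OM/OX | apply: O0].
set a := f`_m.+1 in Oz gm gx *.
have [[a0 _ a']|na] := pselect (ounit a).
  by left; have -> : x = a^-1 * (a * x) by [rewrite mulKf]; apply: OM.
have [[z0 _ z']|nz] := pselect (ounit (a * x)).
  right; have -> : x^-1 = a * (a * x)^-1; last by apply: OM => //; apply: Of.
  by field; rewrite x0; apply: contraNneq z0 => ->; rewrite mul0r.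
(* The top term is absorbed into the next one by [a * x ^+ m.+1 = (a * x) * x ^+ m]. Both [a] and
   [a * x] are non-units here, so the unit coefficient of index [j] survives. *)
pose f' := \poly_(l < m.+1) (f`_l + (if l == m then a * x else 0)).
apply: (IH f' j) => //; first exact: size_poly.
- move=> l; rewrite coef_poly; case: ifP => _; last exact: O0.
  by apply: OD => //; case: ifP => _ //; apply: O0.
- rewrite coef_poly; case: ltngtP => [h|h|h].
  + case: eqP => e; last by rewrite addr0.
    exact: ounitD.
  + by case: hj; rewrite nth_default ?eqxx // (leq_trans sf).
  + by case: na; rewrite /a -h.
- move: fx; rewrite /root (horner_coef_wide _ sf) big_ord_recr /= => /eqP e.
  rewrite (horner_coef_wide _ (size_poly _ _)); apply/eqP; rewrite -[RHS]e.
  rewrite (eq_bigr (fun l : 'I_m.+1 => f`_l * x ^+ l +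
      (if l == m :> nat then a * x else 0) * x ^+ l)); last first.
    by move=> l _; rewrite coef_poly ltn_ord mulrDl.
  rewrite big_split /=; congr (_ + _).
  rewrite big_ord_recr /= eqxx big1 ?add0r ?exprS ?mulrA // => l _.
  by rewrite ltn_eqF ?mul0r.
Qed.

(** Dividing an equation of [x] by its coefficient of least valuation makes it integral with one
    coefficient equal to 1, the situation of [O_root_total]. *)
Lemma O_total x : x != 0 -> O x \/ O x^-1.
Proof.
move=> x0; have [f f0 fx] := halg x.
have sf : (0 < size f)%N by rewrite size_poly_gt0.
have hs : ((size f).-1 < size f)%N by rewrite prednK.
have hj0 : f`_(Ordinal hs) != 0 by rewrite /= -lead_coefE lead_coef_eq0.
have [j hj hmin] : exists2 j : 'I_(size f), f`_j != 0 &
    forall l, f`_l != 0 -> v f`_j <= v f`_l.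
  case: (@arg_minP _ _ _ _ (fun j : 'I_(size f) => f`_j != 0) (fun j => v f`_j) hj0) => j hj hm.
  exists j => // l hl; case: (ltnP l (size f)) => h; last by rewrite nth_default ?eqxx in hl.
  exact: (hm (Ordinal h)).
pose g := map_poly i ((f`_j)^-1 *: f).
have hg l : O g`_l.
  rewrite coef_map coefZ; apply: (O_iota i hK).
  have [->|hl] := eqVneq f`_l 0; first by rewrite mulr0 (Defs.val0 (local_val hK)).
  rewrite (Defs.valM (local_val hK)) ?invr_eq0 // (val_ofV (local_val hK)) //.
  by rewrite addrC subr_ge0 hmin.
apply: (@O_root_total (size g) g j) => //.
  by rewrite coef_map coefZ /= mulVf // rmorph1; apply: ounit1.
by rewrite /g linearZ /= rootZ // fmorph_eq0 invr_eq0.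
Qed.

Lemma maxE x : P x <-> O x /\ ~ ounit x.
Proof.
split=> [[Ox [->|h]]|[Ox h]]; split=> //.
- by case; rewrite eqxx.
- by case.
- have [->|x0] := eqVneq x 0; [by left | right => h'; exact: h].
Qed.

Lemma max0 : P 0. Proof. by split; [apply: O0|left]. Qed.
Lemma max_O x : P x -> O x. Proof. by case. Qed.
Lemma maxMl x y : O x -> P y -> P (x * y).
Proof.
move=> Ox /maxE[Oy h]; apply/maxE; split; first exact: OM.
by rewrite mulrC => /(ounitMl Oy Ox).
Qed.
Lemma maxMr x y : P x -> O y -> P (x * y).
Proof. by rewrite mulrC => hx hy; apply: maxMl. Qed.
Lemma maxN x : P x -> P (- x).
Proof. by rewrite -mulN1r => h; apply: maxMl => //; apply/ON/O1. Qed.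
Lemma maxD x y : P x -> P y -> P (x + y).
Proof.
have [->|x0] := eqVneq x 0; first by rewrite add0r.
have [->|y0] := eqVneq y 0; first by rewrite addr0.
move=> hx hy.
have xy0 : x / y != 0 by rewrite mulf_neq0 ?invr_eq0.
have [h|h] := O_total xy0.
- have -> : x + y = (x / y + 1) * y by field.
  by apply: maxMl => //; apply: OD h O1.
- rewrite invf_div in h; have -> : x + y = (y / x + 1) * x by field.
  by apply: maxMl => //; apply: OD h O1.
Qed.
Lemma maxB x y : P x -> P y -> P (x - y).
Proof. by move=> hx hy; apply/maxD/maxN. Qed.
Lemma max_sum I (r : seq I) (Q : pred I) (F : I -> Ks) :
  (forall j, Q j -> P (F j)) -> P (\sum_(j <- r | Q j) F j).
Proof. by move=> h; elim/big_rec: _ => [|j x Qj]; [apply: max0 | apply/maxD/h]. Qed.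
Lemma max1 : ~ P 1.
Proof. by move=> /maxE[_]; apply; apply: ounit1. Qed.
Lemma max_prime x y : O x -> O y -> P (x * y) -> P x \/ P y.
Proof.
move=> Ox Oy /maxE[_ h]; have [hx|hx] := pselect (ounit x); [right|left; exact/maxE].
by apply/maxE; split=> // hy; apply/h/ounitM.
Qed.
Lemma max_prod (I : eqType) (r : seq I) (F : I -> Ks) :
  (forall j, j \in r -> O (F j)) -> P (\prod_(j <- r) F j) ->
  exists2 j, j \in r & P (F j).
Proof.
elim: r => [|a r IH] h; first by rewrite big_nil => /max1.
have hO : forall j, j \in r -> O (F j) by move=> j hj; apply: h; rewrite inE hj orbT.
rewrite big_cons => hP; case: (max_prime _ _ hP).
- by apply: h; rewrite mem_head.
- by rewrite big_seq; elim/big_rec: _ => [|j x hj]; [apply: O1 | apply/OM/hO].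
- by exists a; rewrite ?mem_head.
- by move=> /(IH hO)[j hj hP']; exists j => //; rewrite inE hj orbT.
Qed.
Lemma maxX x n : O x -> P (x ^+ n) -> P x.
Proof.
move=> Ox; elim: n => [|n IH]; first by rewrite expr0 => /max1.
by rewrite exprS => /(max_prime Ox (OX n Ox))[].
Qed.
Lemma ounitND u z : ounit u -> P z -> ounit (u + z).
Proof. by move=> hu /maxE[Oz hz]; apply: ounitD. Qed.

Lemma max_T : P T.
Proof.
apply/maxE; split; first exact: O_T.
case=> _ _; rewrite -fmorphV (O_iotaE i hK) (val_ofV (local_val hK)) //.
by rewrite vt.
Qed.
Lemma max_divT x : O (x / T) -> P x.
Proof. by move=> h; have -> : x = (x / T) * T; [rewrite divfK | exact/maxMl/max_T]. Qed.
(** No element of [P] has a positive power congruent to 1 modulo [T], so the dichotomy leaves only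
    divisibility by [T]; this is the archimedean property of the values. *)
Lemma max_nilp x : P x -> exists2 M, (0 < M)%N & O (x ^+ M / T).
Proof.
move=> hx; have [M [M0 [h|h]]] := O_power_dichotomy (max_O hx); first by exists M.
case: (max1); have -> : 1 = x ^+ M - (x ^+ M - 1) by rewrite opprB subrKC.
apply: maxB; last exact: max_divT.
by rewrite -(prednK M0) exprS; apply: maxMr => //; apply/OX/max_O.
Qed.
Lemma max_residue y : O y -> exists2 m, (0 < m)%N & P (y ^+ (ell ^ m) - y).
Proof.
move=> Oy; have [m [M [m0 M0 h]]] := O_residue_nilpotent Oy; exists m => //.
by apply: maxX (max_divT h); apply/OB/Oy/OX.
Qed.

End ValuationRing.

(** * Extension of automorphisms and ramification *)

Lemma rmorphism_exists (R S : pzRingType) (f : R -> S) :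
  zmod_morphism f -> monoid_morphism f -> exists s : {rmorphism R -> S}, s =1 f.
Proof.
move=> fB fM.
pose m1 := GRing.isZmodMorphism.Build _ _ f fB.
pose m2 := GRing.isMonoidMorphism.Build _ _ f fM.
pose s : {rmorphism R -> S} := HB.pack f m1 m2.
by exists s.
Qed.

Lemma roots_seq (R : fieldType) (f : {poly R}) : f != 0 ->
  exists2 rs : seq R, uniq rs & forall y, (y \in rs) = root f y.
Proof.
have [n] := ubnP (size f); elim: n f => // n IH f hf f0.
have [[a fa]|h] := pselect (exists a, root f a); last first.
  by exists [::] => // y; rewrite in_nil; apply/esym/negbTE/negP => hy; apply: h; exists y.
have /factor_theorem[q e] := fa.
have q0 : q != 0 by apply: contraNneq f0 => q0; rewrite e q0 mul0r.
have [|rs us hrs] := IH q _ q0.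
  by move: hf; rewrite e size_mul ?polyXsubC_eq0 // size_XsubC addn2 /= ltnS.
exists (undup (a :: rs)) => [|y]; first exact: undup_uniq.
by rewrite mem_undup inE hrs e rootM root_XsubC orbC.
Qed.

(** After removal of the factor ['X^m] the constant term is nonzero, and the equation can be solved
    for the inverse. It has to be a polynomial in [x] over [K], so that a relation closed under ring
    operations contains it. *)
Lemma algebraic_inverse (K L : fieldType) (i : {rmorphism K -> L}) (f : {poly K}) x :
  f != 0 -> root (map_poly i f) x -> x != 0 ->
  exists g : {poly K}, x * (map_poly i g).[x] = 1.
Proof.
move=> f0 fx x0; have [m [h]] := multiplicity_XsubC f 0; rewrite f0 /= => hh e.
have hx : root (map_poly i h) x.
  move: fx; rewrite e rmorphM rmorphXn rmorphB /= map_polyX map_polyC /= rmorph0 subr0.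
  by rewrite rootM /root hornerXn expf_eq0 (negbTE x0) andbF orbF.
pose c := h.[0]; have c0 : c != 0 by exact: hh.
have : root (h - c%:P) 0 by rewrite /root !hornerE subrr.
move=> /factor_theorem[q]; rewrite subr0 => eq.
exists (- (c^-1 *: q)).
have eh : h = q * 'X + c%:P by rewrite -eq subrK.
move: hx; rewrite eh rmorphD rmorphM /= map_polyX map_polyC /root !hornerE /=.
rewrite addr_eq0 => /eqP e2.
rewrite rmorphN /= map_polyZ !hornerE mulrN mulrCA (mulrC x) e2 mulrN opprK -rmorphM mulVf //.
exact: rmorph1.
Qed.

(** * Galois theory of [Ks] through graphs of partial automorphisms *)

Section Galois.
Variables (K Ks : fieldType) (i : {rmorphism K -> Ks}).
Hypothesis hKs : separable_closure i.

Lemma sepclosure_alg x : exists2 f : {poly K}, f != 0 & root (map_poly i f) x.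
Proof.
by have [f fs fx] := (hKs.1 x); exists f => //; apply: separable_poly_neq0.
Qed.

Lemma conjugates_finite x : exists2 rs : seq Ks, uniq rs &
  forall s, galois_aut i s -> s x \in rs.
Proof.
have [f f0 fx] := sepclosure_alg x.
have f0' : map_poly i f != 0 by rewrite map_poly_eq0.
have [rs urs hrs] := roots_seq f0'; exists rs => // s [_ hs].
by rewrite hrs; move: fx => /(rmorph_root s); rewrite -map_poly_comp (eq_map_poly (g := i)).
Qed.

(** A [K]-embedding permutes the finitely many roots of each polynomial over [K], so it is onto. *)
Lemma galois_autP (s : {rmorphism Ks -> Ks}) : (forall c, s (i c) = i c) -> galois_aut i s.
Proof.
move=> hs; split=> //.
have surj y : exists x, s x = y.
  have [f f0 fy] := sepclosure_alg y.
  have f0' : map_poly i f != 0 by rewrite map_poly_eq0.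
  have [rs urs hrs] := roots_seq f0'.
  have hsub : {subset map s rs <= rs}.
    move=> _ /mapP[x hx ->]; move: hx; rewrite !hrs => /(rmorph_root s).
    by rewrite -map_poly_comp (eq_map_poly (g := i)).
  have us : uniq (map s rs) by rewrite map_inj_uniq //; apply: fmorph_inj.
  have [_ e] := uniq_min_size us hsub (eq_leq (esym (size_map s rs))).
  by have : y \in map s rs; [rewrite e hrs | move=> /mapP[x _ ->]; exists x].
have [g hg] := choice surj.
by exists g => x //; apply: (fmorph_inj s); rewrite hg.
Qed.

Lemma galois_id : galois_aut i (idfun : {rmorphism Ks -> Ks}).
Proof. exact: galois_autP. Qed.

Lemma galois_comp (s u : {rmorphism Ks -> Ks}) :
  galois_aut i s -> galois_aut i u -> galois_aut i (s \o u : {rmorphism Ks -> Ks}).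
Proof. by move=> [_ hs] [_ hu]; apply: galois_autP => c; rewrite /= hu hs. Qed.

Lemma galois_inv (s : {rmorphism Ks -> Ks}) : galois_aut i s ->
  exists u : {rmorphism Ks -> Ks}, [/\ galois_aut i u, cancel s u & cancel u s].
Proof.
case=> [[g gK sK] hs].
have [||u hu] := @rmorphism_exists _ _ g.
- by move=> x y; apply: (fmorph_inj s); rewrite sK rmorphB /= !sK.
- split=> [|x y]; apply: (fmorph_inj s); first by rewrite sK rmorph1.
  by rewrite sK rmorphM /= !sK.
exists u; split=> [|x|x]; rewrite ?hu //.
by apply: galois_autP => c; rewrite hu -[in LHS](hs c) gK.
Qed.

(* The graph of a partial [K]-automorphism of [Ks] defined on a subring. *)
Definition field_graph (G : Ks * Ks -> Prop) : Prop :=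
  [/\ forall c, G (i c, i c),
      forall x y, G x -> G y -> G (x - y),
      forall x y, G x -> G y -> G (x * y) &
      forall b, G (0, b) -> b = 0].

Section Step.
Variables (G : Ks * Ks -> Prop) (hG : field_graph G).

Let Gi c : G (i c, i c). Proof. by case: hG. Qed.
Let GB x y : G x -> G y -> G (x - y). Proof. by case: hG => _ h _ _; apply: h. Qed.
Let GM x y : G x -> G y -> G (x * y). Proof. by case: hG => _ _ h _; apply: h. Qed.
Let G0r b : G (0, b) -> b = 0. Proof. by case: hG => _ _ _; apply. Qed.
Let G0 : G 0. Proof. by have := Gi 0; rewrite rmorph0. Qed.
Let G1 : G 1. Proof. by have := Gi 1; rewrite rmorph1. Qed.
Let GN x : G x -> G (- x). Proof. by rewrite -sub0r => h; apply: GB. Qed.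
Let GD x y : G x -> G y -> G (x + y).
Proof. by move=> hx hy; rewrite -[y]opprK; apply/GB/GN. Qed.
Let Gsum I (r : seq I) (P : pred I) (F : I -> Ks * Ks) :
  (forall j, P j -> G (F j)) -> G (\sum_(j <- r | P j) F j).
Proof. by move=> h; elim/big_rec: _ => [|j x Pj]; [apply: G0 | apply/GD/h]. Qed.
Let GX x n : G x -> G (x ^+ n).
Proof. by move=> h; elim: n => [|n IH]; rewrite ?expr0 ?exprS //; apply: GM. Qed.

Let Gpoly (g : {poly K}) a b : G (a, b) -> G ((map_poly i g).[a], (map_poly i g).[b]).
Proof.
move=> hab; rewrite !(@horner_coef_wide _ (size g)) ?size_poly //.
have -> : (\sum_(j < size g) (map_poly i g)`_j * a ^+ j,
           \sum_(j < size g) (map_poly i g)`_j * b ^+ j) =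
    \sum_(j < size g) ((i g`_j, i g`_j) * (a, b) ^+ j).
  rewrite [RHS]surjective_pairing; congr (_, _).
    rewrite (big_morph fst (id1 := 0) (op1 := +%R)) //; apply: eq_bigr => j _.
    by rewrite coef_map (rmorphM fst) (rmorphXn fst).
  rewrite (big_morph snd (id1 := 0) (op1 := +%R)) //; apply: eq_bigr => j _.
  by rewrite coef_map (rmorphM snd) (rmorphXn snd).
by apply: Gsum => j _; apply/GM/GX.
Qed.

(** The inverse of [a] is a polynomial in [a] over [K]; the same polynomial in [b] inverts [b],
    because [G] relates 0 only to 0. *)
Let Ginv a b : G (a, b) -> a != 0 -> exists2 c, G c & c * (a, b) = 1.
Proof.
move=> hab a0; have [f f0 fa] := sepclosure_alg a.
have [g hg] := algebraic_inverse f0 fa a0.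
exists ((map_poly i g).[a], (map_poly i g).[b]); first exact: Gpoly.
have := GB (GM hab (Gpoly g hab)) G1.
rewrite -[_ * _ - 1]/(a * _ - 1, b * _ - 1) hg subrr => /G0r/eqP.
rewrite subr_eq0 => /eqP hb.
by rewrite mulrC -[LHS]/(a * _, b * _) hg hb.
Qed.

(** A polynomial over the product ring is a polynomial over the domain of [G] paired with its image;
    [PG] puts the coefficients in [G], and [ev1], [ev2] evaluate the two components. *)
Local Notation poly2 := {poly (Ks * Ks)%type}.
Let PG (R : poly2) := forall j, G R`_j.
Let ev1 (R : poly2) x := (map_poly fst R).[x].
Let ev2 (R : poly2) x := (map_poly snd R).[x].

Let PGB R S : PG R -> PG S -> PG (R - S).
Proof. by move=> h h' j; rewrite coefB; apply: GB. Qed.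
Let PGD R S : PG R -> PG S -> PG (R + S).
Proof. by move=> h h' j; rewrite coefD; apply: GD. Qed.
Let PGM R S : PG R -> PG S -> PG (R * S).
Proof. by move=> h h' j; rewrite coefM; apply: Gsum => l _; apply: GM. Qed.
Let PGC c : G c -> PG c%:P.
Proof. by move=> h j; rewrite coefC; case: ifP => _. Qed.
Let PGX : PG 'X.
Proof. by move=> j; rewrite coefX; case: eqP. Qed.
Let PGXn n : PG 'X^n.
Proof. by move=> j; rewrite coefXn; case: eqP. Qed.
Let PGK (f : {poly K}) : exists R, [/\ PG R, map_poly fst R = map_poly i f &
  map_poly snd R = map_poly i f].
Proof.
exists (\poly_(j < size f) (i f`_j, i f`_j)); split.
- by move=> j; rewrite coef_poly; case: ifP.
- apply/polyP => j; rewrite !coef_map coef_poly; case: ltnP => //= h.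
  by rewrite nth_default ?rmorph0.
- apply/polyP => j; rewrite !coef_map coef_poly; case: ltnP => //= h.
  by rewrite nth_default ?rmorph0.
Qed.

Variable x : Ks.

(** A nonzero polynomial of least size vanishing at [x]. The product ring is not a domain, so the
    leading pair is inverted through [Ginv] to make it monic. *)
Let min_exists : exists P, [/\ PG P, P \is monic, ev1 P x = 0 &
  forall R, PG R -> ev1 R x = 0 -> (size R < size P)%N -> R = 0].
Proof.
pose Q n := `[< exists R, [/\ PG R, R != 0, ev1 R x = 0 & size R = n] >].
have [|n /asboolP[P [hP P0 hx sP]] hmin] := @ex_minnP Q.
  have [f f0 fx] := sepclosure_alg x; have [R [hR e1 e2]] := PGK f.
  exists (size R); apply/asboolP; exists R; split=> //.
    by apply: contraNneq f0 => R0; rewrite -(map_poly_eq0 i) -e1 R0 rmorph0.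
  by rewrite /ev1 e1; apply/rootP.
have : lead_coef P != 0 by rewrite lead_coef_eq0.
have := hP (size P).-1; rewrite -lead_coefE.
case e : (lead_coef P) => [a b] hab ab0.
have a0 : a != 0 by apply: contraNneq ab0 => a0; move: hab; rewrite a0 => /G0r->.
have [c hc ec] := Ginv hab a0.
have rc : GRing.lreg c.
  by apply: mulrI0_lreg => y hy; rewrite -[y]mul1r -ec mulrAC hy mul0r.
have hev : ev1 (c *: P) x = 0 by rewrite /ev1 map_polyZ hornerZ -[_.[x]]/(ev1 P x) hx mulr0.
exists (c *: P); split=> //.
- by move=> j; rewrite coefZ; apply: GM.
- by rewrite monicE lead_coef_lreg // e ec.
- move=> R hR eR; rewrite lreg_size // sP => hs; apply/eqP/negPn/negP => R0.
  have : (n <= size R)%N by apply: hmin; apply/asboolP; exists R.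
  by rewrite leqNgt hs.
Qed.

Let divide P R : PG P -> P \is monic -> PG R -> exists Q S,
  [/\ PG Q, PG S, R = Q * P + S & (size S < size P)%N].
Proof.
move=> hP mP; have [n] := ubnP (size R); elim: n R => // n IH R hn hR.
have [h|h] := ltnP (size R) (size P).
  by exists 0, R; rewrite mul0r add0r; split=> // j; rewrite coef0.
have sP : (0 < size P)%N by rewrite size_poly_gt0 monic_neq0.
pose A := (lead_coef R)%:P * 'X^(size R - size P).
have hA : PG A by apply: PGM; [apply/PGC/hR | apply: PGXn].
have [|Q [S [hQ hS e hs]]] := IH (R - A * P) _ (PGB hR (PGM hA hP)).
  apply: leq_ltn_trans (_ : (size R).-1 < n)%N; last first.
    by rewrite -ltnS prednK // (leq_trans sP).
  apply/leq_sizeP => j hj; rewrite coefB /A -mulrA coefCM coefXnM.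
  have [hj2|hj2] := ltnP (size R).-1 j.
    have r0 : R`_j = 0.
      have aux a c : (a.-1 < c -> a <= c)%N by lia.
      by apply: nth_default; apply: aux hj2.
    have p0 : P`_(j - (size R - size P)) = 0.
      have aux a b c : (a.-1 < c -> b <= a -> 0 < b -> b <= c - (a - b))%N by lia.
      by apply: nth_default; apply: aux hj2 h sP.
    by rewrite r0 p0 if_same mulr0 subrr.
  have -> : j = (size R).-1 by apply/eqP; rewrite eqn_leq hj hj2.
  rewrite -lead_coefE; case: ltnP => hj3; first
    by have aux a b : (a.-1 < a - b -> b <= a -> 0 < b -> False)%N by [lia]; case: (aux _ _ hj3 h sP).
  have -> : ((size R).-1 - (size R - size P) = (size P).-1)%N
    by have aux a b : (b <= a -> 0 < b -> a.-1 - (a - b) = b.-1)%N by [lia]; apply: aux h sP.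
  by rewrite -lead_coefE (monicP mP) mulr1 subrr.
exists (A + Q), S; split=> //; first exact: PGD.
by rewrite mulrDl -addrA -e subrKC.
Qed.

Let ev1M R S z : ev1 (R * S) z = ev1 R z * ev1 S z.
Proof. by rewrite /ev1 rmorphM hornerM. Qed.
Let ev2M R S z : ev2 (R * S) z = ev2 R z * ev2 S z.
Proof. by rewrite /ev2 rmorphM hornerM. Qed.
Let ev1B R S z : ev1 (R - S) z = ev1 R z - ev1 S z.
Proof. by rewrite /ev1 rmorphB hornerD hornerN. Qed.
Let ev2B R S z : ev2 (R - S) z = ev2 R z - ev2 S z.
Proof. by rewrite /ev2 rmorphB hornerD hornerN. Qed.
Let ev1D R S z : ev1 (R + S) z = ev1 R z + ev1 S z.
Proof. by rewrite /ev1 rmorphD hornerD. Qed.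
Let ev1C c z : ev1 c%:P z = c.1. Proof. by rewrite /ev1 map_polyC hornerC. Qed.
Let ev2C c z : ev2 c%:P z = c.2. Proof. by rewrite /ev2 map_polyC hornerC. Qed.

(* The conjugates of [x] over the domain of [G] are the roots of [map_poly snd P],
   where [P] is the minimal polynomial. *)
Let extend_root P y : PG P -> P \is monic -> ev1 P x = 0 ->
  (forall R, PG R -> ev1 R x = 0 -> (size R < size P)%N -> R = 0) ->
  ev2 P y = 0 ->
  exists G', [/\ field_graph G', forall z, G z -> G' z & G' (x, y)].
Proof.
move=> hP mP ex hmin ey.
exists (fun z => exists2 R, PG R & z = (ev1 R x, ev2 R y)); split.
- split.
  + by move=> c; exists ((i c, i c)%:P); [apply: PGC | rewrite ev1C ev2C].
  + move=> _ _ [R hR ->] [S hS ->]; exists (R - S); first exact: PGB.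
    by rewrite ev1B ev2B.
  + move=> _ _ [R hR ->] [S hS ->]; exists (R * S); first exact: PGM.
    by rewrite ev1M ev2M.
  + move=> b [R hR [e0 ->]].
    have [Q [S [hQ hS e hs]]] := divide hP mP hR.
    move: e0; rewrite e ev1D ev1M ex mulr0 add0r => /esym /(hmin _ hS)/(_ hs) S0.
    by rewrite S0 addr0 ev2M ey mulr0.
- by move=> [a b] hab; exists (a, b)%:P; [apply: PGC | rewrite ev1C ev2C].
- by exists 'X => //; rewrite /ev1 /ev2 !map_polyX !hornerX.
Qed.

(** The minimal polynomial divides a separable polynomial over [K] that kills [x], and so does its
    image, as [G] fixes [K]. *)
Let min_sep P : PG P -> P \is monic -> ev1 P x = 0 ->
  (forall R, PG R -> ev1 R x = 0 -> (size R < size P)%N -> R = 0) ->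
  separable_poly (map_poly snd P).
Proof.
move=> hP mP ex hmin; have [f fs fx] := hKs.1 x.
have [R [hR e1 e2]] := PGK f.
have [Q [S [hQ hS e hs]]] := divide hP mP hR.
have S0 : S = 0.
  apply: hmin => //; have : ev1 R x = 0 by rewrite /ev1 e1; apply/rootP.
  by rewrite e ev1D ev1M ex mulr0 add0r.
apply: (@dvdp_separable _ (map_poly i f)); last by rewrite separable_map.
by rewrite -e2 e S0 addr0 rmorphM dvdp_mulIr.
Qed.

Let min_size P : P \is monic -> ev1 P x = 0 -> (1 < size P)%N.
Proof.
move=> mP ex; rewrite ltn_neqAle size_poly_gt0 monic_neq0 // andbT eq_sym.
apply/negP => /eqP sP; move: (monicP mP) ex.
have eP := size1_polyC (eq_leq sP); rewrite {1 2}eP lead_coefC ev1C => ->.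
by move/eqP; rewrite oner_eq0.
Qed.

Lemma field_graph_extend :
  exists y G', [/\ field_graph G', forall z, G z -> G' z & G' (x, y)].
Proof.
have [P [hP mP ex hmin]] := min_exists.
have [|y hy] := hKs.2 _ (min_sep hP mP ex hmin).
  by rewrite size_map_poly_id0 ?min_size // (monicP mP) oner_neq0.
by exists y; apply: extend_root hP mP ex hmin _; apply/rootP.
Qed.

(** Degree 1 of the minimal polynomial would put [x] in the domain of [G]; in higher degree
    separability provides a root other than [x]. Since [G] is diagonal, the polynomial and its image
    coincide. *)
Lemma field_graph_move : ~ (exists y, G (x, y)) -> (forall z, G z -> z.1 = z.2) ->
  exists y G', [/\ field_graph G', forall z, G z -> G' z, G' (x, y) & y <> x].
Proof.
move=> hx hdiag; have [P [hP mP ex hmin]] := min_exists.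
have sP := min_size mP ex.
have e12 : map_poly fst P = map_poly snd P.
  by apply/polyP => j; rewrite !coef_map; apply: hdiag.
have hs := min_sep hP mP ex hmin.
have : root (map_poly snd P) x by rewrite -e12; apply/rootP.
move=> /factor_theorem[q eq].
have mS : map_poly snd P \is monic by apply: monic_map.
have q0 : q != 0 by apply: contraNneq (monic_neq0 mS) => q0; rewrite eq q0 mul0r.
have sq : size (map_poly snd P) = (size q).+1.
  by rewrite eq size_mul ?polyXsubC_eq0 // size_XsubC addn2.
have sPm : size (map_poly snd P) = size P.
  by rewrite size_map_poly_id0 // (monicP mP) oner_neq0.
move: hs; rewrite eq separable_mul => /and3P[qs _ hc].
have [h2|h2] := ltnP 1 (size q); last first.
  case: hx; exists (- (P`_0).1).
  have sP2 : size P = 2%N.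
    by apply/eqP; rewrite eqn_leq sP andbT -sPm sq.
  have P1 : P`_1 = 1 by move: (monicP mP); rewrite lead_coefE sP2.
  move: ex; rewrite /ev1 (@horner_coef_wide _ 2%N) -?sP2 ?size_poly //.
  rewrite sP2 !big_ord_recr big_ord0 /= !coef_map P1 /= add0r expr0 mulr1 expr1 mul1r.
  move/eqP; rewrite addrC addr_eq0 => /eqP ->.
  have /= := GN (hP 0%N); have := hdiag _ (hP 0%N); case: (P`_0) => a b /= ->.
  by [].
have [y qy] := hKs.2 _ qs h2.
have [|G' [h3 h4 h5]] := @extend_root P y hP mP ex hmin.
  by apply/rootP; rewrite eq rootM qy.
exists y, G'; split=> // eyx.
have := coprimep_root hc qy.
by rewrite eyx !hornerE subrr eqxx.
Qed.

End Step.

(** Zorn's lemma on the graphs containing [G]: by [field_graph_extend] a maximal one is total. *)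
Lemma field_graph_aut (G : Ks * Ks -> Prop) : field_graph G ->
  exists2 s, galois_aut i s & forall x y, G (x, y) -> s x = y.
Proof.
move=> hG.
pose T := {H : Ks * Ks -> Prop | field_graph H /\ forall z, G z -> H z}.
pose R (H H' : T) := `[< forall z, sval H z -> sval H' z >].
have [||||M hM] := @Zorn T R.
- by move=> H; apply/asboolP.
- by move=> H1 H2 H3 /asboolP h /asboolP h'; apply/asboolP => z /h/h'.
- move=> [H hH] [H' hH'] /asboolP h /asboolP h'.
  have e : H = H' by apply/funext => z; apply/propext; split; [apply: h | apply: h'].
  by case: _ / e hH' {h h'} => hH'; congr exist; apply: Prop_irrelevance.
- move=> A tA; have [[H0 AH0]|nA] := pselect (exists H, A H); last first.
    exists (exist _ G (conj hG (fun z h => h))) => H AH.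
    by case: nA; exists H.
  pose U z := exists2 H, A H & sval H z.
  have hU2 x y : U x -> U y -> exists H, [/\ A H, sval H x & sval H y].
    move=> [H AH Hx] [H' AH' Hy]; have [/asboolP h|/asboolP h] := tA _ _ AH AH'.
      by exists H'; split=> //; apply: h.
    by exists H; split=> //; apply: h.
  have hU : field_graph U.
    split.
    + by move=> c; exists H0 => //; case: (svalP H0) => [[h _ _ _] _].
    + move=> x y hx hy; have [H [AH Hx Hy]] := hU2 _ _ hx hy.
      by exists H => //; case: (svalP H) => [[_ h _ _] _]; apply: h.
    + move=> x y hx hy; have [H [AH Hx Hy]] := hU2 _ _ hx hy.
      by exists H => //; case: (svalP H) => [[_ _ h _] _]; apply: h.
    + by move=> b [H AH Hb]; case: (svalP H) => [[_ _ _ h] _]; apply: h.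
  have hGU z : G z -> U z by move=> Gz; exists H0 => //; apply: (svalP H0).2.
  by exists (exist _ U (conj hU hGU)) => H AH; apply/asboolP => z Hz; exists H.
have [hg hGM] := svalP M; have [hMi hMB hMM hM0] := hg.
have tot x : exists y, sval M (x, y).
  have [y [G' [h1 h2 h3]]] := field_graph_extend hg x.
  have hG' z : G z -> G' z by move=> /hGM/h2.
  have /= e := hM (exist _ G' (conj h1 hG')) (introT (asboolP _) h2).
  by exists y; rewrite -e.
have uniqM x y y' : sval M (x, y) -> sval M (x, y') -> y = y'.
  move=> h h'; apply/eqP; rewrite -subr_eq0; apply/eqP/hM0.
  by have := hMB _ _ h h'; rewrite -[_ - _]/(x - x, y - y') subrr.
have [f hf] := choice tot.
have [||s hs] := @rmorphism_exists _ _ f.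
- by move=> x y; apply: uniqM (hf _) (hMB _ _ (hf x) (hf y)).
- split=> [|x y]; last exact: uniqM (hf _) (hMM _ _ (hf x) (hf y)).
  by apply: uniqM (hf _) _; have := hMi 1; rewrite rmorph1.
exists s => [|x y hxy]; last by rewrite hs; apply: uniqM (hf _) (hGM _ hxy).
by apply: galois_autP => c; rewrite hs; apply: uniqM (hf _) (hMi _).
Qed.

(** Galois correspondence for a ring between [K] and [Ks]: the identity of [S] would extend to an
    automorphism moving an [x] outside [S]. *)
Lemma fixed_field (S : Ks -> Prop) x : (forall c, S (i c)) ->
  (forall x y, S x -> S y -> S (x - y)) -> (forall x y, S x -> S y -> S (x * y)) ->
  (forall s, galois_aut i s -> (forall y, S y -> s y = y) -> s x = x) -> S x.
Proof.
move=> Si SB SM hx; apply: contrapT => nx.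
have hG : field_graph (fun z => S z.1 /\ z.1 = z.2).
  split=> [c|[a b] [c d] [/= h1 <-] [/= h2 <-]|[a b] [c d] [/= h1 <-] [/= h2 <-]|b [_ /= <-]] //.
  - by split=> //; apply: Si.
  - by split=> //; exact: (SB _ _ h1 h2).
  - by split=> //; exact: (SM _ _ h1 h2).
have [||y [G' [h1 h2 h3 h4]]] := field_graph_move hG (x := x).
- by case=> y [].
- by move=> z [].
have [s gs hs] := field_graph_aut h1.
apply: h4; rewrite -(hs _ _ h3); apply: hx => // z Sz.
by apply: hs; apply: h2.
Qed.

End Galois.

Lemma separable_split (R : fieldType) (f : {poly R}) :
  (forall g : {poly R}, separable_poly g -> (1 < size g)%N -> exists x, root g x) ->
  separable_poly f ->
  exists rs : seq R, [/\ uniq rs, forall y, (y \in rs) = root f y,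
    f = lead_coef f *: \prod_(z <- rs) ('X - z%:P) & size rs = (size f).-1].
Proof.
move=> hR; have [n] := ubnP (size f); elim: n f => // n IH f hf fs.
have f0 : f != 0 by apply: separable_poly_neq0.
have [h|h] := leqP (size f) 1.
  have e := size1_polyC h; have c0 : f`_0 != 0 by rewrite e polyC_eq0 in f0.
  exists [::]; split=> //; last by rewrite e size_polyC c0.
    by move=> y; rewrite in_nil e rootC (negbTE c0).
  by rewrite big_nil alg_polyC e lead_coefC.
have [a fa] := hR f fs h.
have /factor_theorem[q e] := fa.
have q0 : q != 0 by apply: contraNneq f0 => q0; rewrite e q0 mul0r.
have sf : size f = (size q).+1.
  by rewrite e size_mul ?polyXsubC_eq0 // size_XsubC addn2.
move: (fs); rewrite e separable_mul => /and3P[qs _ hc].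
have [|rs [u hrs eq hs]] := IH q _ qs; first by rewrite -ltnS -sf.
exists (a :: rs); split.
- rewrite /= u andbT hrs; apply/negP => qa.
  by have := coprimep_root hc qa; rewrite !hornerE subrr eqxx.
- by move=> y; rewrite inE hrs rootM root_XsubC orbC.
- by rewrite big_cons lead_coefM lead_coefXsubC mulr1 [in RHS]mulrC scalerAl -eq.
- by rewrite -e /= hs sf prednK // size_poly_gt0.
Qed.

(** * Conjugates, residue field representatives and unramified elements *)

Section Ramification.
Variables (K Ks : fieldType) (v : K -> int) (i : {rmorphism K -> Ks}).
Hypothesis hK : local_field v.
Hypothesis hKs : separable_closure i.
Local Notation O := (sep_integer v i).
Local Notation P := (sep_maximal v i).
Local Notation ounit := (ounit v i).
Variables (t : K) (t0 : t != 0) (vt : v t = 1).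
Local Notation T := (i t).
Variables (ell : nat) (hell : ell \in [pchar Ks]).
Let halg := sepclosure_alg hKs.

Let O1 := O1 i hK.
Let OM := @OM _ _ _ i hK.
Let OX := @OX _ _ _ i hK.
Let maxD := maxD hK t0 vt halg hell.
Let maxB := maxB hK t0 vt halg hell.
Let ounitM := @ounitM _ _ _ i hK.
Let ounitX := @ounitX _ _ _ i hK.
Let p1 : (1 < ell)%N. Proof. exact/prime_gt1/(pcharf_prime hell). Qed.

Lemma galois_integer s x : galois_aut i s -> O x -> O (s x).
Proof.
move=> [_ hs] [f [fm fv fx]]; exists f; split=> //.
by move: fx => /(rmorph_root s); rewrite -map_poly_comp (eq_map_poly (g := i)).
Qed.

Lemma galois_max s x : galois_aut i s -> P x -> P (s x).
Proof.
move=> hs [Ox h]; split; first exact: galois_integer.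
case: h => [->|h]; [by left; rewrite rmorph0 | right; rewrite -fmorphV => h'].
have [u [hu su us]] := galois_inv hKs hs.
by apply: h; rewrite -[x^-1]su; apply: galois_integer.
Qed.

(** Replaces the uniqueness of the extension of [v]: conjugate elements have the same value. *)
Lemma galois_conj_unit s x : galois_aut i s -> x != 0 -> ounit (s x / x).
Proof.
move=> hs x0.
have hit k : galois_aut i s -> exists u : {rmorphism Ks -> Ks}, galois_aut i u /\
    forall y, u y = iter k s y.
  move=> _; elim: k => [|k [u [hu eu]]].
    by exists (idfun : {rmorphism Ks -> Ks}); split=> //; apply: galois_id.
  exists (s \o u : {rmorphism Ks -> Ks}); split; first exact: galois_comp.
  by move=> y; rewrite /= eu.
have [rs _ hrs] := conjugates_finite hKs x.
have hin k : iter k s x \in rs by have [u [hu <-]] := hit k hs; apply: hrs.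
have [k [l [kl e]]] := pigeonhole_nat (fun k => Ordinal (etrans (index_mem _ _) (hin k))).
have {}e : iter k s x = iter l s x.
  have /(congr1 val) /= e' := e.
  by rewrite -(nth_index 0 (hin k)) -(nth_index 0 (hin l)) e'.
have inj n y z : iter n s y = iter n s z -> y = z.
  by elim: n => //= n IH /fmorph_inj/IH.
have {e} e : iter (l - k) s x = x.
  by apply/esym/(@inj k); rewrite -iterD subnKC // ltnW.
move: e kl; rewrite -subn_gt0; move: (l - k)%N => n e n0 {k l inj}.
have y0 k : iter k s x != 0 by have [u [_ <-]] := hit k hs; rewrite fmorph_eq0.
(* a finite orbit of the order preserving map [s] on the ordered group of values is trivial *)
have key (y : Ks) z m : O (s y / y) -> y != 0 -> iter m s y = z -> O (z / y).
  move=> h hy <-; elim: m => [|m IH] /=; first by rewrite divff.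
  have -> : s (iter m s y) / y = s (iter m s y) / iter m s y * (iter m s y / y).
    rewrite mulrA divfK //; elim: m {IH} => //= m IH; by rewrite fmorph_eq0.
  apply: OM => //; elim: m {IH} => //= m IH.
  by rewrite -fmorph_div; apply: galois_integer.
have h2 : O (x / s x) \/ O (s x / x) -> ounit (s x / x).
  have e' : iter n.-1 s (s x) = x by rewrite -iterSr prednK.
  case=> h; split; rewrite ?mulf_neq0 ?invr_eq0 ?fmorph_eq0 //.
  - have h' : O (s x^-1 / x^-1) by rewrite invrK fmorphV mulrC.
    have x0' : x^-1 != 0 by rewrite invr_eq0.
    have e2 : iter n.-1 s (s x^-1) = x^-1.
      have [u [_ eu]] := hit n hs; rewrite -iterSr prednK // -eu fmorphV eu e //.
    have h3 : O (s (s x^-1) / s x^-1) by rewrite -fmorph_div; apply: galois_integer.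
    have := key _ _ _ h3 (_ : s x^-1 != 0) e2.
    by rewrite fmorph_eq0 x0' => /(_ isT); rewrite fmorphV invrK mulrC.
  - by rewrite invf_div.
  - rewrite invf_div.
    have h3 : O (s (s x) / s x) by rewrite -fmorph_div; apply: galois_integer.
    by apply: key h3 _ e'; rewrite fmorph_eq0.
apply: h2; have x1 : x / s x != 0 by rewrite mulf_neq0 ?invr_eq0 ?fmorph_eq0.
have [h|h] := O_total hK t0 vt halg hell x1; [by left|right].
by rewrite invf_div in h.
Qed.

(** The algebraic closure of the prime field in [Ks]. In equal characteristic it is a field of
    Teichmueller representatives, additive as well as multiplicative. *)
Definition Fbar (z : Ks) : Prop := exists2 m, (0 < m)%N & z ^+ (ell ^ m) = z.

Lemma FbarX (z : Ks) m k : z ^+ (ell ^ m) = z -> z ^+ (ell ^ (k * m)) = z.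
Proof.
by move=> h; elim: k => [|k IH]; rewrite ?expr1 // mulSn expnD exprM h.
Qed.
Lemma Fbar2 z w : Fbar z -> Fbar w -> exists m, [/\ (0 < m)%N,
  z ^+ (ell ^ m) = z & w ^+ (ell ^ m) = w].
Proof.
move=> [m m0 hz] [n n0 hw]; exists (n * m)%N; split; rewrite ?muln_gt0 ?m0 ?n0 //.
  exact: FbarX.
by rewrite mulnC; apply: FbarX.
Qed.
Lemma FbarB z w : Fbar z -> Fbar w -> Fbar (z - w).
Proof.
by move=> hz hw; have [m [m0 h1 h2]] := Fbar2 hz hw; exists m; rewrite ?pchar_exprB ?h1 ?h2.
Qed.
Lemma FbarM z w : Fbar z -> Fbar w -> Fbar (z * w).
Proof.
by move=> hz hw; have [m [m0 h1 h2]] := Fbar2 hz hw; exists m; rewrite ?exprMn ?h1 ?h2.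
Qed.
Lemma FbarV z : Fbar z -> Fbar z^-1.
Proof. by move=> [m m0 h]; exists m => //; rewrite exprVn h. Qed.
Lemma Fbar1 : Fbar 1. Proof. by exists 1%N; rewrite // expr1n. Qed.
Lemma Fbar0 : Fbar 0. Proof. by rewrite -(subrr 1); apply: FbarB; apply: Fbar1. Qed.
Lemma FbarN z : Fbar z -> Fbar (- z).
Proof. by rewrite -sub0r; apply: FbarB; apply: Fbar0. Qed.
Lemma FbarD z w : Fbar z -> Fbar w -> Fbar (z + w).
Proof. by move=> hz hw; rewrite -[w]opprK; apply/FbarB/FbarN. Qed.
Lemma Fbar_galois s z : Fbar z -> Fbar ((s : {rmorphism Ks -> Ks}) z).
Proof. by move=> [m m0 h]; exists m => //; rewrite -rmorphXn h. Qed.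

Let p1m m : (0 < m)%N -> (1 < ell ^ m)%N.
Proof. by move=> m0; apply: leq_ltn_trans m0 (ltn_expl m p1). Qed.

Let size_XnX (R : fieldType) m : (0 < m)%N ->
  size ('X^(ell ^ m) - 'X : {poly R}) = (ell ^ m).+1.
Proof.
move=> m0; by rewrite size_polyDl size_polyXn // size_polyN size_polyX ltnS p1m.
Qed.

Lemma Fbar_O z : Fbar z -> O z.
Proof.
case=> m m0 h; exists ('X^(ell ^ m) - 'X); split.
- apply/monicP; rewrite lead_coefE size_XnX // coefB coefXn coefX eqxx /=.
  by rewrite gtn_eqF ?subr0 // p1m.
- move=> j; rewrite coefB coefXn coefX; apply/(val_ge0P (local_val hK)).
  apply: (val_geB (local_val hK)); case: eqP => _; try by left.
    by right; rewrite (val_of1 (local_val hK)).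
  by right; rewrite (val_of1 (local_val hK)).
- by rewrite rmorphB rmorphXn /= map_polyX /root !hornerE h subrr.
Qed.

Lemma Fbar_unit z : Fbar z -> z != 0 -> ounit z.
Proof. by move=> h z0; split=> //; apply: Fbar_O => //; apply: FbarV. Qed.

(** The polynomial ['X^(ell ^ m) - 'X] splits in [Ks] and [P] is prime, so one factor of its value
    at [x] lies in [P]. The list depends on [m] alone, which later allows a pigeonhole argument on
    residues. *)
Lemma Fbar_rep_level m : (0 < m)%N -> exists rs : seq Ks, forall x, O x ->
  P (x ^+ (ell ^ m) - x) -> exists z, [/\ z \in rs, Fbar z & P (x - z)].
Proof.
move=> m0; pose f : {poly Ks} := 'X^(ell ^ m) - 'X.
have fs : separable_poly f.
  have -> : separable_poly f = coprimep f f^`() by rewrite unlock.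
  rewrite /f derivB derivXn derivX -scaler_nat natrX (pcharf0 hell) expr0n gtn_eqF //.
  by rewrite scale0r sub0r -[- 1]scaleN1r coprimepZr ?oppr_eq0 ?oner_neq0 // coprimep1.
have [rs [u hrs e _]] := separable_split hKs.2 fs.
have fm : lead_coef f = 1.
  rewrite lead_coefE size_XnX // coefB coefXn coefX eqxx /=.
  by rewrite gtn_eqF ?subr0 // p1m.
exists rs => x Ox hm.
have ev : f.[x] = x ^+ (ell ^ m) - x by rewrite /f !hornerE.
move: hm; rewrite -ev e fm scale1r horner_prod => hm.
have hF z : z \in rs -> Fbar z.
  rewrite hrs /root /f !hornerE subr_eq0 => /eqP h; exists m => //.
have [z|z hz hP] := max_prod hK _ hm.
  by move=> /hF hz; rewrite !hornerE; apply: (OB hK) => //; apply: Fbar_O.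
by exists z; split; [| apply: hF | move: hP; rewrite !hornerE].
Qed.

Lemma Fbar_rep x : O x -> exists2 z, Fbar z & P (x - z).
Proof.
move=> Ox; have [m m0 hm] := max_residue hK t0 vt hell Ox.
have [rs hrs] := Fbar_rep_level m0.
by have [z [_ h1 h2]] := hrs x Ox hm; exists z.
Qed.

(** Every residue class has a representative in [Fbar], so an automorphism fixing [Fbar] acts
    trivially on residues. *)
Lemma Fbar_fix_inertia s : galois_aut i s -> (forall z, Fbar z -> s z = z) ->
  inertia_aut v i s.
Proof.
move=> hs hF; split=> // x Ox; have [z hz hP] := Fbar_rep Ox.
have -> : s x - x = s (x - z) - (x - z) by rewrite rmorphB (hF z hz) /=; ring.
by apply: maxB => //; apply: galois_max.
Qed.

Lemma Fbar_eq z w : Fbar z -> Fbar w -> P (z - w) -> z = w.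
Proof.
move=> hz hw hP; apply/eqP; rewrite -subr_eq0; apply/negPn/negP => h.
move: hP; rewrite (maxE i hK) => -[_]; apply.
by apply: Fbar_unit h; apply: FbarB.
Qed.

(** The representative of an element of [K] is Galois invariant, because distinct elements of [Fbar]
    are incongruent modulo [P]. *)
Lemma teichmuller a : O (i a) -> exists2 k, Fbar (i k) & P (i a - i k).
Proof.
move=> Oa; have [z hz hP] := Fbar_rep Oa.
have [|x y [a1 <-] [a2 <-]|x y [a1 <-] [a2 <-]|s hs _|k hk] :=
  @fixed_field _ _ _ hKs (fun y => exists k, i k = y) z.
- by move=> c; exists c.
- by exists (a1 - a2); rewrite rmorphB.
- by exists (a1 * a2); rewrite rmorphM.
- apply: Fbar_eq => //; first exact: Fbar_galois.
  have -> : s z - z = (i a - z) - s (i a - z) by rewrite rmorphB hs.2 /=; ring.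
  by apply: maxB => //; apply: galois_max.
- by exists k; rewrite hk.
Qed.

(** The compositum of [K] and [Fbar], that is, the maximal unramified extension of [K] in [Ks]. *)
Definition KFbar (y : Ks) : Prop := exists (I : finType) (c : I -> K) (z : I -> Ks),
  (forall j, Fbar (z j)) /\ y = \sum_j i (c j) * z j.

Lemma KFbarB x y : KFbar x -> KFbar y -> KFbar (x - y).
Proof.
move=> [I [c [z [hz ->]]]] [J [d [w [hw ->]]]].
exists (I + J)%type, (fun u => match u with inl a => c a | inr b => - d b end),
  (fun u => match u with inl a => z a | inr b => w b end); split; first by case.
rewrite big_sumType /= -sumrN; congr (_ + _); apply: eq_bigr => j _.
by rewrite rmorphN mulNr.
Qed.
Lemma KFbarM x y : KFbar x -> KFbar y -> KFbar (x * y).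
Proof.
move=> [I [c [z [hz ->]]]] [J [d [w [hw ->]]]].
exists (I * J)%type, (fun u => c u.1 * d u.2), (fun u => z u.1 * w u.2); split.
  by move=> u; apply: FbarM.
rewrite big_distrl -(pair_bigA _ (fun a b => i (c a * d b) * (z a * w b))) /=.
apply: eq_bigr => a _; rewrite big_distrr; apply: eq_bigr => b _.
by rewrite rmorphM mulrACA.
Qed.

(** Values do not ramify in this extension. Divide by the coefficient of least valuation and replace
    the quotients by representatives [k l] in [K]. If the combination [xi] of these is nonzero, it
    is a unit and gives the value; if it vanishes, subtracting [c j] times this relation removes the
    term [j], and induction applies. *)
Lemma KFbar_ord_value n (c : 'I_n -> K) (z : 'I_n -> Ks) : (forall j, Fbar (z j)) ->
  \sum_j i (c j) * z j != 0 ->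
  exists2 d, d != 0 & ounit ((\sum_j i (c j) * z j) / i d).
Proof.
elim: n c z => [|n IH] c z hz; first by rewrite big_ord0 eqxx.
move=> y0; have [j0 hj0] : exists j, c j != 0.
  apply: contrapT => h; case/negP: y0; apply/eqP; rewrite big1 // => j _.
  have [->|cj] := eqVneq (c j) 0; first by rewrite rmorph0 mul0r.
  by case: h; exists j.
have [j hj hmin] : exists2 j, c j != 0 & forall l, c l != 0 -> v (c j) <= v (c l).
  case: (@arg_minP _ _ _ _ (fun j => c j != 0) (fun j => v (c j)) hj0) => j hj hm.
  by exists j.
pose a l := c l / c j.
have Oa l : O (i (a l)).
  apply: (O_iota i hK); rewrite /a; have [->|hl] := eqVneq (c l) 0.
    by rewrite mul0r (Defs.val0 (local_val hK)).
  rewrite (Defs.valM (local_val hK)) ?invr_eq0 // (val_ofV (local_val hK)) //.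
  by rewrite subr_ge0 hmin.
have H l : exists k, Fbar (i k) /\ P (i (a l) - i k).
  by have [k h1 h2] := teichmuller (Oa l); exists k.
have [k hk] := choice H.
have kj : k j = 1.
  apply: (fmorph_inj i); rewrite rmorph1; apply: Fbar_eq; [by case: (hk j)|exact: Fbar1|].
  have := (hk j).2; rewrite /a divff // rmorph1 => /(maxN hK).
  by rewrite opprB.
pose xi := \sum_l i (k l) * z l.
have hxi : Fbar xi.
  rewrite /xi; elim/big_rec: _ => [|l x _ hx]; first exact: Fbar0.
  by apply: FbarD => //; apply: FbarM => //; case: (hk l).
have hP : P (\sum_l i (a l) * z l - xi).
  rewrite /xi -sumrB. apply: (max_sum hK t0 vt halg hell) => l _.
  by rewrite -mulrBl; apply: (maxMr hK) (hk l).2 _; apply: Fbar_O.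
have ey : \sum_l i (c l) * z l = i (c j) * \sum_l i (a l) * z l.
  rewrite mulr_sumr; apply: eq_bigr => l _; rewrite mulrA -rmorphM /a.
  by rewrite [c j * _]mulrC divfK.
have [xi0|xi0] := eqVneq xi 0; last first.
  exists (c j) => //; rewrite ey mulrAC divff ?fmorph_eq0 // mul1r.
  by have := ounitND hK t0 vt halg hell (Fbar_unit hxi xi0) hP; rewrite subrKC.
have e2 : \sum_l i (c l) * z l =
   \sum_l i (c (lift j l) - c j * k (lift j l)) * z (lift j l).
  have e3 : \sum_l i (c l) * z l = \sum_l i (c l - c j * k l) * z l.
    transitivity (\sum_l i (c l) * z l - i (c j) * xi); first by rewrite xi0 mulr0 subr0.
    rewrite /xi mulr_sumr -sumrB.
    by apply: eq_bigr => l _; rewrite rmorphB rmorphM mulrBl mulrA.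
  by rewrite e3 (bigD1_ord j) //= kj mulr1 subrr rmorph0 mul0r add0r.
by move: y0; rewrite e2 => y0; apply: IH.
Qed.

Lemma KFbar_value y : KFbar y -> y != 0 -> exists2 c, c != 0 & ounit (y / i c).
Proof.
case=> I [c [z [hz ->]]]; rewrite (big_enum_val _ (A := I)) /=.
by apply: KFbar_ord_value => j; apply: hz.
Qed.

Lemma unramified_value y : y != 0 ->
  (forall s, galois_aut i s -> (forall z, Fbar z -> s z = z) -> s y = y) ->
  exists2 c, c != 0 & ounit (y / i c).
Proof.
move=> y0 hy; apply: KFbar_value y0; apply: (fixed_field hKs).
- move=> c; exists unit, (fun=> c), (fun=> 1); split; first by move=> _; apply: Fbar1.
  by rewrite big_const card_unit /= mulr1 addr0.
- exact: KFbarB.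
- exact: KFbarM.
- move=> s hs hz; apply: hy => // z Fz; apply: hz.
  exists unit, (fun=> 1), (fun=> z); split=> //.
  by rewrite big_const card_unit /= rmorph1 mul1r addr0.
Qed.

End Ramification.

Section Orbits.
Variables (K Ks : fieldType) (i : {rmorphism K -> Ks}).
Hypothesis hKs : separable_closure i.
Implicit Types (s u : {rmorphism Ks -> Ks}).

Definition fixing (W : Ks -> Prop) s := galois_aut i s /\ forall y, W y -> s y = y.

Lemma fixing_id W : fixing W (idfun : {rmorphism Ks -> Ks}).
Proof. by split=> //; apply: galois_id. Qed.

Lemma fixing_comp W s u : fixing W s -> fixing W u ->
  fixing W (s \o u : {rmorphism Ks -> Ks}).
Proof.
by move=> [hs h1] [hu h2]; split=> [|y hy]; [apply: galois_comp | rewrite /= h2 // h1].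
Qed.

Lemma fixing_inv W s : fixing W s ->
  exists u, [/\ fixing W u, cancel s u & cancel u s].
Proof.
move=> [hs h1]; have [u [hu su us]] := galois_inv hKs hs.
by exists u; split=> //; split=> // y hy; rewrite -[in LHS](h1 y hy) su.
Qed.

Lemma orbit_seq (J : {rmorphism Ks -> Ks} -> Prop) x :
  (forall s, J s -> galois_aut i s) ->
  exists2 os : seq Ks, uniq os & forall y, y \in os <-> exists2 s, J s & y = s x.
Proof.
move=> hJ; have [rs urs hrs] := conjugates_finite hKs x.
exists [seq y <- rs | `[< exists2 s, J s & y = s x >]]; first exact: filter_uniq.
move=> y; rewrite mem_filter; split=> [/andP[/asboolP]//|h].
by rewrite asboolT //; case: h => s Js ->; apply/hrs/hJ.
Qed.

(** The restriction of [s] to [X] is encoded by the positions of the images in a finite list [R] of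
    conjugates. *)
Lemma finite_cosets (J : {rmorphism Ks -> Ks} -> Prop) (X : seq Ks) u0 :
  J u0 -> (forall s, J s -> galois_aut i s) ->
  exists (T : finType) (g : T -> {rmorphism Ks -> Ks}),
    (forall a, J (g a)) /\ forall s, J s -> exists a, {in X, s =1 g a}.
Proof.
move=> J0 hJ.
have [R hR] : exists R : seq Ks, forall s x, J s -> x \in X -> s x \in R.
  elim: X => [|x X [R hR]]; first by exists [::].
  have [rs _ hrs] := conjugates_finite hKs x.
  exists (rs ++ R) => s y Js; rewrite inE mem_cat => /orP[/eqP ->|hy].
    by rewrite hrs //; apply: hJ.
  by rewrite hR ?orbT.
pose code s := [ffun j : 'I_(size X) => inord (index (s X`_j) R) : 'I_(size R).+1].
have codeP s s' : J s -> J s' -> code s = code s' -> {in X, s =1 s'}.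
  move=> Js Js' e x hx; have hj : (index x X < size X)%N by rewrite index_mem.
  have /ffunP/(_ (Ordinal hj)) := e; rewrite !ffunE /= nth_index //.
  move=> /(congr1 val) /=; rewrite !inordK ?ltnS ?index_size // => e'.
  by rewrite -(nth_index 0 (hR _ _ Js hx)) e' nth_index // hR.
have H t : exists s', J s' /\ forall s, J s -> code s = t -> {in X, s =1 s'}.
  have [[s' [Js' <-]]|h] := pselect (exists s, J s /\ code s = t).
    by exists s'; split=> // s Js; apply: codeP.
  by exists u0; split=> // s Js e; case: h; exists s.
have [g hg] := choice H.
exists _, g; split=> [t|s Js]; first by case: (hg t).
by exists (code s); apply: (hg _).2.
Qed.

End Orbits.

Section OrbitBound.
Variables (K Ks : fieldType) (v : K -> int) (i : {rmorphism K -> Ks}).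
Hypothesis hK : local_field v.
Hypothesis hKs : separable_closure i.
Local Notation ounit := (ounit v i).
Variables (t : K) (t0 : t != 0) (vt : v t = 1).
Variables (ell : nat) (hell : ell \in [pchar Ks]).
Implicit Types (s u : {rmorphism Ks -> Ks}).
Local Notation Fb := (@Fbar Ks ell).
Let ounitM := @ounitM _ _ _ i hK.
Let ounitX := @ounitX _ _ _ i hK.
Let ounitV := @ounitV _ _ v i.
Let conj_unit := galois_conj_unit hK hKs t0 vt hell.

(** The norm of [x] to the field fixed by [fixing i W]; conjugates differ by units, so it has the
    value of [x ^+ size os]. *)
Lemma orbit_norm W (x : Ks) (os : seq Ks) : x != 0 -> uniq os ->
  (forall y, y \in os <-> exists2 s, fixing i W s & y = s x) ->
  [/\ \prod_(y <- os) y != 0,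
      forall s, fixing i W s -> s (\prod_(y <- os) y) = \prod_(y <- os) y &
      ounit (\prod_(y <- os) y / x ^+ size os)].
Proof.
move=> x0 uos hos; split.
- rewrite prodf_seq_neq0; apply/allP => y /hos[s _ ->].
  by rewrite fmorph_eq0 x0 implybT.
- move=> s hs; rewrite rmorph_prod -(big_map s xpredT id).
  apply: perm_big; apply: uniq_perm => //; first by rewrite map_inj_uniq //; apply: fmorph_inj.
  move=> y; apply/mapP/idP => [[z /hos[u hu ->] ->]|/hos[u hu ->]].
    by apply/hos; exists (s \o u : {rmorphism Ks -> Ks}); [apply: fixing_comp|].
  have [s' [hs' ss' s's]] := fixing_inv hKs hs.
  exists (s' (u x)); last by rewrite s's.
  by apply/hos; exists (s' \o u : {rmorphism Ks -> Ks}); [apply: fixing_comp|].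
- have hin : {subset os <= os} by [].
  move: {1 3 4}os hin; elim=> [|y r IH] hr.
    by rewrite big_nil expr0 divr1; apply: ounit1.
  rewrite big_cons exprS invfM mulrACA; apply: ounitM.
    have /hos[s [hs _] ->] : y \in os by apply: hr; rewrite mem_head.
    exact: conj_unit.
  by apply: IH => z hz; apply: hr; rewrite inE hz orbT.
Qed.

Lemma iota_unit_val a : ounit (i a) -> v a = 0.
Proof.
move=> [a0 h1]; rewrite fmorph_eq0 in a0; rewrite -fmorphV.
move: h1 => /(O_iotaE i hK) h1 /(O_iotaE i hK).
rewrite (val_ofV (local_val hK)) // oppr_ge0 => h2.
by apply/eqP; rewrite eq_le h1 h2.
Qed.

(** [M] bounds the number of restrictions to [X] of automorphisms fixing [Fbar]. The norm [eta] of
    [x] over the group fixing [Fbar] and [X] has at most [M] conjugates under the group fixing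
    [Fbar], and their product has the value of some [d] in [K]. Comparing values, [D] divides
    [|v c|] times [size os] times the number of these conjugates. *)
Lemma ramification_bound (X : seq Ks) : exists2 M, (0 < M)%N &
  forall (x lam : Ks) (c : K) (e D : nat) (os : seq Ks),
    x != 0 -> (0 < e)%N -> (0 < D)%N -> v c < 0 ->
    ounit (x ^+ D / lam) -> ounit (lam ^+ e / i c) -> uniq os ->
    (forall y, y \in os <->
       exists2 s, fixing i (fun z => Fb z \/ z \in X) s & y = s x) ->
    (D <= `|v c| * M * size os)%N.
Proof.
have [T [g [hg1 hg2]]] := finite_cosets hKs X (fixing_id hKs Fb) (fun s h => h.1).
have [a0 _] := hg2 _ (fixing_id hKs Fb).
exists #|T|; first by apply/card_gt0P; exists a0.
move=> x lam c e D os x0 e0 D0 vc hx hlam uos hos.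
have [eta0 etaf etau] := orbit_norm x0 uos hos.
move: (\prod_(y <- os) y) eta0 etaf etau => eta eta0 etaf etau.
have [ns uns hns] := orbit_seq hKs eta (J := fixing i Fb) (fun s h => h.1).
have [N0 Nf Nu] := orbit_norm eta0 uns hns.
have [d d0 hd] := unramified_value hK hKs t0 vt hell N0 (fun s h1 h2 => Nf s (conj h1 h2)).
move: (\prod_(y <- ns) y) N0 Nf Nu hd => N N0 _ Nu hd.
have sns : (size ns <= #|T|)%N.
  (* An automorphism fixing [Fbar] moves [eta] in a way that depends only on its restriction to
     [X]. *)
  have hsub : {subset ns <= [seq g a eta | a <- enum T]}.
    move=> y /hns[s hs ->]; have [a ha] := hg2 s hs.
    apply/mapP; exists a; first by rewrite mem_enum.
    have [u [hu gu ug]] := fixing_inv hKs (hg1 a).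
    have : fixing i (fun z => Fb z \/ z \in X) (u \o s : {rmorphism Ks -> Ks}).
      split; first exact: (fixing_comp hKs hu hs).1.
      by move=> z [hz|hz] /=; [rewrite hs.2 // hu.2 | rewrite ha // gu].
    by move=> /etaf /= /(congr1 (g a)); rewrite ug.
  by have := uniq_leq_size uns hsub; rewrite size_map -cardE.
have ns0 : (0 < size ns)%N.
  rewrite lt0n size_eq0; apply/eqP => ns0.
  have : eta \in ns by apply/hns; exists idfun => //; apply: fixing_id.
  by rewrite ns0.
set m := size os in etau *; set n := size ns in Nu sns ns0 *.
have c0 : c != 0 by apply: contraTneq vc => ->; rewrite (Defs.val0 (local_val hK)) ltxx.
have lam0 : lam != 0.
  by case: hlam => h _ _; apply: contraNneq h => ->; rewrite expr0n gtn_eqF // mul0r.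
(* in the value group, [N ~ eta^n ~ x^(m n)] and [x^(D e) ~ c] *)
have key : ounit (i (d ^+ (D * e) / c ^+ (m * n))).
  have -> : i (d ^+ (D * e) / c ^+ (m * n)) =
     (N / i d) ^- (D * e) * (N / eta ^+ n) ^+ (D * e) * (eta / x ^+ m) ^+ (n * (D * e))
     * (x ^+ D / lam) ^+ (e * (m * n)) * (lam ^+ e / i c) ^+ (m * n).
    rewrite fmorph_div !rmorphXn !exprMn !exprVn -!exprM.
    have E1 : (D * (e * (m * n)) = m * (n * (D * e)))%N.
      by rewrite mulnA [(m * (n * _))%N]mulnA [(m * n * _)%N]mulnC.
    rewrite E1.
    have id0 : i d != 0 by rewrite fmorph_eq0.
    have ic0 : i c != 0 by rewrite fmorph_eq0.
    move: (expf_neq0 (D * e) id0) (expf_neq0 (m * n) ic0) (expf_neq0 (D * e) N0)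
      (expf_neq0 (n * (D * e)) eta0) (expf_neq0 (m * (n * (D * e))) x0)
      (expf_neq0 (e * (m * n)) lam0).
    move: (i d ^+ _) (i c ^+ _) (N ^+ _) (eta ^+ _) (x ^+ _) (lam ^+ _) => z1 z2 z3 z4 z5 z6.
    move=> h1 h2 h3 h4 h5 h6; field.
    by rewrite h1 h2 h3 h4 h5 h6.
  exact: (ounitM (ounitM (ounitM (ounitM (ounitV (ounitX _ hd)) (ounitX _ Nu))
    (ounitX _ etau)) (ounitX _ hx)) (ounitX _ hlam)).
have := iota_unit_val key.
rewrite (Defs.valM (local_val hK)) ?invr_eq0 ?expf_neq0 // (val_ofV (local_val hK)) ?expf_neq0 //.
rewrite !(val_ofX (local_val hK)) // => /eqP; rewrite subr_eq0 => /eqP E.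
have hm : (0 < m)%N.
  rewrite lt0n size_eq0; apply/eqP => os0.
  have : x \in os by apply/hos; exists idfun => //; apply: fixing_id.
  by rewrite os0.
have hdiv : (D %| `|v c| * m * n)%N.
  apply/dvdnP; exists (`|v d| * e)%N.
  have aux (z : int) k : (`|z *+ k| = `|z| * k)%N by rewrite -mulr_natr abszM natz.
  have := congr1 absz E; rewrite (aux (v d)) (aux (v c)) => E'.
  by rewrite -mulnA -E' -mulnA [(e * D)%N]mulnC.
have h1 : (D <= `|v c| * m * n)%N.
  apply: dvdn_leq hdiv; rewrite !muln_gt0 hm ns0 !andbT absz_gt0.
  by rewrite lt_eqF.
apply: leq_trans h1 _.
by rewrite -!mulnA leq_mul2l [(#|T| * m)%N]mulnC leq_mul2l sns !orbT.
Qed.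

End OrbitBound.

(** * Ideals and torsion modules *)

Section IdealPowers.
Variables (A : comNzRingType) (p : idealr A).
Local Notation "x \in_p^ n" := (ideal_pow p n x) (at level 70).

Lemma ideal_powMr n a x : x \in_p^ n -> x * a \in_p^ n.
Proof. by rewrite mulrC; apply: ideal_powMl. Qed.

Lemma ideal_powN n x : x \in_p^ n -> - x \in_p^ n.
Proof. by rewrite -mulN1r; apply: ideal_powMl. Qed.

Lemma ideal_pow_sum n I (r : seq I) (P : pred I) (F : I -> A) :
  (forall j, P j -> F j \in_p^ n) -> \sum_(j <- r | P j) F j \in_p^ n.
Proof.
move=> h; elim/big_rec: _ => [|j x Pj]; first exact: ideal_pow0.
by apply: ideal_powD; apply: h.
Qed.

Lemma ideal_powS n x y : x \in p -> y \in_p^ n -> x * y \in_p^ n.+1.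
Proof.
move=> hx hy; exists [:: (x, y)]; last by rewrite big_seq1.
by move=> u; rewrite inE => /eqP ->.
Qed.

Lemma ideal_powX n x : x \in p -> x ^+ n \in_p^ n.
Proof. by move=> hx; elim: n => [|n IH] //; rewrite exprS; apply: ideal_powS. Qed.

Lemma mem_ideal_pow1 x : x \in_p^ 1 <-> x \in p.
Proof.
split; first exact: ideal_pow1.
by move=> hx; rewrite -[x]mulr1; apply: ideal_powS.
Qed.

Lemma ideal_powW n x : x \in_p^ n.+1 -> x \in_p^ n.
Proof.
elim: n x => // n IH x [s hs ->]; rewrite big_seq; apply: ideal_pow_sum => w /hs[h1 h2].
by apply: ideal_powS h1 _; apply: IH.
Qed.

Lemma ideal_powWn m n x : (n <= m)%N -> x \in_p^ m -> x \in_p^ n.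
Proof.
move=> /subnK <-; elim: (m - n)%N => // k IH; rewrite addSn => /ideal_powW; exact: IH.
Qed.

Lemma ideal_pow_add m n x y : x \in_p^ m -> y \in_p^ n -> x * y \in_p^ (m + n).
Proof.
elim: m x => [|m IH] x; first by move=> _; apply: ideal_powMl.
move=> [s hs ->] hy; rewrite mulr_suml big_seq; apply: ideal_pow_sum => w /hs[h1 h2].
by rewrite -mulrA; apply: ideal_powS => //; apply: IH.
Qed.

Hypothesis hp : maximal_ideal p.

Lemma maximal_inverse a : a \notin p -> exists b, 1 - a * b \in p.
Proof.
move=> ha; apply: contrapT => nb.
pose J : {pred A} := fun x => `[< exists y, x - a * y \in p >].
have JP x : reflect (exists y, x - a * y \in p) (x \in J) by apply: asboolP.
have Jc : idealr_closed J.
  split.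
  - by apply/JP; exists 0; rewrite mulr0 subr0 rpred0.
  - by apply/JP => -[y hy]; apply: nb; exists y.
  - move=> b x y /JP[x' hx] /JP[y' hy]; apply/JP; exists (b * x' + y').
    have -> : b * x + y - a * (b * x' + y') = b * (x - a * x') + (y - a * y') by ring.
    by apply: rpredD => //; apply: idealMr.
pose m := isIdealr.Build A J Jc.
pose I : idealr A := HB.pack J m.
have hI : {subset p <= I}.
  by move=> x hx; apply/JP; exists 0; rewrite mulr0 subr0.
have := hp hI (x := a); rewrite (negbTE ha) => h.
suff : false by []; apply: h; apply/JP; exists 1.
by rewrite mulr1 subrr rpred0.
Qed.

Lemma maximal_prime a b : a * b \in p -> a \in p \/ b \in p.
Proof.
move=> hab; have [ha|ha] := boolP (a \in p); [by left | right].
have [c hc] := maximal_inverse ha.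
have -> : b = b * (1 - a * c) + c * (a * b) by ring.
by apply: rpredD; apply: idealMr.
Qed.

Lemma notin_ideal1 : 1 \notin p. Proof. by rewrite idealr1. Qed.

Lemma maximal_notinM a b : a \notin p -> b \notin p -> a * b \notin p.
Proof.
by move=> ha hb; apply/negP => /maximal_prime[h|h]; [rewrite h in ha|rewrite h in hb].
Qed.

Lemma maximal_notinX a n : a \notin p -> a ^+ n \notin p.
Proof.
by move=> ha; elim: n => [|n IH]; rewrite ?expr0 ?notin_ideal1 // exprS maximal_notinM.
Qed.

(** The power [(1 - a * b) ^+ n] lies in [p ^ n] and has the form [1 - a * c]. *)
Lemma ideal_pow_inverse n a : a \notin p -> exists b, 1 - a * b \in_p^ n.
Proof.
move=> ha; have [b hb] := maximal_inverse ha.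
have [c hc] : exists c, (1 - a * b) ^+ n = 1 - a * c.
  elim: n => [|n [c hc]]; first by exists 0; rewrite mulr0 subr0.
  by exists (b + c - a * b * c); rewrite exprS hc; ring.
by exists c; rewrite -hc; apply: ideal_powX.
Qed.

Lemma ideal_pow_cancel n a x : a \notin p -> a * x \in_p^ n -> x \in_p^ n.
Proof.
move=> ha hx; have [b hb] := ideal_pow_inverse n ha.
have -> : x = x * (1 - a * b) + b * (a * x) by ring.
by apply: ideal_powD; apply: ideal_powMl.
Qed.

(* [pi] generates [p] locally at [p], with denominator [u]. *)
Definition local_generator (pi u : A) : Prop :=
  [/\ pi \in p, u \notin p & forall y, y \in p -> exists z, u * y = z * pi].

Section LocalGenerator.
Variables (pi u : A) (hpi : local_generator pi u).

Lemma local_generator_pow n y : y \in_p^ n -> exists z, u ^+ n * y = z * pi ^+ n.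
Proof.
have [hpip hu hloc] := hpi.
elim: n y => [|n IH] y; first by move=> _; exists y; rewrite !expr0 mulr1 mul1r.
case=> s hs ->; elim: s hs => [|[t1 t2] s IHs] hs.
  by exists 0; rewrite big_nil mulr0 mul0r.
have [|z hz] := IHs; first by move=> w hw; apply: hs; rewrite inE hw orbT.
have [h1 h2] := hs (t1, t2) (mem_head _ _).
have [z1 hz1] := hloc _ h1; have [z2 hz2] := IH _ h2.
exists (z1 * z2 + z); rewrite big_cons mulrDr hz mulrDl; congr (_ + _).
rewrite /= !exprS; transitivity ((u * t1) * (u ^+ n * t2)); first by ring.
by rewrite hz1 hz2; ring.
Qed.

Lemma local_generator_powP n y z : u ^+ n * y = z * pi ^+ n -> y \in_p^ n.
Proof.
have [hpip hu hloc] := hpi => e; apply: (@ideal_pow_cancel _ (u ^+ n)).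
  exact: maximal_notinX.
by rewrite e; apply/ideal_powMl/ideal_powX.
Qed.

Hypothesis pi_reg : forall x, pi * x = 0 -> x = 0.

Lemma local_generator_div n x : pi * x \in_p^ n.+1 -> x \in_p^ n.
Proof.
have [hpip hu hloc] := hpi.
move=> /local_generator_pow[z hz]; apply: (@ideal_pow_cancel _ u) => //.
apply: (@local_generator_powP _ _ z); apply/eqP; rewrite -subr_eq0; apply/eqP/pi_reg.
rewrite mulrBr; apply/eqP; rewrite subr_eq0; apply/eqP.
transitivity (u ^+ n.+1 * (pi * x)); first by rewrite exprS; ring.
by rewrite hz exprS; ring.
Qed.

Lemma local_generator_approx n y : y \in p -> exists z, y - pi * z \in_p^ n.
Proof.
have [hpip hu hloc] := hpi => /hloc[z hz].
have [e he] := ideal_pow_inverse n hu.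
exists (e * z); have -> : y - pi * (e * z) = y * (1 - u * e) + e * (u * y - z * pi) by ring.
by rewrite hz subrr mulr0 addr0; apply: ideal_powMl.
Qed.

Definition residue_system (I : A -> Prop) (T : finType) (f : T -> A) : Prop :=
  (forall x, exists j, I (x - f j)) /\ (forall j k, I (f j - f k) -> j = k).

(** Expansion in base [pi]: a class modulo [p ^ n.+1] is a residue digit plus [pi] times a class
    modulo [p ^ n]. *)
Lemma residue_system_pow (T : finType) (f : T -> A) n :
  residue_system (ideal_pow p 1) f ->
  exists (Tn : finType) (fn : Tn -> A),
    residue_system (ideal_pow p n) fn /\ #|Tn| = (#|T| ^ n)%N.
Proof.
have [hpip hu hloc] := hpi.
move=> [f1 f2]; elim: n => [|n [Tn [fn [[h1 h2] hc]]]].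
  exists unit, (fun=> 0); split; last by rewrite card_unit.
  by split=> [x|[] []] //; exists tt.
exists (T * Tn)%type, (fun c => f c.1 + pi * fn c.2); split; last by rewrite card_prod hc expnS.
split=> [x|[j c] [j' c']]; last first.
  move=> h0; have {h0} h : ideal_pow p n.+1 (f j + pi * fn c - (f j' + pi * fn c')) := h0.
  have ej : j = j'.
    apply: f2; have -> : f j - f j' = (f j + pi * fn c - (f j' + pi * fn c')) + pi * (fn c' - fn c) by ring.
    by apply: ideal_powD; [apply: ideal_powWn h | apply/mem_ideal_pow1; rewrite mulrC; apply: idealMr].
  rewrite -ej in h *; congr (_, _); apply: h2; apply: local_generator_div.
  by rewrite mulrBr; move: h; congr (ideal_pow _ _ _); ring.
  have [j /ideal_pow1 hj] := f1 x; have [z hz] := local_generator_approx n.+1 hj.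
  have [c hc'] := h1 z; exists (j, c).
  change (ideal_pow p n.+1 (x - (f j + pi * fn c))).
  have -> : x - (f j + pi * fn c) = (x - f j - pi * z) + pi * (z - fn c) by ring.
  by apply: ideal_powD => //; apply: ideal_powS.
Qed.

End LocalGenerator.
End IdealPowers.

Lemma pairwise_refine (T : eqType) (E : T -> T -> Prop) (r : seq T) :
  (forall x, E x x) -> (forall x y, E x y -> E y x) ->
  exists r' : seq T, [/\ uniq r', {subset r' <= r},
    forall x, x \in r -> exists2 y, y \in r' & E x y &
    {in r' &, forall x y, E x y -> x = y}].
Proof.
move=> Er Es; elim: r => [|x r [r' [u hs hc hp]]]; first by exists [::].
have [[y hy Exy]|h] := pselect (exists2 y, y \in r' & E x y).
  exists r'; split=> //; first by move=> z /hs hz; rewrite inE hz orbT.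
  by move=> z; rewrite inE => /orP[/eqP ->|/hc//]; exists y.
exists (x :: r'); split.
- by rewrite /= u andbT; apply/negP => hx; apply: h; exists x.
- by move=> z; rewrite !inE => /orP[->//|/hs ->]; rewrite orbT.
- move=> z; rewrite inE => /orP[/eqP ->|/hc[y hy hE]]; first by exists x; rewrite ?mem_head.
  by exists y; rewrite // inE hy orbT.
- move=> a b; rewrite !inE => /orP[/eqP ->|ha] /orP[/eqP ->|hb] hE //.
  + by case: h; exists b.
  + by case: h; exists a => //; apply: Es.
  + exact: hp.
Qed.

(** * Local principality of a maximal ideal, without Dedekind theory *)

Section DedekindLocal.
Variables (A : comNzRingType).
Hypothesis domA : forall a b : A, a * b = 0 -> a = 0 \/ b = 0.
Hypothesis finA : forall a : A, a != 0 -> exists N, quotient_card a N.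
(* [A] is completely integrally closed *)
Hypothesis closedA : forall a b x : A, a != 0 -> x != 0 ->
  (forall n, exists y, b ^+ n * x = a ^+ n * y) -> exists y, b = a * y.
Variables (p : idealr A) (hp : maximal_ideal p).

Lemma finite_residue (a : A) : a != 0 ->
  exists s : seq A, forall x, exists2 y, y \in s & exists z, x = y + a * z.
Proof.
move=> a0; have [N [s hs]] := finA a0; exists s => x.
have [j [[y hy] _]] := hs x; exists (tnth s j); first exact: mem_tnth.
by exists y.
Qed.

Lemma finite_residue_pigeonhole (a : A) (x : nat -> A) : a != 0 ->
  exists m n, (m < n)%N /\ exists z, x m - x n = a * z.
Proof.
move=> a0; have [N [s hs]] := finA a0.
have H k : exists j, exists y, x k = tnth s j + a * y by have [j [h _]] := hs (x k); exists j.
have [j hj] := choice H.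
have [m [n [mn e]]] := pigeonhole_nat j.
exists m, n; split=> //; have [y hy] := hj m; have [y' hy'] := hj n.
by exists (y - y'); rewrite hy hy' e; ring.
Qed.

(** The fraction [b / a] multiplies [p] into [A] without lying in [A]. The product [s] of the
    representatives outside [p] absorbs every factor outside [p], so each element of [p] has a power
    annihilating [s] modulo [a]; multiplying [s] by the last nonzero power of each representative in
    [p] gives [b]. *)
Lemma socle_exists (a : A) : a != 0 -> a \in p -> exists b,
  ~ (exists y, b = a * y) /\ forall x, x \in p -> exists y, b * x = a * y.
Proof.
move=> a0 ap; have [R hR] := finite_residue a0.
pose I x := exists y, x = a * y.
have ID x y : I x -> I y -> I (x + y) by move=> [z ->] [w ->]; exists (z + w); ring.
have IM x y : I y -> I (x * y) by move=> [z ->]; exists (x * z); ring.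
have IMa x : I (a * x) by exists x.
pose s := \prod_(x <- R | x \notin p) x.
have sp : s \notin p.
  rewrite /s; elim/big_rec: _ => [|x y hx hy]; first exact: notin_ideal1.
  exact: maximal_notinM.
have I_p x : I x -> x \in p by move=> [y ->]; rewrite mulrC; apply: idealMr.
have s1 x y : x \notin p -> I (x * y) -> I (s * y).
  move=> hx hI; have [x' hx' [z e]] := hR x.
  have x'p : x' \notin p.
    apply: contra hx => hx; rewrite e; apply: rpredD => //.
    by rewrite mulrC; apply: idealMr.
  rewrite /s (big_rem x') //= x'p mulrAC mulrC; apply: IM.
  have -> : x' * y = x * y + a * (- z * y) by rewrite e; ring.
  exact: ID.
(* Two powers of [x] agree modulo [a], and [1 - x ^+ (n - m)] lies outside [p], so [s] absorbs
   it. *)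
have s2 x : x \in p -> exists k, I (s * x ^+ k).
  move=> hx; have [m [n [mn [z e]]]] := finite_residue_pigeonhole (fun k => x ^+ k) a0.
  exists m; apply: (s1 (1 - x ^+ (n - m))).
    apply/negP => h; case/negP: (notin_ideal1 p).
    rewrite -(subrK (x ^+ (n - m)) 1); apply: rpredD => //.
    by rewrite -(ltn_predK (_ : 0 < n - m)%N) ?subn_gt0 // exprSr; apply: idealMr.
  exists z; rewrite -e -[in RHS](subnK (ltnW mn)) exprD; ring.
have aux (r : seq A) : exists b, [/\ exists c, b = s * c, ~ I b &
    forall x, x \in r -> x \in p -> I (b * x)].
  elim: r => [|x r [b [[c bs] nb hb]]].
    by exists s; split=> //; [exists 1; rewrite mulr1 | move=> /I_p h; rewrite h in sp].
  have [xp|xp] := boolP (x \in p); last first.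
    exists b; split=> //; first by exists c.
    by move=> y; rewrite inE => /orP[/eqP ->|/hb//]; rewrite (negbTE xp).
  have [|k /asboolP hk kmin] := @ex_minnP (fun k => `[< I (b * x ^+ k) >]).
    have [k hk] := s2 x xp; exists k; apply/asboolP.
    by rewrite bs mulrAC mulrC; apply: IM.
  have k0 : (0 < k)%N by case: k hk {kmin} => //; rewrite expr0 mulr1.
  exists (b * x ^+ k.-1); split.
  - by exists (c * x ^+ k.-1); rewrite bs mulrA.
  - move=> h; have := kmin k.-1 (introT (asboolP _) h); by rewrite -ltnS prednK // ltnn.
  - move=> y; rewrite inE => /orP[/eqP -> _|hy yp].
      by rewrite -mulrA -exprSr prednK.
    by rewrite mulrAC mulrC; apply/IM/hb.
have [b [_ nb hb]] := aux R.
exists b; split=> // x hx; have [x' hx' [z e]] := hR x.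
have x'p : x' \in p.
  have -> : x' = x - z * a by rewrite e; ring.
  by apply: rpredB => //; apply: idealMr.
rewrite e mulrDr; apply: ID; first exact: hb.
by exists (b * z); ring.
Qed.

(** If [b / pi] mapped [p] into itself, complete integral closure would put it in [A]. So some [x]
    in [p] satisfies [b * x = pi * w] with [w] outside [p], and [x] generates [p] with denominator
    [w]. Being outside [p ^ 2], [pi] equals [x] up to factors outside [p] and is a generator as
    well. *)
Lemma local_generator_exists (pi : A) : pi \in p -> ~ ideal_pow p 2 pi ->
  exists u, local_generator p pi u.
Proof.
move=> pip pi2.
have pi0 : pi != 0 by apply/eqP => e; apply: pi2; rewrite e; apply: ideal_pow0.
have mulI (a x y : A) : a != 0 -> a * x = a * y -> x = y.
  move=> a0 /eqP; rewrite -subr_eq0 -mulrBr => /eqP /domA[h|/eqP].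
    by rewrite h eqxx in a0.
  by rewrite subr_eq0 => /eqP.
have [b [nb hb]] := socle_exists pi0 pip.
have [x [w [xp wp ew]]] : exists x w, [/\ x \in p, w \notin p & b * x = pi * w].
  apply: contrapT => h; apply: nb; apply: (@closedA pi b pi) => //.
  suff H n : exists2 y, y \in p & b ^+ n * pi = pi ^+ n * y.
    by move=> n; have [y _ e] := H n; exists y.
  elim: n => [|n [y yp e]]; first by exists pi; rewrite ?mul1r.
  have [y' e'] := hb y yp; exists y'.
    by apply/negPn/negP => hy'; apply: h; exists y, y'.
  by rewrite exprS -mulrA e mulrCA e' exprS; ring.
have loc y : y \in p -> exists z, w * y = z * x.
  move=> yp; have [z e] := hb y yp; exists z; apply: (mulI pi) => //.
  transitivity ((pi * w) * y); first by ring.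
  by rewrite -ew; transitivity ((b * y) * x); [ring | rewrite e; ring].
have [y' ey'] := loc _ pip.
have y'p : y' \notin p.
  apply/negP => hy'; apply: pi2; apply: (@ideal_pow_cancel _ _ hp _ w) => //.
  by rewrite ey'; apply: ideal_powS => //; apply/mem_ideal_pow1.
have w0 : w != 0 by apply: contraNneq wp => ->; rewrite rpred0.
exists y'; split=> // y yp; have [z e] := loc y yp; exists z; apply: (mulI w) => //.
transitivity (y' * (w * y)); first by ring.
rewrite e; transitivity (z * (y' * x)); first by ring.
by rewrite -ey'; ring.
Qed.

Lemma residue_field_system (a : A) : a != 0 -> a \in p ->
  exists (T : finType) (f : T -> A), residue_system (ideal_pow p 1) f /\ (1 < #|T|)%N.
Proof.
move=> a0 ap; have [R hR] := finite_residue a0.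
have [|x y|r [u hs hc hd]] := @pairwise_refine _ (fun x y => x - y \in p) ([:: 0, 1 & R]).
- by move=> x; rewrite subrr rpred0.
- by rewrite -opprB rpredN.
have hcov x : exists2 y, y \in r & x - y \in p.
  have [z hz [w e]] := hR x.
  have [|y hy hzy] := hc z; first by rewrite !inE hz !orbT.
  exists y => //; have -> : x - y = (z - y) + w * a by rewrite e; ring.
  by apply: rpredD => //; apply: idealMr.
exists 'I_(size r), (fun j : 'I_(size r) => r`_j); split; last first.
  rewrite card_ord ltnNge; apply/negP => h.
  have [y hy h0] := hcov 0; have [z hz h1] := hcov 1.
  have eyz : y = z.
    by case: r h hy hz {u hs hc hd hcov} => [|? []] //= _; rewrite !inE => /eqP -> /eqP ->.
  case/negP: (notin_ideal1 p).
  have -> : 1 = (1 - z) - (0 - y) by rewrite eyz; ring.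
  exact: rpredB.
split=> [x|j k /ideal_pow1 h].
  have [y hy hxy] := hcov x; have hj : (index y r < size r)%N by rewrite index_mem.
  by exists (Ordinal hj); rewrite /= nth_index //; apply/mem_ideal_pow1.
apply/val_inj/eqP; rewrite -(nth_uniq 0 _ _ u) ?ltn_ord //.
by apply/eqP; apply: hd h; apply: mem_nth; apply: ltn_ord.
Qed.

End DedekindLocal.

Section Residue.
Variables (A : comNzRingType) (p : idealr A).
Local Notation R := (completion p).
Local Notation quo := (\pi_({ideal_quot (@null_seq A p)})%qT).

Lemma quo_eqP (a b : coherent_seq p) :
  quo a = quo b <-> forall n, ideal_pow p n (seq_of a n - seq_of b n).
Proof.
have e : (a - b \in @null_seq A p) = (quo a == quo b) := Quotient.idealrBE _ a b.
split=> [/eqP|h]; first by rewrite -e => /asboolP.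
by apply/eqP; rewrite -e; apply/asboolP.
Qed.

Lemma residue_quo (a : coherent_seq p) n : ideal_pow p n (residue (quo a : R) n - seq_of a n).
Proof. by move: n; apply/quo_eqP; rewrite reprK. Qed.

Lemma residue_seq (c : nat -> A) : (forall n, ideal_pow p n (c n.+1 - c n)) ->
  exists al : R, forall n, ideal_pow p n (residue al n - c n).
Proof.
move=> hc; pose a := @CoherentSeq A p c (introT (asboolP _) hc).
by exists (quo a) => n; apply: (residue_quo a).
Qed.

Lemma residue_coherent (al : R) n : ideal_pow p n (residue al n.+1 - residue al n).
Proof. by have /asboolP := seq_ofP (repr al); apply. Qed.

Lemma residue_inj (al be : R) :
  (forall n, ideal_pow p n (residue al n - residue be n)) -> al = be.
Proof. by move=> h; rewrite -[al]reprK -[be]reprK; apply/quo_eqP. Qed.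

Let residue_op (al : R) (a : coherent_seq p) n :
  al = quo a -> ideal_pow p n (residue al n - seq_of a n).
Proof. by move=> ->; apply: residue_quo. Qed.

Lemma residueD (al be : R) n :
  ideal_pow p n (residue (al + be) n - (residue al n + residue be n)).
Proof.
apply: (residue_op (a := repr al + repr be)).
by rewrite rmorphD /= !reprK.
Qed.
Lemma residueN (al : R) n : ideal_pow p n (residue (- al) n - (- residue al n)).
Proof.
apply: (residue_op (a := - repr al)).
by rewrite rmorphN /= !reprK.
Qed.
Lemma residueM (al be : R) n :
  ideal_pow p n (residue (al * be) n - (residue al n * residue be n)).
Proof.
apply: (residue_op (a := repr al * repr be)).
by rewrite rmorphM /= !reprK.
Qed.
Lemma residue1 n : ideal_pow p n (residue (1 : R) n - 1).
Proof. by apply: (residue_op (a := 1)); rewrite rmorph1. Qed.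
Lemma residue0 n : ideal_pow p n (residue (0 : R) n - 0).
Proof. by apply: (residue_op (a := 0)); rewrite rmorph0. Qed.
End Residue.

(** * Torsion and Tate modules over [A] *)

Section Torsion.
Variables (A : comNzRingType) (p : idealr A) (M : lmodType A).

Definition tors n (x : M) := forall a, ideal_pow p n a -> a *: x = 0.

Lemma torsO n : tors n 0. Proof. by move=> a _; rewrite scaler0. Qed.
Lemma torsD n x y : tors n x -> tors n y -> tors n (x + y).
Proof. by move=> hx hy a ha; rewrite scalerDr hx // hy // addr0. Qed.
Lemma torsN n x : tors n x -> tors n (- x).
Proof. by move=> hx a ha; rewrite scalerN hx // oppr0. Qed.
Lemma torsB n x y : tors n x -> tors n y -> tors n (x - y).
Proof. by move=> hx hy; apply/torsD/torsN. Qed.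
Lemma torsZ n b x : tors n x -> tors n (b *: x).
Proof. by move=> hx a ha; rewrite scalerA; apply: hx; rewrite mulrC; apply: ideal_powMl. Qed.
Lemma tors_sum n I (r : seq I) (P : pred I) (F : I -> M) :
  (forall j, P j -> tors n (F j)) -> tors n (\sum_(j <- r | P j) F j).
Proof. by move=> h; elim/big_rec: _ => [|j x Pj]; [apply: torsO | apply/torsD/h]. Qed.
Lemma tors0 x : tors 0 x -> x = 0.
Proof. by move=> h; rewrite -[x]scale1r; apply: h. Qed.
Lemma torsZ_pow m n a x : ideal_pow p m a -> tors (n + m) x -> tors n (a *: x).
Proof.
by move=> ha hx b hb; rewrite scalerA; apply: hx; apply: ideal_pow_add.
Qed.
Lemma tors_mod n a b x : ideal_pow p n (a - b) -> tors n x -> a *: x = b *: x.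
Proof. by move=> hab hx; apply/eqP; rewrite -subr_eq0 -scalerBl hx. Qed.

Hypothesis hp : maximal_ideal p.

Lemma tors_inverse n w : w \notin p -> exists e, forall x, tors n x -> e *: (w *: x) = x.
Proof.
move=> hw; have [e he] := ideal_pow_inverse hp n hw; exists e => x hx.
rewrite scalerA mulrC -[RHS]scale1r; apply/esym; exact: tors_mod he hx.
Qed.

Variables (pi u : A) (hpi : local_generator p pi u).
Hypothesis pi_reg : forall x, pi * x = 0 -> x = 0.

Lemma tors_pi n x : tors n.+1 x -> tors n (pi *: x).
Proof.
have [hp1 _ _] := hpi => hx; apply: (@torsZ_pow 1); rewrite ?addn1 //.
exact/mem_ideal_pow1.
Qed.

Lemma tors_ker n x : tors n x -> pi *: x = 0 -> tors 1 x.
Proof.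
have [hp1 hu hloc] := hpi => hx h0 a /ideal_pow1 /hloc[z e].
have [f hf] := tors_inverse n hu.
rewrite -(hf (a *: x)); last exact: torsZ.
by rewrite !scalerA -mulrA e mulrA -scalerA h0 scaler0.
Qed.

(* Multiplication by [pi] need not be onto, but it is so on [p]-power torsion as soon
   as one element of [p], outside [p ^ 2], acts surjectively. *)
Lemma tors_div (rho w : A) : local_generator p rho w ->
  (forall x : M, exists y, rho *: y = x) ->
  forall n x, tors n x -> exists2 y, tors n.+1 y & pi *: y = x.
Proof.
move=> hrho surj n x hx; have [hr hw hwloc] := hrho.
have [hp1 hu hloc] := hpi.
have [y0 e0] := surj x.
have h0 : rho ^+ n.+1 *: y0 = 0.
  by rewrite exprSr -scalerA e0; apply: hx; apply: ideal_powX.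
have hy1 : tors n.+1 (w ^+ n.+1 *: y0).
  move=> a /(local_generator_pow hrho)[z e].
  by rewrite scalerA mulrC e -scalerA h0 scaler0.
have [e he] := ideal_pow_inverse hp n (maximal_notinX hp n.+1 hw).
pose y2 := e *: (w ^+ n.+1 *: y0).
have ey2 : rho *: y2 = x.
  transitivity ((w ^+ n.+1 * e) *: (rho *: y0)).
    by rewrite /y2 !scalerA; congr (_ *: _); ring.
  rewrite e0 -[RHS]scale1r; apply/esym.
  exact: tors_mod he hx.
have hy2 : tors n.+1 y2 by apply: torsZ.
have [z ez] := hloc _ hr.
have [f hf] := tors_inverse n hu.
exists (f *: (z *: y2)); first by do 2 apply: torsZ.
have -> : pi *: (f *: (z *: y2)) = f *: ((z * pi) *: y2).
  by rewrite !scalerA; congr (_ *: _); ring.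
by rewrite -ez -scalerA ey2 hf.
Qed.

Hypothesis div : forall n x, tors n x -> exists2 y, tors n.+1 y & pi *: y = x.

Definition tate (b : nat -> M) := forall n, tors n (b n) /\ pi *: b n.+1 = b n.

Lemma tate_lift x : tors 1 x -> exists2 b, tate b & b 1%N = x.
Proof.
move=> hx.
have H (u0 : nat * M) : exists y, tors u0.1 u0.2 -> tors u0.1.+1 y /\ pi *: y = u0.2.
  have [h|h] := pselect (tors u0.1 u0.2); last by exists 0.
  by have [y] := div h; exists y.
have [f hf] := choice H.
(* The sequence starts with 0, the only torsion of level 0; [x] sits at index 1. *)
pose b := fix b n := if n is m.+1 then (if m is m'.+1 then f (m, b m) else x) else 0.
have hb : forall n, tors n (b n).
  by case=> [|n]; [apply: torsO | elim: n => [|n IH] //; have [] := hf (n.+1, b n.+1) IH].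
exists b => // -[|n]; split=> //.
  by apply: tors0; apply: tors_pi.
by have [] := hf (n.+1, b n.+1) (hb n.+1).
Qed.

Lemma tate_scaleX b m n : tate b -> pi ^+ m *: b (m + n)%N = b n.
Proof.
move=> hb; elim: m => [|m IH]; first by rewrite scale1r.
by rewrite exprSr -scalerA addSn (hb _).2.
Qed.

Section Basis.
Variables (d : nat) (b : 'I_d -> nat -> M) (hb : forall j, tate (b j)).
Hypothesis span1 : forall x, tors 1 x -> exists a : 'I_d -> A, x = \sum_j a j *: b j 1%N.
Hypothesis indep1 : forall a : 'I_d -> A, \sum_j a j *: b j 1%N = 0 ->
  forall j, a j \in p.

(** Coefficients of [pi *: x] at level [n] approximate [x] up to an error killed by [pi], which is a
    combination of the vectors [b j 1 = pi ^+ n *: b j n.+1]. *)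
Lemma tate_span n x : tors n x -> exists a : 'I_d -> A, x = \sum_j a j *: b j n.
Proof.
elim: n x => [|n IH] x hx.
  exists (fun=> 0); rewrite (tors0 hx) big1 // => j _; exact: scale0r.
have [a ea] := IH _ (tors_pi hx).
have hy : tors 1 (x - \sum_j a j *: b j n.+1).
  apply: (@tors_ker n.+1).
    by apply: torsB => //; apply: tors_sum => j _; apply/torsZ; case: (hb j n.+1).
  rewrite scalerBr scaler_sumr ea; apply/eqP; rewrite subr_eq0; apply/eqP.
  by apply: eq_bigr => j _; rewrite scalerA mulrC -scalerA (hb j n).2.
have [c ec] := span1 hy.
exists (fun j => a j + c j * pi ^+ n).
rewrite -[LHS](subrK (\sum_j a j *: b j n.+1)) ec addrC -big_split.
apply: eq_bigr => j _ /=; rewrite scalerDl -scalerA.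
by rewrite -[n.+1 in X in _ = _ + X]addn1 tate_scaleX.
Qed.

(** Multiplication by [pi ^+ n] descends to level 1 and puts all coefficients in [p]; dividing them
    by [pi], with denominator [u], leaves a relation at level [n]. *)
Lemma tate_indep n (a : 'I_d -> A) : \sum_j a j *: b j n = 0 ->
  forall j, ideal_pow p n (a j).
Proof.
have [hp1 hu hloc] := hpi.
elim: n a => [|n IH] a e j //.
have hap l : a l \in p.
  move: l; apply: indep1.
  transitivity (pi ^+ n *: \sum_j a j *: b j n.+1); last by rewrite e scaler0.
  rewrite scaler_sumr; apply: eq_bigr => l _.
  by rewrite scalerA mulrC -scalerA -[n.+1]addn1 tate_scaleX.
have [z hz] := choice (fun l => hloc _ (hap l)).
have hz0 l : ideal_pow p n (z l).
  apply: IH; transitivity (u *: \sum_j a j *: b j n.+1); last by rewrite e scaler0.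
  rewrite scaler_sumr; apply: eq_bigr => k _.
  by rewrite scalerA hz -scalerA (hb k n).2.
apply: (ideal_pow_cancel hp (a := u)) => //.
by rewrite hz mulrC; apply: ideal_powS.
Qed.

Lemma tate_coord n (a c : 'I_d -> A) : \sum_j a j *: b j n = \sum_j c j *: b j n ->
  forall j, ideal_pow p n (a j - c j).
Proof.
move=> e; apply: tate_indep; apply/eqP.
under eq_bigr => j _ do rewrite scalerBl.
by rewrite sumrB subr_eq0 e.
Qed.

Lemma tate_comb_mod n (a c : 'I_d -> A) : (forall j, ideal_pow p n (a j - c j)) ->
  \sum_j a j *: b j n = \sum_j c j *: b j n.
Proof.
by move=> h; apply: eq_bigr => j _; apply: tors_mod (h j) _; case: (hb j n).
Qed.

(** Coordinates at successive levels agree modulo [p ^ n] and so define elements of the completion;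
    independence at each level gives uniqueness. *)
Lemma tate_coordinates x : tate x -> exists! al : 'cV[completion p]_d,
  forall n, x n = \sum_j residue (al j 0) n *: b j n.
Proof.
move=> hx; have [a ha] := choice (fun n => tate_span (hx n).1).
have hc j n : ideal_pow p n (a n.+1 j - a n j).
  move: j; apply: tate_coord; rewrite -ha -(hx n).2 ha scaler_sumr.
  by apply: eq_bigr => j _; rewrite scalerA mulrC -scalerA (hb j n).2.
have [al hal] := choice (fun j => residue_seq (hc j)).
exists (\col_j al j); split=> [n|be hbe].
  by rewrite [LHS]ha; apply: tate_comb_mod => j; rewrite mxE -opprB; apply: ideal_powN.
apply/matrixP => j k; rewrite ord1 mxE; apply: residue_inj => n.
have -> : residue (al j) n - residue (be j 0) n = (residue (al j) n - a n j) +
  (a n j - residue (be j 0) n) by ring.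
apply: ideal_powD; first exact: hal.
by move: j; apply: tate_coord; rewrite -ha hbe.
Qed.

Lemma tors_card (T : finType) (f : T -> A) n : residue_system (ideal_pow p n) f ->
  exists (S : finType) (g : S -> M), [/\ #|S| = (#|T| ^ d)%N, injective g &
    forall x, tors n x <-> exists c, x = g c].
Proof.
move=> [f1 f2]; exists {ffun 'I_d -> T}, (fun c : {ffun 'I_d -> T} => \sum_j f (c j) *: b j n); split.
- by rewrite card_ffun card_ord.
- move=> c c' /tate_coord h; apply/ffunP => j; exact/f2/h.
- move=> x; split=> [hx|[c ->]]; last first.
    by apply: tors_sum => j _; apply/torsZ; case: (hb j n).
  have [a ->] := tate_span hx; have [c hc] := choice (fun j => f1 (a j)).
  exists (finfun c); apply: tate_comb_mod => j; rewrite ffunE; exact: hc.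
Qed.

End Basis.

(** A generating family of least size: a relation with a coefficient outside [p], invertible on
    [p]-torsion, would eliminate a generator. *)
Lemma torsion_basis (s : seq M) : (forall x, tors 1 x -> x \in s) ->
  exists d (be : 'I_d -> M), [/\ forall j, tors 1 (be j),
    forall x, tors 1 x -> exists a : 'I_d -> A, x = \sum_j a j *: be j &
    forall a : 'I_d -> A, \sum_j a j *: be j = 0 -> forall j, a j \in p].
Proof.
move=> hs.
pose Q d := `[< exists be : 'I_d -> M, (forall j, tors 1 (be j)) /\
  forall x, tors 1 x -> exists a : 'I_d -> A, x = \sum_j a j *: be j >].
have [|d /asboolP[be [h1 h2]] dmin] := @ex_minnP Q.
  pose s' := [seq x <- s | `[< tors 1 x >]].
  exists (size s'); apply/asboolP; exists (fun j => s'`_j); split.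
    by move=> j; have := mem_nth 0 (ltn_ord j); rewrite mem_filter => /andP[/asboolP].
  move=> x hx; have xs : x \in s' by rewrite mem_filter asboolT // hs.
  have hj : (index x s' < size s')%N by rewrite index_mem.
  exists (fun j => if j == Ordinal hj then 1 else 0).
  rewrite (bigD1 (Ordinal hj)) //= eqxx scale1r nth_index // big1 ?addr0 // => j /negbTE ->.
  exact: scale0r.
exists d, be; split=> // a e j; apply/negPn/negP => haj.
case: d be h1 h2 dmin a e j haj => [|d] be h1 h2 dmin a e j haj; first by case: j haj.
suff : (d.+1 <= d)%N by rewrite ltnn.
apply: dmin; apply/asboolP; exists (fun l => be (lift j l)); split=> // x /h2[c ->].
have [f hf] := tors_inverse 1 haj.
exists (fun l => c (lift j l) - c j * f * a (lift j l)).
rewrite (bigD1_ord j) //= in e *; rewrite (bigD1_ord j) //=.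
move/eqP: e; rewrite addr_eq0 => /eqP e.
rewrite -{1}(hf (be j) (h1 j)) e scalerN scaler_sumr scalerN scaler_sumr -sumrN -big_split.
by apply: eq_bigr => l _ /=; rewrite scalerBl addrC !scalerA.
Qed.

End Torsion.

(** * Drinfeld modules and the rank of their torsion *)

Section TauEval.
Variables (q ell e : nat) (M : fieldType) (hell : ell \in [pchar M]).
Hypotheses (hq : q = (ell ^ e)%N) (e0 : (0 < e)%N).
Implicit Types f g : {poly M}.

Let q1 : (1 < q)%N.
Proof.
rewrite hq; apply: leq_ltn_trans e0 _; apply: ltn_expl.
exact/prime_gt1/(pcharf_prime hell).
Qed.

Lemma pcharq_exprD j (x y : M) : (x + y) ^+ (q ^ j) = x ^+ (q ^ j) + y ^+ (q ^ j).
Proof. by rewrite hq -expnM; apply: pchar_exprD. Qed.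

Lemma pcharq_expr_sum j I (r : seq I) (P : pred I) (F : I -> M) :
  (\sum_(k <- r | P k) F k) ^+ (q ^ j) = \sum_(k <- r | P k) F k ^+ (q ^ j).
Proof.
elim/big_rec2: _ => [|k x y _ <-]; last exact: pcharq_exprD.
by rewrite expr0n gtn_eqF // expn_gt0 ltnW.
Qed.

Lemma tau_eval_wide f n x : (size f <= n)%N ->
  tau_eval q f x = \sum_(j < n) f`_j * x ^+ (q ^ j).
Proof.
move=> h; rewrite /tau_eval (big_ord_widen _ (fun j => f`_j * x ^+ (q ^ j)) h).
rewrite big_mkcond; apply: eq_bigr => j _; case: ltnP => // hj.
by rewrite nth_default ?mul0r.
Qed.

Lemma tau_evalDr f x y : tau_eval q f (x + y) = tau_eval q f x + tau_eval q f y.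
Proof. by rewrite -big_split; apply: eq_bigr => j _; rewrite pcharq_exprD mulrDr. Qed.

Lemma tau_evalDl f g x : tau_eval q (f + g) x = tau_eval q f x + tau_eval q g x.
Proof.
pose n := maxn (size f) (size g).
rewrite (tau_eval_wide _ (size_polyD _ _)) (@tau_eval_wide f n) ?leq_maxl //.
rewrite (@tau_eval_wide g n) ?leq_maxr // -big_split.
by apply: eq_bigr => j _; rewrite coefD mulrDl.
Qed.

Lemma tau_evalC (c x : M) : tau_eval q c%:P x = c * x.
Proof.
rewrite (@tau_eval_wide _ 1) ?size_polyC ?leq_b1 //.
by rewrite big_ord1 coefC eqxx expn0 expr1.
Qed.

Lemma tau_eval0 (x : M) : tau_eval q 0 x = 0.
Proof. by rewrite /tau_eval size_poly0 big_ord0. Qed.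

Lemma tau_evalZX (c : M) j x : tau_eval q (c *: 'X^j) x = c * x ^+ (q ^ j).
Proof.
rewrite (@tau_eval_wide _ j.+1); last first.
  by apply: leq_trans (size_scale_leq _ _) _; rewrite size_polyXn.
rewrite big_ord_recr /= coefZ coefXn eqxx mulr1 big1 ?add0r // => l _.
by rewrite coefZ coefXn ltn_eqF ?mulr0 ?mul0r.
Qed.

Lemma tau_eval_mul f g x : tau_eval q (tau_mul q f g) x = tau_eval q f (tau_eval q g x).
Proof.
have sumE I (r : seq I) (F : I -> {poly M}) :
    tau_eval q (\sum_(k <- r) F k) x = \sum_(k <- r) tau_eval q (F k) x.
  by elim/big_rec2: _ => [|k u w _ <-]; rewrite ?tau_eval0 ?tau_evalDl.
rewrite /tau_mul sumE; apply: eq_bigr => j _; rewrite sumE.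
rewrite {2}/tau_eval pcharq_expr_sum mulr_sumr; apply: eq_bigr => l _.
by rewrite tau_evalZX exprMn -exprM -expnD addnC mulrA.
Qed.

Lemma size_tau_mul f g : f != 0 -> g != 0 ->
  (size (tau_mul q f g)).-1 = ((size f).-1 + (size g).-1)%N.
Proof.
move=> f0 g0; set m := (size f).-1; set n := (size g).-1.
have sf : size f = m.+1 by rewrite prednK // size_poly_gt0.
have sg : size g = n.+1 by rewrite prednK // size_poly_gt0.
have ce l : (tau_mul q f g)`_l =
    \sum_(a < m.+1) \sum_(b < n.+1) f`_a * g`_b ^+ (q ^ a) * (l == a + b)%N%:R.
  rewrite /tau_mul sf sg coef_sum; apply: eq_bigr => a _.
  by rewrite coef_sum; apply: eq_bigr => b _; rewrite coefZ coefXn.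
have top : (tau_mul q f g)`_(m + n) = f`_m * g`_n ^+ (q ^ m).
  rewrite ce big_ord_recr /= big1 ?add0r => [|a _].
    rewrite big_ord_recr /= eqxx mulr1 big1 ?add0r // => b _.
    by rewrite eqn_add2l gtn_eqF ?mulr0.
  rewrite big1 // => b _; rewrite gtn_eqF ?mulr0 // -addSn leq_add //.
  by rewrite -ltnS.
have top0 : (tau_mul q f g)`_(m + n) != 0.
  rewrite top mulf_neq0 ?expf_neq0 //.
    by rewrite -lead_coefE lead_coef_eq0.
  by rewrite -lead_coefE lead_coef_eq0.
have h1 : (size (tau_mul q f g) <= (m + n).+1)%N.
  apply/leq_sizeP => l hl; rewrite ce big1 // => a _; rewrite big1 // => b _.
  rewrite gtn_eqF ?mulr0 //; apply: leq_ltn_trans hl.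
  by rewrite leq_add // -ltnS.
have h2 : (m + n < size (tau_mul q f g))%N.
  by rewrite ltnNge; apply: contra top0 => h; rewrite nth_default.
by have -> : size (tau_mul q f g) = (m + n).+1 by apply/eqP; rewrite eqn_leq h1 h2.
Qed.

Definition add_poly f : {poly M} := \sum_(j < size f) f`_j *: 'X^(q ^ j).

Lemma add_polyE f n : size f = n -> add_poly f = \sum_(j < n) f`_j *: 'X^(q ^ j).
Proof. by move=> <-. Qed.

Lemma tau_eval_horner f x : tau_eval q f x = (add_poly f).[x].
Proof. by rewrite horner_sum; apply: eq_bigr => j _; rewrite hornerZ hornerXn. Qed.

Lemma size_add_poly f : f != 0 -> size (add_poly f) = (q ^ (size f).-1).+1.
Proof.
move=> f0; have sf : (size f).-1.+1 = size f by rewrite prednK // size_poly_gt0.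
rewrite (add_polyE (esym sf)) big_ord_recr /= addrC.
have c0 : f`_(size f).-1 != 0 by rewrite -lead_coefE lead_coef_eq0.
rewrite size_polyDl size_scale // size_polyXn // ltnS.
apply: leq_trans (size_sum _ _ _) _; apply/bigmax_leqP => j _.
apply: leq_trans (size_scale_leq _ _) _; rewrite size_polyXn.
by rewrite ltn_exp2l.
Qed.

(** In characteristic [ell] only the linear term has a nonzero derivative, so a nonzero linear
    coefficient means separability. *)
Lemma deriv_add_poly f : f != 0 -> (add_poly f)^`() = (f`_0)%:P.
Proof.
move=> f0; have sf : (size f).-1.+1 = size f by rewrite prednK // size_poly_gt0.
rewrite (add_polyE (esym sf)).
rewrite raddf_sum big_ord_recl /= expn0 derivZ derivXn expr0 alg_polyC big1 ?addr0 // => j _.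
rewrite derivZ derivXn -scaler_nat hq /bump /= add1n -expnM mulnS expnD natrM natrX.
by rewrite (pcharf0 hell) expr0n gtn_eqF // mul0r scale0r scaler0.
Qed.

Hypothesis hM : forall f, separable_poly f -> (1 < size f)%N -> exists x, root f x.

Lemma add_poly_separable f y : f`_0 != 0 -> separable_poly (add_poly f - y%:P).
Proof.
move=> h0; have f0 : f != 0 by apply: contraNneq h0 => ->; rewrite coef0.
have -> : separable_poly (add_poly f - y%:P) =
  coprimep (add_poly f - y%:P) (add_poly f - y%:P)^`() by rewrite unlock.
by rewrite derivB derivC subr0 deriv_add_poly // -[(f`_0)%:P]alg_polyC coprimepZr // coprimep1.
Qed.

Lemma size_add_polyB f y : f != 0 -> size (add_poly f - y%:P) = (q ^ (size f).-1).+1.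
Proof.
move=> f0; rewrite -(size_add_poly f0); apply: size_polyDl; rewrite size_polyN.
by apply: leq_ltn_trans (size_polyC_leq1 _) _; rewrite size_add_poly // ltnS expn_gt0 ltnW.
Qed.

Lemma tau_eval_surj f y : f`_0 != 0 -> exists x, tau_eval q f x = y.
Proof.
move=> h0; have f0 : f != 0 by apply: contraNneq h0 => ->; rewrite coef0.
have [|x] := hM (add_poly_separable y h0).
  by rewrite size_add_polyB // ltnS expn_gt0 ltnW.
by rewrite /root !hornerE subr_eq0 => /eqP e1; exists x; rewrite tau_eval_horner.
Qed.

Lemma tau_kernel_le f : f != 0 -> exists2 s : seq M,
  (forall x, tau_eval q f x = 0 -> x \in s) & (size s <= q ^ (size f).-1)%N.
Proof.
move=> f0; have sf := size_add_poly f0.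
have g0 : add_poly f != 0 by rewrite -size_poly_gt0 sf.
have [rs u hrs] := roots_seq g0; exists rs.
  by move=> x; rewrite tau_eval_horner hrs => /rootP.
rewrite -ltnS -sf; apply: max_poly_roots => //.
by apply/allP => x; rewrite hrs.
Qed.

Lemma tau_kernel_eq f : f`_0 != 0 -> exists2 s : seq M, uniq s &
  (forall x, x \in s <-> tau_eval q f x = 0) /\ size s = (q ^ (size f).-1)%N.
Proof.
move=> h0; have f0 : f != 0 by apply: contraNneq h0 => ->; rewrite coef0.
have := add_poly_separable 0 h0; rewrite subr0 => hs.
have [rs [u hrs _ hsz]] := separable_split hM hs.
exists rs => //; split; last by rewrite hsz size_add_poly.
move=> x; rewrite hrs tau_eval_horner; split=> [/rootP//|h]; exact/rootP.
Qed.

End TauEval.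

Section DrinfeldModule.
Variables (k : finFieldType) (A : comNzRingType) (kA : {rmorphism k -> A}).
Variables (M : fieldType) (kM : {rmorphism k -> M}) (phi : A -> {poly M}).
Hypothesis hphi : drinfeld_module kA kM phi.

Lemma finField_card : exists ell e, [/\ ell \in [pchar M], #|k| = (ell ^ e)%N & (0 < e)%N].
Proof.
have [ell ell_pr hell] := finPcharP k.
have [n hn] : exists n, #|k| = (ell ^ n)%N by eexists; apply: card_pprimeChar hell.
exists ell, n; split=> //; first by rewrite (fmorph_pchar kM).
rewrite lt0n; apply/eqP => n0; have := finNzRing_gt1 k; by rewrite hn n0.
Qed.

Lemma drinfeld0 : phi 0 = 0.
Proof. by apply: (@addrI _ (phi 0)); rewrite -(drinfeldD hphi) !addr0. Qed.
Lemma drinfeldN a : phi (- a) = - phi a.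
Proof. by apply/eqP; rewrite -addr_eq0 -(drinfeldD hphi) addNr drinfeld0. Qed.
Lemma drinfeldB a b : phi (a - b) = phi a - phi b.
Proof. by rewrite (drinfeldD hphi) drinfeldN. Qed.
Lemma drinfeld1 : phi 1 = 1.
Proof. by rewrite -(rmorph1 kA) (drinfeld_scalar hphi) rmorph1. Qed.

Definition act a x := tau_eval #|k| (phi a) x.

Lemma act_is_module : [/\ forall a b x, act a (act b x) = act (a * b) x,
  forall x, act 1 x = x, forall a x y, act a (x + y) = act a x + act a y &
  forall x a b, act (a + b) x = act a x + act b x].
Proof.
have [ell [e [hell hq e0]]] := finField_card.
split=> *; rewrite /act.
- by rewrite (drinfeldM hphi) (tau_eval_mul hell hq e0).
- by rewrite drinfeld1 tau_evalC mul1r.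
- exact: (tau_evalDr hell hq).
- by rewrite (drinfeldD hphi) tau_evalDl.
Qed.

(** A copy of [M] on which [A] acts through [phi]. The dummy argument keeps the module structures of
    different Drinfeld modules on one field apart, as needed for [D] and [E] on [Ks]. *)
Definition dmod of drinfeld_module kA kM phi : Type := M.
HB.instance Definition _ := GRing.Zmodule.on (dmod hphi).
Let mulA : forall a b (x : dmod hphi), act a (act b x) = act (a * b) x.
Proof. by case: act_is_module. Qed.
Let mul1 : left_id (1 : A) (act : A -> dmod hphi -> dmod hphi).
Proof. by case: act_is_module => _ h _ _ x; apply: h. Qed.
Let mulDr : right_distributive (act : A -> dmod hphi -> dmod hphi) +%R.
Proof. by case: act_is_module => _ _ h _ a x y; apply: h. Qed.
Let mulDl : forall x : dmod hphi, {morph (fun a => act a x : dmod hphi) : a b / a + b >-> a + b}.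
Proof. by case: act_is_module => _ _ _ h x a b; apply: h. Qed.
HB.instance Definition _ :=
  GRing.Zmodule_isLmodule.Build A (dmod hphi) mulA mul1 mulDr mulDl.

Lemma drinfeld_coef0M a b : (phi (a * b))`_0 = (phi a)`_0 * (phi b)`_0.
Proof.
rewrite (drinfeldM hphi) /tau_mul.
have [->|fa] := eqVneq (phi a) 0; first by rewrite size_poly0 big_ord0 coef0 mul0r.
have [->|fb] := eqVneq (phi b) 0.
  rewrite coef0 mulr0 big1 ?coef0 // => j _; by rewrite size_poly0 big_ord0.
have sa : size (phi a) = (size (phi a)).-1.+1 by rewrite prednK // size_poly_gt0.
have sb : size (phi b) = (size (phi b)).-1.+1 by rewrite prednK // size_poly_gt0.
rewrite sa sb coef_sum big_ord_recl coef_sum big_ord_recl /= coefZ coefXn eqxx mulr1 expn0 expr1.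
rewrite big1 ?addr0 => [|j _]; last by rewrite coefZ coefXn mulr0.
rewrite big1 ?addr0 // => j _; rewrite coef_sum big1 // => l _.
by rewrite coefZ coefXn mulr0.
Qed.

Lemma drinfeld_coef0X a n : (phi (a ^+ n))`_0 = (phi a)`_0 ^+ n.
Proof.
elim: n => [|n IH]; first by rewrite !expr0 drinfeld1 coefC.
by rewrite !exprS drinfeld_coef0M IH.
Qed.

Lemma drinfeld_coef0B a b : (phi (a - b))`_0 = (phi a)`_0 - (phi b)`_0.
Proof. by rewrite drinfeldB coefB. Qed.

End DrinfeldModule.

Lemma drinfeld_map (k : finFieldType) (A : comNzRingType) (kA : {rmorphism k -> A})
    (K L : fieldType) (kK : {rmorphism k -> K}) (i : {rmorphism K -> L})
    (phi : A -> {poly K}) :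
  drinfeld_module kA kK phi -> drinfeld_module kA (i \o kK) (fun a => map_poly i (phi a)).
Proof.
case=> hD hM hs [a ha]; split.
- by move=> x y; rewrite hD rmorphD.
- move=> x y; rewrite hM /tau_mul rmorph_sum !size_map_poly; apply: eq_bigr => j _ /=.
  rewrite rmorph_sum; apply: eq_bigr => l _ /=.
  by rewrite map_polyZ map_polyXn !coef_map rmorphM rmorphXn.
- by move=> c; rewrite hs map_polyC.
- by exists a; rewrite size_map_poly.
Qed.

(** Take [n = C]: if [d] exceeded [r], the two powers would differ by a factor of at least [N ^ C],
    which exceeds [C]. *)
Lemma leq_exp_rate (N C d r : nat) : (1 < N)%N ->
  (forall n, N ^ (n * d) <= C * N ^ (n * r))%N -> (d <= r)%N.
Proof.
move=> N1 h; rewrite leqNgt; apply/negP => rd.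
have := h C; rewrite leqNgt => /negP; apply.
apply: leq_trans (_ : (N ^ C * N ^ (C * r) <= _)%N).
  by rewrite ltn_mul2r expn_gt0 ltnW //= ltn_expl.
by rewrite -expnD leq_exp2l // -mulnS leq_mul2l rd orbT.
Qed.

(** * Counting the torsion points of a Drinfeld module *)

Section Rank.
Variables (k : finFieldType) (A : comNzRingType) (kA : {rmorphism k -> A}).
Variables (L : fieldType) (kL : {rmorphism k -> L}) (psi : A -> {poly L}).
Hypothesis hpsi : drinfeld_module kA kL psi.
Variables (r : nat) (hrank : drinfeld_rank k psi r).
Hypothesis domA : forall a b : A, a * b = 0 -> a = 0 \/ b = 0.
Hypothesis hL : forall f : {poly L}, separable_poly f -> (1 < size f)%N -> exists x, root f x.
Local Notation q := #|k|.
Local Notation deg a := (size (psi a)).-1.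
Local Notation M := (dmod hpsi).

Let q1 : (1 < q)%N. Proof. exact: finNzRing_gt1. Qed.

Lemma rank_gt0 : (0 < r)%N.
Proof.
have [a ha] := drinfeld_pos hpsi.
have a0 : a != 0 by apply: contraTneq ha => ->; rewrite (drinfeld0 hpsi) size_poly0.
have [N _ e] := hrank a0; rewrite lt0n; apply/eqP => r0.
move: e; rewrite r0 expn0 => /eqP; rewrite gtn_eqF // -(expn0 q) ltn_exp2l //.
by rewrite -subn1 subn_gt0.
Qed.

Lemma quotient_card_system (a : A) N : quotient_card a N ->
  exists f : 'I_N -> A, residue_system (fun x => exists z, x = a * z) f.
Proof.
move=> [s hs]; exists (tnth s); split.
  move=> x; have [j [[y e] _]] := hs x; exists j; exists y; rewrite e; ring.
move=> j l [z e]; have [j0 [_ h]] := hs (tnth s j).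
rewrite -(h j); last by exists 0; rewrite mulr0 addr0.
by apply: h; exists z; rewrite -e; ring.
Qed.

Lemma drinfeld_neq0 a : a != 0 -> psi a != 0.
Proof.
move=> a0; have [N [s hs] e] := hrank a0; apply/negP => /eqP h.
move: e; rewrite h size_poly0 /= => e.
have N1 : N = 1%N.
  apply/eqP; rewrite -(eqn_exp2r N 1 rank_gt0) exp1n -e; by [].
have [j0 [[y0 e0] _]] := hs 0; have [j1 [[y1 e1] _]] := hs 1.
have ej : j0 = j1 by apply/val_inj; case: j0 j1 {e0 e1} => a1 h1 [a2 h2] /=; move: h1 h2; rewrite N1; case: a1 a2 => [|?] [|?].
have : psi 1 = 0.
  have -> : 1 = a * (y1 - y0) :> A.
    transitivity (tnth s j1 + a * y1 - (tnth s j0 + a * y0)); last by rewrite ej; ring.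
    by rewrite -e0 -e1 subr0.
  by rewrite (drinfeldM hpsi) h /tau_mul size_poly0 big_ord0.
by rewrite (drinfeld1 hpsi) => /eqP; rewrite oner_eq0.
Qed.

Lemma drinfeld_size_mul a b : a != 0 -> (size (psi (a * b)) <= deg a + size (psi b))%N.
Proof.
move=> a0; have [->|b0] := eqVneq b 0.
  by rewrite mulr0 (drinfeld0 hpsi) size_poly0.
have [ell [e [hell hq e0]]] := finField_card kL.
rewrite (drinfeldM hpsi).
have := size_tau_mul q (drinfeld_neq0 a0) (drinfeld_neq0 b0).
have : (0 < size (psi b))%N by rewrite size_poly_gt0 drinfeld_neq0.
by move: (size _) (size _) (size _) => x y z; clear; lia.
Qed.

Lemma drinfeld_size_B a b n : (size (psi a) <= n)%N -> (size (psi b) <= n)%N ->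
  (size (psi (a - b)) <= n)%N.
Proof.
move=> ha hb; rewrite (drinfeldB hpsi); apply: leq_trans (size_polyD _ _) _.
by rewrite size_polyN geq_max ha hb.
Qed.

(** Expansions in base [a] with digits [f j]; [D0] bounds the digits, and each further digit adds
    [deg a]. *)
Lemma principal_system (a : A) N : a != 0 -> quotient_card a N -> exists D0, forall n,
  exists (T : finType) (g : T -> A), [/\ #|T| = (N ^ n)%N,
    residue_system (fun x => exists z, x = a ^+ n * z) g &
    forall c, (size (psi (g c)) <= D0 + n * deg a)%N].
Proof.
move=> a0 hN; have [f [f1 f2]] := quotient_card_system hN.
have mulI x y : a * x = a * y -> x = y.
  move=> /eqP; rewrite -subr_eq0 -mulrBr => /eqP /domA[h|/eqP].
    by rewrite h eqxx in a0.
  by rewrite subr_eq0 => /eqP.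
pose D0 := \max_j size (psi (f j)).
have hD j : (size (psi (f j)) <= D0)%N by apply: leq_bigmax.
exists D0; elim=> [|n [T [g [hT [g1 g2] hg]]]].
  exists unit, (fun=> 0); split; first by rewrite card_unit.
    by split=> [x|[] []] //; exists tt; exists x; rewrite subr0 mul1r.
  by move=> _; rewrite (drinfeld0 hpsi) size_poly0.
exists ('I_N * T)%type, (fun c => f c.1 + a * g c.2); split.
- by rewrite card_prod card_ord hT expnS.
- split=> [x|[j c] [j' c'] /= [z e]].
    have [j [y hy]] := f1 x; have [c [z hz]] := g1 y.
    exists (j, c); exists z => /=.
    have -> : x - (f j + a * g c) = (x - f j) - a * g c by ring.
    by rewrite hy -mulrBr hz exprS mulrA.
  have ej : j = j'.
    apply: f2; exists (a ^+ n * z + g c' - g c).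
    have -> : f j - f j' = (f j + a * g c - (f j' + a * g c')) + a * (g c' - g c) by ring.
    by rewrite e exprS; ring.
  congr (_, _) => //; apply: g2; exists z; apply: mulI.
  by rewrite mulrA -exprS -e ej; ring.
- move=> [j c] /=; rewrite -[_ * g c]opprK; apply: drinfeld_size_B.
    by apply: leq_trans (hD j) (leq_addr _ _).
  rewrite (drinfeldN hpsi) size_polyN.
  apply: leq_trans (drinfeld_size_mul _ a0) _; rewrite mulSn addnCA leq_add2l.
  exact: hg.
Qed.

(* Riemann-Roch in weak form: an ideal of small index contains an element of small degree. *)
Lemma small_element : exists C, forall (I : A -> Prop) m, (0 < m)%N ->
  (forall c : 'I_m.+1 -> A, exists j l, j <> l /\ I (c j - c l)) ->
  exists a, [/\ a != 0, I a & (q ^ deg a <= C * m ^ r)%N].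
Proof.
have [f hf] := drinfeld_pos hpsi.
have f0 : f != 0 by apply: contraTneq hf => ->; rewrite (drinfeld0 hpsi) size_poly0.
have [N hN e] := hrank f0.
have N1 : (1 < N)%N.
  rewrite ltnNge; apply/negP => hN1.
  have : (N ^ r <= 1)%N by rewrite -(exp1n r) leq_exp2r // rank_gt0.
  by rewrite -e leqNgt -(expn0 q) ltn_exp2l // -subn1 subn_gt0 hf.
have [D0 hD] := principal_system f0 hN.
exists (q ^ (D0 + deg f))%N => I m m0 hI.
(* This gives [N ^ n <= m < N ^ n.+1], so the representatives modulo [f ^+ n.+1] outnumber [m], and
   two of them differ by an element of [I]. *)
set n := trunc_log N m.
have /andP[h1 h2] := trunc_log_bounds N1 m0.
have [T [g [hT [g1 g2] hg]]] := hD n.+1.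
have hle : (m.+1 <= #|T|)%N by rewrite hT.
have [j [l [jl hIa]]] := hI (fun j => g (enum_val (widen_ord hle j))).
set c := enum_val _ in hIa; set c' := enum_val _ in hIa.
have cc : c <> c' by move=> /enum_val_inj /(congr1 val) /= h; apply: jl; apply: val_inj.
exists (g c - g c'); split=> //.
  rewrite subr_eq0; apply/eqP => h; apply: cc; apply: g2; exists 0.
  by rewrite h subrr mulr0.
apply: leq_trans (_ : (q ^ (D0 + n.+1 * deg f) <= _)%N).
  rewrite leq_exp2l //; apply: leq_trans (leq_pred _) _.
  by apply: drinfeld_size_B.
rewrite mulSn addnA expnD leq_mul2l; apply/orP; right.
by rewrite mulnC expnM e -expnM mulnC expnM leq_exp2r // rank_gt0.
Qed.

Variables (p : idealr A) (hp : maximal_ideal p).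
Variables (rho w : A) (hrho : local_generator p rho w) (hrho0 : (psi rho)`_0 != 0).
Variables (T1 : finType) (f1 : T1 -> A) (hT : residue_system (ideal_pow p 1) f1).
Hypothesis T1gt1 : (1 < #|T1|)%N.
Local Notation N := #|T1|.

Let rho0 : rho != 0.
Proof. by apply: contraNneq hrho0 => ->; rewrite (drinfeld0 hpsi) coef0. Qed.
Let rho_reg x : rho * x = 0 -> x = 0.
Proof. by move=> /domA[h|//]; move: rho0; rewrite h eqxx. Qed.

Lemma act_surj (a : A) : (psi a)`_0 != 0 -> forall x : M, exists y, a *: y = x.
Proof.
move=> h x; have [ell [e [hell hq e0]]] := finField_card kL.
exact: (tau_eval_surj hell hq e0 hL).
Qed.

Lemma act_kernel_le (a : A) : a != 0 -> exists2 s : seq M,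
  (forall x : M, a *: x = 0 -> x \in s) & (size s <= q ^ deg a)%N.
Proof.
move=> a0; have [ell [e [hell hq e0]]] := finField_card kL.
exact: (tau_kernel_le hell hq e0 (drinfeld_neq0 a0)).
Qed.

Lemma act_kernel_eq (a : A) : (psi a)`_0 != 0 -> exists2 s : seq M, uniq s &
  (forall x : M, x \in s <-> a *: x = 0) /\ size s = (q ^ deg a)%N.
Proof.
move=> h; have [ell [e [hell hq e0]]] := finField_card kL.
exact: (tau_kernel_eq hell hq e0 hL).
Qed.

Variables (d : nat) (be : 'I_d -> M).
Hypothesis be1 : forall j, tors p 1 (be j).
Hypothesis be_span : forall x, tors p 1 x -> exists a : 'I_d -> A, x = \sum_j a j *: be j.
Hypothesis be_indep : forall a : 'I_d -> A, \sum_j a j *: be j = 0 -> forall j, a j \in p.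

Let torsN n : exists (S : finType) (g : S -> M), [/\ #|S| = (N ^ (n * d))%N, injective g &
    forall x, tors p n x <-> exists c, x = g c].
Proof.
have hdiv := tors_div hp hrho hrho (act_surj hrho0).
have H j : exists b, tate p rho b /\ b 1%N = be j.
  by have [b hb e] := tate_lift hrho hdiv (be1 j); exists b.
have [b hb] := choice H.
have [Tn [fn [hTn hcard]]] := residue_system_pow hp hrho rho_reg n hT.
have [||S [g [h1 h2 h3]]] := tors_card hp hrho (fun j => (hb j).1) _ _ hTn.
- move=> x /be_span[a ->]; exists a; apply: eq_bigr => j _; by rewrite (hb j).2.
- move=> a e; apply: be_indep; rewrite -[RHS]e; apply: eq_bigr => j _; by rewrite (hb j).2.
by exists S, g; split=> //; rewrite h1 hcard expnM.
Qed.

(** A small element [a] of [p ^ n] annihilates all [N ^ (n * d)] torsion points, while its kernel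
    has at most [q ^ deg a] points. *)
Let upper C : (forall (I : A -> Prop) m, (0 < m)%N ->
  (forall c : 'I_m.+1 -> A, exists j l, j <> l /\ I (c j - c l)) ->
  exists a, [/\ a != 0, I a & (q ^ deg a <= C * m ^ r)%N]) ->
  forall n, (N ^ (n * d) <= C * N ^ (n * r))%N.
Proof.
move=> hC n; have [Tn [fn [[g1 g2] hcard]]] := residue_system_pow hp hrho rho_reg n hT.
have [||a [a0 Ia hle]] := hC (ideal_pow p n) (N ^ n)%N.
- by rewrite expn_gt0 ltnW.
- move=> c; have [h hh] := choice (fun j => g1 (c j)).
  have /injectivePn[j [l jl e]] : ~~ injectiveb h.
    by apply/negP => /injectiveP/leq_card; rewrite card_ord hcard ltnn.
  exists j, l; split; first exact/eqP.
  have -> : c j - c l = (c j - fn (h j)) - (c l - fn (h l)) by rewrite e; ring.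
  exact: ideal_powB.
have [S [g [h1 h2 h3]]] := torsN n.
have [s hs1 hs2] := act_kernel_le a0.
rewrite (expnM N n r); apply: leq_trans hle; apply: leq_trans hs2; rewrite -h1 cardE.
rewrite -(size_map g); apply: uniq_leq_size; first by rewrite map_inj_uniq // enum_uniq.
by move=> _ /mapP[c _ ->]; apply: hs1; apply: (h3 (g c)).2 => //; exists c.
Qed.

(** The complementary count. [I] is the ideal quotient of [rho ^+ n] by [p ^ n], of index at most
    [Nr ^ n / N ^ n]. With a small [a] in [I], each of the [(Nr ^ n) ^ r] points killed by
    [rho ^+ n] is a sum of a [p ^ n]-torsion point and a point of the kernel of [a]. *)
Let lower C : (forall (I : A -> Prop) m, (0 < m)%N ->
  (forall c : 'I_m.+1 -> A, exists j l, j <> l /\ I (c j - c l)) ->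
  exists a, [/\ a != 0, I a & (q ^ deg a <= C * m ^ r)%N]) ->
  forall n, (N ^ (n * r) <= C * N ^ (n * d))%N.
Proof.
move=> hC n; have [hr1 hw hloc] := hrho.
have [Tn [fn [[g1 g2] hcard]]] := residue_system_pow hp hrho rho_reg n hT.
have [Nr hNr eNr] := hrank rho0.
have [D0 hD] := principal_system rho0 hNr.
have [Tr [gr [hTr [gr1 gr2] _]]] := hD n.
pose I a := forall y, ideal_pow p n y -> exists z, a * y = rho ^+ n * z.
have Iw : I (w ^+ n).
  by move=> y /(local_generator_pow hrho)[z e]; exists z; rewrite e mulrC.
have [t ht] := ideal_pow_inverse hp n (maximal_notinX hp n hw).
(* [s] lies in [p ^ n] and its complement [w ^+ n * t] in [I]: a partition of unity for the two
   ideals. *)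
pose s := 1 - w ^+ n * t; have hs : ideal_pow p n s := ht.
have Irho z : ideal_pow p n (rho ^+ n * z) by apply/ideal_powMr/ideal_powX.
(* Chinese remainder: classes mod [I] and mod [p ^ n] determine one mod [rho ^ n] *)
have crt m (c : 'I_m -> A) : (forall j l, I (c j - c l) -> j = l) -> (m * N ^ n <= Nr ^ n)%N.
  move=> hc; pose h (x : 'I_m * Tn) := c x.1 * s + fn x.2 * (w ^+ n * t).
  have [e he] := choice (fun x => gr1 (h x)).
  have inj : injective e.
    move=> [j a] [l b] exy.
    have [z hz] : exists z, h (j, a) - h (l, b) = rho ^+ n * z.
      have [z1 hz1] := he (j, a); have [z2 hz2] := he (l, b).
      exists (z1 - z2); rewrite mulrBr -hz1 -hz2 exy; ring.
    have ea : a = b.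
      apply: g2; have -> : fn a - fn b = rho ^+ n * z + s * ((fn a - fn b) - (c j - c l)).
        by rewrite -hz /h /= /s; ring.
      by apply: ideal_powD => //; apply: ideal_powMr.
    congr (_, _) => //; apply: hc => y hy; have [z' ez'] := Iw _ hy.
    exists (z * y + t * (c j - c l) * z').
    rewrite mulrDr mulrA -hz [rho ^+ n * (_ * z')]mulrCA -ez' /h /= ea /s; ring.
  by have := leq_card _ inj; rewrite card_prod card_ord hcard hTr.
have N0 : (0 < N ^ n)%N by rewrite expn_gt0 ltnW.
pose m := (Nr ^ n %/ N ^ n)%N.
have m0 : (0 < m)%N.
  rewrite divn_gt0 //; have := @crt 1%N (fun=> 0); rewrite mul1n; apply=> j l _.
  by rewrite !ord1.
have mle : (m * N ^ n <= Nr ^ n)%N by apply: leq_trunc_div.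
have [|a [a0 Ia hle]] := hC I m m0.
  move=> c; apply: contrapT => hn.
  have := @crt m.+1 c _; rewrite leqNgt => /(_ _)/negP; apply.
    move=> j l h; apply: contrapT => jl; apply: hn; exists j, l; by [].
  by apply: ltn_ceil.
have [S [g [h1 h2 h3]]] := torsN n.
have [sa hsa1 hsa2] := act_kernel_le a0.
have hrn : (psi (rho ^+ n))`_0 != 0 by rewrite (drinfeld_coef0X hpsi) expf_neq0.
have [sr usr [hsr1 hsr2]] := act_kernel_eq hrn.
have degX : (q ^ deg (rho ^+ n) = (Nr ^ n) ^ r)%N.
  rewrite -expnM mulnC expnM -eNr -expnM; congr (_ ^ _)%N.
  elim: n {hcard Tn fn g1 g2 Tr gr hTr gr1 gr2 I Iw t ht s hs Irho crt N0 m m0 mle a a0 Ia hle S g h1 h2 h3 sa hsa1 hsa2 hrn sr usr hsr1 hsr2} => [|n IH].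
    by rewrite expr0 (drinfeld1 hpsi) size_poly1 muln0.
  have [ell [e [hell hq e0]]] := finField_card kL.
  have rn0 : rho ^+ n != 0.
    elim: n {IH} => [|n IH]; first by rewrite expr0 oner_neq0.
    by rewrite exprS; apply: contraNneq IH => /rho_reg ->.
  rewrite exprS (drinfeldM hpsi) (size_tau_mul q) ?drinfeld_neq0 // IH mulnS.
  by [].
have hsplit : {subset sr <= [seq g u.1 + u.2 | u <- [seq (x, y) | x <- enum S, y <- sa]]}.
  move=> x /hsr1 hx.
  have hx1 : tors p n ((w ^+ n * t) *: x).
    move=> y hy; have [z e] := Iw _ hy.
    have -> : y *: ((w ^+ n * t) *: x) = (t * z) *: (rho ^+ n *: x).
      by rewrite !scalerA; congr (_ *: _); transitivity (t * (w ^+ n * y)); [ring | rewrite e; ring].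
    by rewrite hx scaler0.
  have hx2 : a *: (s *: x) = 0.
    have [z e] := Ia _ hs; by rewrite scalerA e mulrC -scalerA hx scaler0.
  have [c ec] := (h3 _).1 hx1.
  apply/mapP; exists (c, s *: x).
    by apply/allpairsP; exists (c, s *: x); rewrite mem_enum hsa1.
  by rewrite /= -ec -scalerDl /s subrKC scale1r.
have hcount : ((Nr ^ n) ^ r <= N ^ (n * d) * (C * m ^ r))%N.
  rewrite -degX -hsr2; apply: leq_trans (uniq_leq_size usr hsplit) _.
  rewrite size_map size_allpairs -cardE h1 leq_mul2l; apply/orP; right.
  exact: leq_trans hsa2 hle.
have hr : (0 < (Nr ^ n) ^ r)%N.
  by rewrite expn_gt0; apply/orP; left; apply: leq_trans mle; rewrite muln_gt0 m0.
rewrite -(leq_pmul2r hr) expnM; apply: leq_trans (leq_mul (leqnn _) hcount) _.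
have -> : ((N ^ n) ^ r * (N ^ (n * d) * (C * m ^ r)) = C * N ^ (n * d) * (m * N ^ n) ^ r)%N.
  by rewrite expnMn; move: (_ ^ r)%N (_ ^ (n * d))%N (m ^ r)%N => x y z; ring.
by rewrite leq_mul2l leq_exp2r ?rank_gt0 // mle orbT.
Qed.

Lemma torsion_rank : d = r.
Proof.
have [C hC] := small_element.
by apply/eqP; rewrite eqn_leq (leq_exp_rate T1gt1 (upper hC)) (leq_exp_rate T1gt1 (lower hC)).
Qed.

End Rank.

(** * The unipotent group scheme *)

Section LastColumn.
Variables (B : comNzRingType) (d : nat).

Definition last_column_coord (R : comAlgType B) (x : 'rV[R]_d) (i : 'I_d.+1) : R :=
  if unlift ord_max i is Some j then x 0 j else 0.

Definition last_column_mx (R : comAlgType B) (x : 'rV[R]_d) : 'M[R]_d.+1 :=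
  \matrix_(i, j) ((i == j)%:R + (j == ord_max)%:R * last_column_coord x i).

(** The matrices that fix the first [d] basis vectors, which will span the Tate module of [D], and
    act trivially on the quotient of rank one. *)
Definition last_column_eqs (f : GL_poly B d.+1) : Prop :=
  exists i j : 'I_d.+1, (i == ord_max) || (j != ord_max) /\
    f = mpoly.mpolyX B (mpoly.mnm1 (lshift 1 (mxvec_index i j))) -
        mpoly.mpolyC _ (i == j)%:R.

Lemma last_column_mxD (R : comAlgType B) (x y : 'rV[R]_d) :
  last_column_mx (x + y) = last_column_mx x *m last_column_mx y.
Proof.
apply/matrixP => i j; rewrite !mxE.
under eq_bigr => l _ do rewrite !mxE mulrDr.
rewrite big_split /= (bigD1 j) //= big1 ?addr0 => [|l /negbTE ne]; last by rewrite ne mulr0.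
rewrite eqxx mulr1 -addrA; congr (_ + _).
have [_|_] := eqVneq j ord_max; last first.
  by rewrite !mul0r add0r big1 // => l _; rewrite mul0r mulr0.
under eq_bigr => l _ do rewrite mul1r.
rewrite !mul1r (bigD1 i) //= eqxx big1 ?addr0 => [|l /negbTE ne].
  rewrite [in RHS]mulrDl mul1r -mulrA.
  have -> : (i == ord_max)%:R * (last_column_coord x i * last_column_coord y i) = 0.
    have [im|_] := eqVneq i ord_max; last by rewrite mul0r.
    by rewrite /last_column_coord im unlift_none mulr0 mulr0.
  rewrite addr0 /last_column_coord; case: unliftP => [l _|_]; rewrite ?mxE ?addr0 //.
rewrite eq_sym ne add0r.
have [lm|_] := eqVneq l ord_max; last by rewrite !mul0r.
by rewrite /last_column_coord lm unlift_none mulr0.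
Qed.

Lemma last_column_mx0 (R : comAlgType B) : last_column_mx (0 : 'rV[R]_d) = 1%:M.
Proof.
apply/matrixP => i j; rewrite !mxE /last_column_coord.
by case: unliftP => [l _|_]; rewrite ?mxE mulr0 addr0.
Qed.

Lemma last_column_points (R : comAlgType B) (g : 'M[R]_d.+1) :
  GL_points last_column_eqs g <-> exists x, last_column_mx x = g.
Proof.
have ev i j (d' : R) : GL_eval g d' (mpoly.mpolyX B (mpoly.mnm1 (lshift 1 (mxvec_index i j))) -
        mpoly.mpolyC _ (i == j)%:R) = g i j - (i == j)%:R.
  rewrite /GL_eval mpoly.mmapB mpoly.mmapX mpoly.mmap1U mpoly.mmapC row_mxEl mxvecE.
  by rewrite /= scaler_nat.
split=> [[d' _ h]|[x e]].
  have hg i j : (i == ord_max) || (j != ord_max) -> g i j = (i == j)%:R.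
    move=> hij; apply/eqP; rewrite -subr_eq0 -(ev i j d'); apply/eqP/h.
    by exists i, j.
  exists (\row_j g (lift ord_max j) ord_max); apply/matrixP => i j; rewrite mxE.
  rewrite /last_column_coord; case: unliftP => [l ->|->]; last first.
    by rewrite mulr0 addr0 hg // eqxx.
  have [jm|jn] := eqVneq j ord_max; last by rewrite mul0r addr0 hg // jn orbT.
  by rewrite mxE mul1r jm eq_sym (negbTE (neq_lift _ _)) add0r.
(* The inverse matrix belongs to [- x], so its determinant is the inverse determinant. *)
exists (\det (last_column_mx (- x))).
  by rewrite -e -det_mulmx -last_column_mxD addNr last_column_mx0 det1.
move=> f [i [j [hij ->]]]; rewrite ev -e mxE.
have [ji|] := eqVneq j ord_max; last by rewrite mul0r addr0 subrr.
move: hij; rewrite ji eqxx orbF => /eqP ->.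
by rewrite /last_column_coord unlift_none mulr0 addr0 subrr.
Qed.

Lemma last_column_subgroup : subgroup_scheme last_column_eqs.
Proof.
move=> R; split.
- by apply/last_column_points; exists 0; apply: last_column_mx0.
- move=> g h /last_column_points[x <-] /last_column_points[y <-].
  by apply/last_column_points; exists (x + y); apply: last_column_mxD.
- move=> g h /last_column_points[x <-] e; apply/last_column_points; exists (- x).
  rewrite -[LHS]mulmx1 -e mulmxA -last_column_mxD addNr last_column_mx0 mul1mx //.
Qed.

Lemma last_column_Ga : isomorphic_to_Ga last_column_eqs d.
Proof.
exists last_column_mx; split.
- exact: last_column_mxD.
- move=> R x y /matrixP e; apply/rowP => j.
  have := e (lift ord_max j) ord_max; rewrite !mxE eqxx !mul1r => /addrI.
  by rewrite /last_column_coord liftK.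
- by move=> R g; apply: last_column_points.
- move=> R R' h x; apply/matrixP => i j; rewrite !mxE rmorphD rmorphM !rmorph_nat.
  congr (_ + _ * _); rewrite /last_column_coord; case: unliftP => [l _|_]; rewrite ?mxE //.
  exact: rmorph0.
Qed.

End LastColumn.

(** * The period lattice *)

Section AnalyticExpansion.
Variables (K Ks : fieldType) (v : K -> int) (i : {rmorphism K -> Ks}).
Hypothesis hK : local_field v.
Local Notation O := (sep_integer v i).
Variables (t : K) (t0 : t != 0) (vt : v t = 1).
Local Notation T := (i t).
Hypothesis halg : forall x : Ks,
  exists2 f : {poly K}, f != 0 & root (map_poly i f) x.

Let T0 : T != 0. Proof. by rewrite fmorph_eq0. Qed.

(** Stands for a lower bound [n], possibly negative, on the valuation of [x]. *)
Definition vge (n : int) (x : Ks) : Prop := O (x * T ^ (- n)).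

Lemma vge_0 n : vge n 0. Proof. by rewrite /vge mul0r; apply: (O0 i hK). Qed.
Lemma vgeD n x y : vge n x -> vge n y -> vge n (x + y).
Proof. by rewrite /vge mulrDl; apply: (OD hK). Qed.
Lemma vgeN n x : vge n x -> vge n (- x).
Proof. by rewrite /vge mulNr; apply: (ON hK). Qed.
Lemma vgeB n x y : vge n x -> vge n y -> vge n (x - y).
Proof. by move=> hx hy; apply/vgeD/vgeN. Qed.
Lemma vge_sum n I (r : seq I) (P : pred I) (F : I -> Ks) :
  (forall j, P j -> vge n (F j)) -> vge n (\sum_(j <- r | P j) F j).
Proof. by move=> h; elim/big_rec: _ => [|j x Pj]; [apply: vge_0 | apply/vgeD/h]. Qed.
Lemma vgeM m n x y : vge m x -> vge n y -> vge (m + n) (x * y).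
Proof.
by move=> hx hy; rewrite /vge opprD expfzDr // mulrACA; apply: (OM hK).
Qed.
Lemma vgeW m n x : n <= m -> vge m x -> vge n x.
Proof.
move=> h hx; rewrite /vge; have -> : x * T ^ (- n) = x * T ^ (- m) * T ^ (m - n).
  by rewrite -mulrA -expfzDr //; congr (_ * T ^ _); lia.
apply: (OM hK) => //; have : 0 <= m - n by lia.
case: (m - n) => // k _; exact: (O_TX i hK t0 vt).
Qed.
Lemma vgeX n k x : vge n x -> vge (n * k%:Z) (x ^+ k).
Proof.
move=> hx; elim: k => [|k IH]; first by rewrite mulr0 /vge oppr0 expr0z mulr1 expr0; apply: (O1 i hK).
by rewrite exprS intS mulrDr mulr1; apply: vgeM.
Qed.
Lemma vge0P x : vge 0 x <-> O x.
Proof. by rewrite /vge oppr0 expr0z mulr1. Qed.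
Lemma vge_T n : vge n (T ^ n).
Proof. by rewrite /vge -expfzDr // subrr expr0z; apply: (O1 i hK). Qed.
Lemma vge_exists x : exists2 n, n <= 0 & vge n x.
Proof.
have [s hs] := O_absorb hK t0 vt halg x; exists (- s%:Z); first by lia.
by rewrite /vge opprK mulrC.
Qed.
Lemma vge_exists_seq (f : nat -> Ks) N : exists2 n, n <= 0 & forall j, (j < N)%N -> vge n (f j).
Proof.
elim: N => [|N [n n0 hn]]; first by exists 0.
have [m m0 hm] := vge_exists (f N); exists (m + n); first by lia.
move=> j; rewrite ltnS leq_eqVlt => /orP[/eqP ->|/hn h].
  by apply: vgeW hm; lia.
by apply: vgeW h; lia.
Qed.
Lemma vge_separated x n0 : (forall n, n0 <= n -> vge n x) -> x = 0.
Proof.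
move=> h; apply: (T_separated hK t0 vt halg) => s.
have : vge s x by apply: (@vgeW (`|n0|%:Z + s)); [lia | apply: h; lia].
by rewrite /vge -exprnN.
Qed.

Lemma sep_ball_T n x : sep_ball v i (t ^ n) x <-> vge n x.
Proof. by rewrite /sep_ball /vge rmorphXz ?unitfE // -invr_expz. Qed.

Lemma sep_limit_vge u l n N : sep_limit v i u l ->
  (forall k, (N <= k)%N -> vge n (u k)) -> vge n l.
Proof.
move=> hl hu; have tn0 : t ^ n != 0 by rewrite expfz_neq0.
have [N' hN'] := hl _ tn0.
have /sep_ball_T h := hN' (maxn N N') (leq_maxr _ _).
rewrite -(subKr (u (maxn N N')) l); apply: vgeB => //.
exact/hu/leq_maxl.
Qed.

Lemma sep_limitB u l w m : sep_limit v i u l -> sep_limit v i w m ->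
  sep_limit v i (fun n => u n - w n) (l - m).
Proof.
move=> hu hw c c0; have [N hN] := hu c c0; have [N' hN'] := hw c c0.
exists (maxn N N') => n; rewrite geq_max => /andP[h1 h2].
rewrite /sep_ball; have -> : u n - w n - (l - m) = (u n - l) - (w n - m) by ring.
by rewrite mulrBl; apply: (OB hK); [apply: hN | apply: hN'].
Qed.

Lemma sep_limit_const a : sep_limit v i (fun=> a) a.
Proof. by move=> c _; exists 0%N => n _; rewrite /sep_ball subrr mul0r; apply: (O0 i hK). Qed.

Lemma sep_limit_unique u l m : sep_limit v i u l -> sep_limit v i u m -> l = m.
Proof.
move=> hl hm; apply/eqP; rewrite -subr_eq0; apply/eqP/(@vge_separated _ 0) => n _.
apply: (sep_limit_vge (N := 0) (sep_limitB hl hm)) => k _.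
by rewrite subrr; apply: vge_0.
Qed.

Lemma analytic_galois (co : nat -> Ks) (e : Ks -> Ks) (s : {rmorphism Ks -> Ks}) :
  separable_closure i ->
  (forall x, sep_limit v i (fun n => \sum_(j < n) co j * x ^+ j) (e x)) ->
  galois_aut i s -> (forall j, s (co j) = co j) -> forall x, e (s x) = s (e x).
Proof.
move=> hKs he hs hco x; apply: sep_limit_unique (he (s x)) _.
move=> c c0; have [N hN] := he x c c0; exists N => n hn.
have -> : \sum_(j < n) co j * s x ^+ j = s (\sum_(j < n) co j * x ^+ j).
  by rewrite rmorph_sum; apply: eq_bigr => j _; rewrite rmorphM rmorphXn hco.
rewrite /sep_ball -rmorphB -(hs.2 c) -fmorph_div; apply: galois_integer => //; exact: hN.
Qed.

Variables (q : nat) (q1 : (1 < q)%N).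

(** Every nonlinear term contains a power of [x] with exponent at least 2, hence has order at least
    [2 * m] up to the bound [b] of the coefficients. *)
Lemma vge_tau_eval (f : {poly Ks}) b m x : 0 <= m -> (forall j, vge b f`_j) -> vge m x ->
  vge (b + 2 * m) (tau_eval q f x - f`_0 * x) /\ vge (b + m) (tau_eval q f x).
Proof.
move=> m0 hf hx.
have h1 : vge (b + 2 * m) (tau_eval q f x - f`_0 * x).
  have [->|f0] := eqVneq f 0.
    by rewrite /tau_eval size_poly0 big_ord0 coef0 mul0r subrr; apply: vge_0.
  rewrite /tau_eval; have -> : size f = (size f).-1.+1 by rewrite prednK // size_poly_gt0.
  rewrite big_ord_recl /= expn0 expr1 addrAC subrr add0r; apply: vge_sum => j _.
  have := vgeM (hf (bump 0 j)) (vgeX (q ^ bump 0 j) hx).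
  apply: vgeW; rewrite lerD2l mulrC ler_wpM2l // lez_nat /bump add1n expnS.
  by rewrite -[2%N]muln1 leq_mul // expn_gt0 ltnW.
split=> //; rewrite -(subrK (f`_0 * x) (tau_eval _ _ _)); apply: vgeD.
  by apply: vgeW h1; lia.
exact: vgeM.
Qed.

(** Insert [x = T ^ m] in the functional equation of [e]. The nonlinear terms have order at least
    [2 * m] up to a constant, whereas the linear ones differ by [x] times a fixed element. Letting
    [m] grow makes this element infinitely divisible by [T], hence zero. *)
Lemma analytic_linear_coef (co : nat -> Ks) (e : Ks -> Ks) (D E : {poly Ks}) :
  co 1%N != 0 ->
  (forall x, sep_limit v i (fun n => \sum_(j < n) co j * x ^+ j) (e x)) ->
  e 0 = 0 -> (forall x, e (tau_eval q D x) = tau_eval q E (e x)) ->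
  D`_0 = E`_0.
Proof.
move=> co1 he e0 heq.
have co0 : co 0%N = 0.
  have h : sep_limit v i (fun n => \sum_(j < n) co j * 0 ^+ j) (co 0%N).
    move=> c c0; exists 1%N => -[//|n] _; rewrite big_ord_recl /= expr0 mulr1 big1.
      by rewrite addr0 subrr /sep_ball mul0r; apply: (O0 i hK).
    by move=> j _; rewrite expr0n mulr0.
  by rewrite -(sep_limit_unique h (he 0)) in e0.
(* The coefficients are bounded because the series converges at 1: from some index on, each is a
   difference of two partial sums close to [e 1]. *)
have [b b0 hb] : exists2 b, b <= 0 & forall j, vge b (co j).
  have [N hN] := he 1 1 (oner_neq0 _).
  have [b b0 hb] := vge_exists_seq co N; exists b => // j.
  have [/hb//|hj] := ltnP j N; apply: (vgeW b0); apply/vge0P.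
  have -> : co j = (\sum_(l < j.+1) co l * 1 ^+ l - e 1) - (\sum_(l < j) co l * 1 ^+ l - e 1).
    by rewrite big_ord_recr /= expr1n mulr1; ring.
  by apply: (OB hK); [have := hN j.+1 (leqW hj)|have := hN j hj]; rewrite /sep_ball rmorph1 divr1.
have est m x : 0 <= m -> vge m x -> vge (b + 2 * m) (e x - co 1%N * x).
  move=> m0 hx.
  apply: (sep_limit_vge (N := 2) (sep_limitB (he x) (sep_limit_const (co 1%N * x)))).
  move=> -[//|[//|k]] _; rewrite big_ord_recl big_ord_recl /= co0 mul0r add0r expr1.
  rewrite addrAC subrr add0r; apply: vge_sum => j _.
  have := vgeM (hb (bump 0 (bump 0 j))) (vgeX (bump 0 (bump 0 j)) hx).
  by apply: vgeW; rewrite lerD2l mulrC ler_wpM2l // lez_nat /bump !add1n.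
have [d d0 hd] : exists2 d, d <= 0 & forall j, vge d D`_j.
  have [d d0 hd] := vge_exists_seq (fun j => D`_j) (size D); exists d => // j.
  by have [/hd//|h] := ltnP j (size D); rewrite nth_default //; apply: vge_0.
have [c c0 hc] : exists2 c, c <= 0 & forall j, vge c E`_j.
  have [c c0 hc] := vge_exists_seq (fun j => E`_j) (size E); exists c => // j.
  by have [/hc//|h] := ltnP j (size E); rewrite nth_default //; apply: vge_0.
apply/eqP; rewrite -subr_eq0.
suff : co 1%N * (D`_0 - E`_0) = 0 by move/eqP; rewrite mulf_eq0 (negbTE co1).
(* The three bounds are nonpositive, so this constant lies below the one lost in each of the four
   estimates. *)
pose C := c + 2 * b + 2 * d.
apply: (@vge_separated _ (- b - d + C)) => n hn; pose m := n - C.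
have m0 : 0 <= m by rewrite /m; lia.
have bm : 0 <= b + m by rewrite /m; lia.
have dm : 0 <= d + m by rewrite /m; lia.
pose x := T ^ m; have hx : vge m x := vge_T m.
have [hD1 hD2] := vge_tau_eval m0 hd hx.
have h1 := est _ _ dm hD2.
have h2 := vgeM (hb 1%N) hD1.
have h3 := est _ _ m0 hx.
have hz : vge (b + m) (e x).
  rewrite -(subrK (co 1%N * x) (e x)); apply: vgeD; first by apply: vgeW h3; lia.
  exact: vgeM.
have [h4 _] := vge_tau_eval bm hc hz.
have h5 := vgeM (hc 0%N) h3.
have : vge (C + 2 * m) (co 1%N * (D`_0 - E`_0) * x).
  have -> : co 1%N * (D`_0 - E`_0) * x =
    (tau_eval q E (e x) - E`_0 * e x) + E`_0 * (e x - co 1%N * x)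
    - co 1%N * (tau_eval q D x - D`_0 * x) - (e (tau_eval q D x) - co 1%N * tau_eval q D x).
    by rewrite heq; ring.
  apply: vgeB; first apply: vgeB; first apply: vgeD.
  - by apply: vgeW h4; rewrite /C; lia.
  - by apply: vgeW h5; rewrite /C; lia.
  - by apply: vgeW h2; rewrite /C; lia.
  - by apply: vgeW h1; rewrite /C; lia.
rewrite /vge -mulrA /x -expfzDr //; congr (O (_ * T ^ _)); rewrite /m; lia.
Qed.

End AnalyticExpansion.

Section RankOneLattice.
Variables (A : comNzRingType).
Hypothesis domA : forall a b : A, a * b = 0 -> a = 0 \/ b = 0.
Variables (p : idealr A) (hp : maximal_ideal p).
Variables (rho w : A) (hrho : local_generator p rho w) (rho0 : rho != 0).

(** Krull's intersection theorem by counting: if [a] lay in [p ^ N], the [#|T| ^ N] classes modulo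
    [p ^ N] would stay distinct modulo [a], where there are only [N] classes. *)
Lemma ideal_pow_separated (T : finType) (f : T -> A) (a : A) N :
  residue_system (ideal_pow p 1) f -> (1 < #|T|)%N -> quotient_card a N ->
  exists n, ~ ideal_pow p n a.
Proof.
move=> hf hT [s hs]; exists N => ha.
have reg x : rho * x = 0 -> x = 0 by move=> /domA[h|//]; move: rho0; rewrite h eqxx.
have [Tn [fn [[_ g2] hcard]]] := residue_system_pow hp hrho reg N hf.
have H c : exists j, exists y, fn c = tnth s j + a * y by have [j [h _]] := hs (fn c); exists j.
have [j hj] := choice H.
have inj : injective j.
  move=> c c' e; apply: g2; have [y hy] := hj c; have [y' hy'] := hj c'.
  have -> : fn c - fn c' = a * (y - y') by rewrite hy hy' e; ring.
  exact: ideal_powMr.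
have := leq_card _ inj; rewrite card_ord hcard leqNgt => /negP; apply.
exact: ltn_expl.
Qed.

Hypothesis capA : forall a : A, a != 0 -> exists n, ~ ideal_pow p n a.
Variables (M : lmodType A) (Lam : M -> Prop).
Hypothesis LamB : forall x y, Lam x -> Lam y -> Lam (x - y).
Hypothesis LamZ : forall a x, Lam x -> Lam (a *: x).
Hypothesis Lam_proj : exists (n : nat) (g : 'I_n -> M) (sec : M -> 'rV[A]_n),
    [/\ forall j, Lam (g j),
        forall x y, Lam x -> Lam y -> sec (x + y) = sec x + sec y,
        forall a x, Lam x -> sec (a *: x) = a *: sec x &
        forall x, Lam x -> x = \sum_j (sec x 0 j *: g j)].

Lemma lattice_torsion_free a x : Lam x -> a != 0 -> a *: x = 0 -> x = 0.
Proof.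
move=> hx a0 e; have [n [g [sec [hg hD hZ hs]]]] := Lam_proj.
have s0 : a *: sec x = 0.
  rewrite -hZ // e; have L0 : Lam 0 by rewrite -(subrr x); apply: LamB.
  by rewrite -(scale0r (0 : M)) hZ // scale0r.
rewrite (hs x hx) big1 // => j _.
have /matrixP/(_ 0 j) := s0; rewrite !mxE => /domA[h|->]; last exact: scale0r.
by move: a0; rewrite h eqxx.
Qed.

Hypothesis rank_ge1 : exists2 x, Lam x & forall c : A, c *: x = 0 -> c = 0.
Hypothesis rank_le1 : forall x y, Lam x -> Lam y ->
  exists a b : A, (a != 0 \/ b != 0) /\ a *: x = b *: y.

(* [lam] generates [Lam] locally at [p]: the lattice need not be free. *)
Lemma lattice_local_generator : exists lam, [/\ Lam lam, lam != 0,
  forall mu c, Lam mu -> c \notin p -> c *: lam <> rho *: mu &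
  forall mu, Lam mu -> exists c c', c \notin p /\ c *: mu = c' *: lam].
Proof.
have [hr1 hw hloc] := hrho.
have [lam [hlam nlam]] : exists lam, Lam lam /\
    forall mu c, Lam mu -> c \notin p -> c *: lam <> rho *: mu.
  (* Otherwise every lattice element is divisible by every [rho ^+ m] up to factors outside [p]; its
     coordinates lie in all [p ^ m] and vanish, against rank one. *)
  apply: contrapT => h; have [x1 hx1 x1i] := rank_ge1.
  have [n [g [sec [hg hD hZ hs]]]] := Lam_proj.
  have H m x : Lam x -> exists c mu, [/\ c \notin p, Lam mu & c *: x = rho ^+ m *: mu].
    elim: m x => [|m IH] x hx.
      by exists 1, x; split; [exact: notin_ideal1 | exact: hx | rewrite expr0].
    have [mu [c [hmu hc e]]] : exists mu c, [/\ Lam mu, c \notin p & c *: x = rho *: mu].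
      apply: contrapT => h2; apply: h; exists x; split=> // mu c hmu hc e.
      by apply: h2; exists mu, c.
    have [c' [mu' [hc' hmu' e']]] := IH _ hmu.
    exists (c' * c), mu'; split=> //; first exact: maximal_notinM.
    by rewrite -scalerA e scalerA mulrC -scalerA e' scalerA exprS.
  have x10 : x1 = 0.
    rewrite (hs _ hx1) big1 // => j _.
    have s0 : sec x1 0 j = 0; last by rewrite s0 scale0r.
    apply/eqP/negPn/negP => /capA[m]; apply.
    have [c [mu [hc hmu e]]] := H m x1 hx1.
    apply: (ideal_pow_cancel hp hc).
    have /matrixP/(_ 0 j) : sec (c *: x1) = sec (rho ^+ m *: mu) by rewrite e.
    rewrite !hZ // !mxE => ->; apply/ideal_powMr/ideal_powX.
    by case: hrho.
  by have := x1i 1; rewrite x10 scaler0 => /(_ erefl)/eqP; rewrite oner_eq0.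
have lam0 : lam != 0.
  apply/eqP => e; apply: (nlam 0 1).
  - by rewrite -e.
  - exact: notin_ideal1.
  - by rewrite e !scaler0.
exists lam; split=> // mu hmu.
have [a [b [ab e]]] := rank_le1 hlam hmu.
have [n hn] : exists n, ~ (ideal_pow p n a /\ ideal_pow p n b).
  by case: ab => /capA[n hn]; exists n; case.
(* Descent on the order at [p] of the relation [a *: lam = b *: mu]: while [b] lies in [p], so does
   [a] by the choice of [lam], and a factor [rho] cancels. *)
elim: n a b e hn {ab} => [|n IH] a b e hn; first by case: hn.
have [bp|bp] := boolP (b \in p); last by exists b, a.
have [z2 e2] := hloc _ bp.
have [ap|ap] := boolP (a \in p); last first.
  exfalso; apply: (nlam (z2 *: mu) (w * a)); first exact: LamZ.
    exact: maximal_notinM.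
  by rewrite -scalerA e !scalerA mulrC -[in LHS](mulrC w) e2 mulrC.
have [z1 e1] := hloc _ ap.
apply: (IH z1 z2).
  apply/eqP; rewrite -subr_eq0; apply/eqP/(@lattice_torsion_free rho) => //.
    by apply: LamB; apply: LamZ.
  rewrite scalerBr !scalerA ![rho * _]mulrC -e1 -e2 -!scalerA e subrr //.
move=> [h1 h2]; apply: hn; split; apply: (ideal_pow_cancel hp hw).
  by rewrite e1 mulrC; apply: ideal_powS.
by rewrite e2 mulrC; apply: ideal_powS.
Qed.

End RankOneLattice.

(** * Values and iterates of integral twisted polynomials *)

Section LatticeValuation.
Variables (K Ks : fieldType) (v : K -> int) (i : {rmorphism K -> Ks}).
Hypothesis hK : local_field v.
Hypothesis hKs : separable_closure i.
Local Notation O := (sep_integer v i).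
Local Notation P := (sep_maximal v i).
Local Notation ounit := (ounit v i).
Variables (t : K) (t0 : t != 0) (vt : v t = 1).
Local Notation T := (i t).
Variables (ell : nat) (hell : ell \in [pchar Ks]).
Let halg := sepclosure_alg hKs.
Let OX := @OX _ _ _ i hK.
Let OM := @OM _ _ _ i hK.
Let total := O_total hK t0 vt halg hell.
Let maxB := maxB hK t0 vt halg hell.

Variables (q e : nat) (hq : q = (ell ^ e)%N) (e0 : (0 < e)%N).
Let q1 : (1 < q)%N.
Proof.
by rewrite hq (leq_ltn_trans e0) // ltn_expl // prime_gt1 // (pcharf_prime hell).
Qed.

(** For nonintegral [x] the inverse lies in [P], so the top term, with its unit coefficient,
    dominates all others. *)
Lemma tau_nonintegral (f : {poly Ks}) x : (forall j, O f`_j) -> ounit (lead_coef f) ->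
  ~ O x -> ounit (tau_eval q f x / x ^+ (q ^ (size f).-1)).
Proof.
move=> Of hu nOx.
have f0 : f != 0 by rewrite -lead_coef_eq0; case: hu.
have sf : size f = (size f).-1.+1 by rewrite prednK // size_poly_gt0.
have x0 : x != 0 by apply/eqP => x0; apply: nOx; rewrite x0; exact: (O0 i hK).
have Py : P x^-1.
  apply/(maxE i hK); split; first by have [/nOx|//] := total x0.
  by case=> _ _; rewrite invrK.
set n := (size f).-1 in sf *.
rewrite /tau_eval sf big_ord_recr /= mulrDl -mulrA divff ?expf_neq0 // mulr1 addrC.
apply: (ounitND hK t0 vt halg hell); first by move: hu; rewrite lead_coefE sf.
rewrite mulr_suml; apply: (max_sum hK t0 vt halg hell) => j _.
rewrite -mulrA; apply: (maxMl hK) => //.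
have hj : (q ^ j < q ^ n)%N by rewrite ltn_exp2l.
have -> : x ^+ (q ^ j) / x ^+ (q ^ n) = x^-1 ^+ (q ^ n - q ^ j).
  by rewrite exprVn -[in LHS](subnK (ltnW hj)) exprD invfM mulrCA divff ?mulr1 // expf_neq0.
rewrite -subn_gt0 in hj; case: (_ - _)%N hj => // l _.
by rewrite exprS; apply: (maxMr hK) => //; apply/OX/(max_O Py).
Qed.

Lemma tau_dominant (f : {poly Ks}) x : (forall j, O f`_j) -> ounit (lead_coef f) ->
  ~ O (tau_eval q f x) -> ounit (x ^+ (q ^ (size f).-1) / tau_eval q f x).
Proof.
move=> Of hu hlam.
have nOx : ~ O x.
  move=> Ox; apply: hlam; apply: (Osum hK) => j _; exact/OM/OX.
by have := ounitV (tau_nonintegral Of hu nOx); rewrite invf_div.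
Qed.

Lemma tau_kernel_integral (f : {poly Ks}) x : (forall j, O f`_j) -> ounit (lead_coef f) ->
  tau_eval q f x = 0 -> O x.
Proof.
move=> Of hu hx; apply: contrapT => /(tau_nonintegral Of hu).
by rewrite hx mul0r; case; rewrite eqxx.
Qed.

Lemma tau_kernel_max (f : {poly Ks}) x : (forall j, O f`_j) -> ounit f`_0 ->
  tau_eval q f x = 0 -> P x -> x = 0.
Proof.
move=> Of hu hx Px; apply/eqP/negPn/negP => x0.
have f0 : f != 0 by apply/eqP => f0; case: hu; rewrite f0 coef0 eqxx.
have : ounit (tau_eval q f x / x); last by rewrite hx mul0r; case; rewrite eqxx.
rewrite /tau_eval; have -> : size f = (size f).-1.+1 by rewrite prednK // size_poly_gt0.
rewrite big_ord_recl /= expn0 expr1 mulrDl -mulrA divff // mulr1.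
apply: (ounitND hK t0 vt halg hell) => //.
rewrite mulr_suml; apply: (max_sum hK t0 vt halg hell) => j _.
rewrite -mulrA; apply: (maxMl hK) => //.
have : (1 < q ^ bump 0 j)%N by rewrite -(expn0 q) ltn_exp2l.
case: (q ^ bump 0 j)%N => // -[|l] // _; rewrite exprSr -mulrA divff // mulr1 exprS.
by apply: (maxMr hK) => //; apply/OX/(max_O Px).
Qed.

(** The witness is the norm of [lam] to [K]: with an empty condition [fixing] is the whole Galois
    group. It has the value of a power of [lam], which would be integral if [v c] were
    nonnegative. *)
Lemma nonintegral_power lam : ~ O lam ->
  exists m c, [/\ (0 < m)%N, v c < 0 & ounit (lam ^+ m / i c)].
Proof.
move=> nO; have lam0 : lam != 0 by apply/eqP => h; apply: nO; rewrite h; exact: (O0 i hK).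
have [os uos hos] := orbit_seq hKs lam (J := fixing i (fun=> False)) (fun s h => h.1).
have [N0 Nf Nu] := orbit_norm hK hKs t0 vt hell lam0 uos hos.
have [||||c hc] := @fixed_field _ _ _ hKs (fun y => exists c, i c = y) (\prod_(y <- os) y).
- by move=> c; exists c.
- by move=> x y [a <-] [b <-]; exists (a - b); rewrite rmorphB.
- by move=> x y [a <-] [b <-]; exists (a * b); rewrite rmorphM.
- by move=> s hs _; apply: Nf; split.
rewrite -hc in N0 Nu; have {}Nu := ounitV Nu; rewrite invf_div in Nu.
exists (size os), c; split=> //.
  rewrite lt0n size_eq0; apply/eqP => os0.
  have : lam \in os by apply/hos; exists idfun => //; apply: fixing_id.
  by rewrite os0.
rewrite ltNge; apply/negP => hv; apply: nO.
have hO : O (lam ^+ size os).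
  have ic0 : i c != 0 by case: Nu => h _ _; apply: contraNneq h => ->; rewrite invr0 mulr0.
  have -> : lam ^+ size os = lam ^+ size os / i c * i c by rewrite divfK.
  by case: Nu => _ h _; apply: OM => //; apply: (O_iota i hK).
have [//|h] := total lam0.
have os0 : (0 < size os)%N.
  rewrite lt0n size_eq0; apply/eqP => os0.
  have : lam \in os by apply/hos; exists idfun => //; apply: fixing_id.
  by rewrite os0.
case: (size os) os0 hO => // n _ hO.
have -> : lam = lam ^+ n.+1 * lam^-1 ^+ n; last by apply/OM/OX.
by rewrite exprS exprVn -mulrA divff ?mulr1 // expf_neq0.
Qed.

(** Choose [g] in [P] dividing both the linear coefficient and [x 0]. Each application of [f] gains
    a factor [g], from the linear coefficient or, in the other terms, from a second factor [x n];
    and a power of [g] is divisible by [T]. *)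
Lemma tau_contracting (f : {poly Ks}) (x : nat -> Ks) : (forall j, O f`_j) -> P f`_0 ->
  P (x 0%N) -> (forall n, x n.+1 = tau_eval q f (x n)) ->
  forall s, exists n, O (x n / T ^+ s).
Proof.
move=> Of Pf Px hx s.
have T0 : T != 0 by rewrite fmorph_eq0.
have [x00|x00] := eqVneq (x 0%N) 0; first by exists 0%N; rewrite x00 mul0r; exact: (O0 i hK).
have [g [g0 Pg h1 h2]] : exists g, [/\ g != 0, P g, O (f`_0 / g) & O (x 0%N / g)].
  have [f00|f00] := eqVneq f`_0 0.
    exists (x 0%N); rewrite divff // f00 mul0r; split=> //; [exact: (O0 i hK)|exact: (O1 i hK)].
  have h : f`_0 / x 0%N != 0 by rewrite mulf_neq0 ?invr_eq0.
  have [hO|] := total h.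
    by exists (x 0%N); rewrite divff //; split=> //; exact: (O1 i hK).
  by rewrite invf_div => hO; exists f`_0; rewrite divff //; split=> //; exact: (O1 i hK).
have hn n : O (x n / g ^+ n.+1).
  elim: n => [|n IH]; first by rewrite expr1.
  have Og := max_O Pg.
  have [y Oy xE] : exists2 y, O y & x n = y * g ^+ n.+1.
    by exists (x n / g ^+ n.+1); rewrite // divfK // expf_neq0.
  have gn0 : g ^+ n != 0 by rewrite expf_neq0.
  have Oxn : O (x n) by rewrite xE; apply/OM/OX.
  rewrite hx /tau_eval mulr_suml; apply: (Osum hK) => j _.
  case: j => -[|j] hj /=.
    have -> : f`_0 * x n ^+ (q ^ 0) / g ^+ n.+2 = f`_0 / g * y.
      rewrite expn0 expr1 xE !exprS; move: (g ^+ n) gn0 => z z0.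
      by field; rewrite g0 z0.
    exact: OM.
  have : (1 < q ^ j.+1)%N by rewrite -(expn0 q) ltn_exp2l.
  case: (q ^ j.+1)%N => // -[|l] // _.
  have -> : f`_j.+1 * x n ^+ l.+2 / g ^+ n.+2 = f`_j.+1 * x n ^+ l * (y * (y * g ^+ n)).
    rewrite !exprS; have := xE; rewrite exprS.
    move: (g ^+ n) gn0 (x n ^+ l) (x n) => z z0 X x' ->; field.
    by rewrite g0 z0.
  apply: OM; first by apply: OM => //; apply: OX.
  by apply: OM => //; apply: OM => //; apply: OX.
have [M M0 hM] := max_nilp hK t0 vt halg hell Pg.
exists (M * s)%N.
have -> : x (M * s)%N / T ^+ s = x (M * s)%N / g ^+ (M * s).+1 * g * (g ^+ M / T) ^+ s.
  rewrite exprMn exprVn -exprM exprS invfM.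
  have : g ^+ (M * s) != 0 by rewrite expf_neq0.
  have : T ^+ s != 0 by rewrite expf_neq0.
  by move: (g ^+ _) (T ^+ _) => z X z0 X0; field; rewrite g0 z0 X0.
apply: OM; last exact: OX.
by apply: OM => //; apply: max_O Pg.
Qed.

(* The residues of the orbit all lie in one finite field. *)
Lemma tau_residue_pigeonhole (f : {poly Ks}) (x : nat -> Ks) : (forall j, O f`_j) ->
  O (x 0%N) -> (forall n, x n.+1 = tau_eval q f (x n)) ->
  exists m n, (m < n)%N /\ P (x m - x n).
Proof.
move=> Of Ox hx.
have Oxn n : O (x n).
  elim: n => // n IH; rewrite hx; apply: (Osum hK) => j _; exact/OM/OX.
(* Says that the residue of [y] lies in the field with [ell ^ m] elements. One [m] serves [x 0] and
   all coefficients of [f], hence the whole orbit. *)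
pose C m y := P (y ^+ (ell ^ m) - y).
have Cmul m l y : O y -> C m y -> C (l * m)%N y.
  move=> Oy Cy; elim: l => [|l IH]; first by rewrite /C expr1 subrr; exact: (max0 i hK).
  rewrite /C mulSn expnD exprM.
  have -> : (y ^+ (ell ^ m)) ^+ (ell ^ (l * m)) - y =
     (y ^+ (ell ^ m) - y) ^+ (ell ^ (l * m)) + (y ^+ (ell ^ (l * m)) - y).
    by rewrite pchar_exprB //; ring.
  apply: (maxD hK t0 vt halg hell) => //.
  have : (0 < ell ^ (l * m))%N by rewrite expn_gt0 prime_gt0 // (pcharf_prime hell).
  case: (ell ^ (l * m))%N => // u _; rewrite exprS; apply: (maxMr hK) => //.
  by apply: OX; apply: max_O Cy.
have [m m0 [Cx Cf]] : exists2 m, (0 < m)%N & C m (x 0%N) /\ forall j, C m f`_j.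
  have [m0 m00 h0] := max_residue hK t0 vt hell Ox.
  have [m m1 hm] : exists2 m, (0 < m)%N & forall j, (j < size f)%N -> C m f`_j.
    elim: (size f) => [|n [m mp IH]]; first by exists 1%N.
    have [m' m'0 h'] := max_residue hK t0 vt hell (Of n).
    exists (m * m')%N => [|j]; first by rewrite muln_gt0 mp m'0.
    rewrite ltnS leq_eqVlt => /orP[/eqP ->|hj]; first exact: Cmul.
    by rewrite mulnC; apply: Cmul => //; apply: IH.
  exists (m * m0)%N; first by rewrite muln_gt0 m1 m00.
  split; first exact: Cmul.
  move=> j; rewrite mulnC; apply: Cmul => //; have [/hm//|hj] := ltnP j (size f).
  rewrite nth_default // /C subr0 expr0n gtn_eqF ?expn_gt0 ?prime_gt0 ?(pcharf_prime hell) //.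
  exact: (max0 i hK).
have Cn n : C m (x n).
  elim: n => // n IH; rewrite /C hx /tau_eval.
  have -> : (\sum_(j < size f) f`_j * x n ^+ (q ^ j)) ^+ (ell ^ m) =
     \sum_(j < size f) f`_j ^+ (ell ^ m) * (x n ^+ (ell ^ m)) ^+ (q ^ j).
    elim/big_rec2: _ => [|j a b _ <-].
      by rewrite expr0n gtn_eqF ?expn_gt0 ?prime_gt0 ?(pcharf_prime hell).
    by rewrite pchar_exprD // exprMn exprAC.
  rewrite -sumrB; apply: (max_sum hK t0 vt halg hell) => j _.
  have -> : f`_j ^+ (ell ^ m) * (x n ^+ (ell ^ m)) ^+ (q ^ j) - f`_j * x n ^+ (q ^ j) =
     (f`_j ^+ (ell ^ m) - f`_j) * (x n ^+ (ell ^ m)) ^+ (q ^ j) +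
     f`_j * (x n ^+ (ell ^ m) - x n) ^+ (q ^ j).
    by rewrite hq -!expnM pchar_exprB //; ring.
  apply: (maxD hK t0 vt halg hell).
    by apply: (maxMr hK); [apply: Cf | do 2 apply: OX].
  apply: (maxMl hK) => //; have : (0 < q ^ j)%N by rewrite expn_gt0 ltnW.
  case: (q ^ j)%N => // u _; rewrite exprS; apply: (maxMr hK) => //.
  by apply: OX; apply: max_O IH.
have [rs hrs] := Fbar_rep_level hK hKs hell m0.
have H n : exists j : 'I_(size rs), P (x n - rs`_j).
  have [z [hz _ hP]] := hrs _ (Oxn n) (Cn n).
  have hj : (index z rs < size rs)%N by rewrite index_mem.
  by exists (Ordinal hj); rewrite /= nth_index.
have [j hj] := choice H.
have [a [b [ab eab]]] := pigeonhole_nat j.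
exists a, b; split=> //.
have -> : x a - x b = (x a - rs`_(j a)) - (x b - rs`_(j b)) by rewrite eab; ring.
exact: maxB.
Qed.

End LatticeValuation.

Section CoordinateRing.
Variables (A : comNzRingType) (F : fieldType) (AF : {rmorphism A -> F}) (vinf : F -> int).
Hypothesis hA : regular_outside AF vinf.

Lemma regular_outside_domain (a b : A) : a * b = 0 -> a = 0 \/ b = 0.
Proof.
move=> e; have := congr1 AF e; rewrite rmorphM rmorph0 => /eqP.
rewrite mulf_eq0 => /orP[] /eqP h; [left|right]; apply: hA.1; by rewrite h rmorph0.
Qed.

(** At a place where [b / a] had negative value, the value of [(b / a) ^+ n * x] would be negative
    for large [n], although this element belongs to [A]. *)
Lemma regular_outside_closed (a b x : A) : a != 0 -> x != 0 ->
  (forall n, exists y, b ^+ n * x = a ^+ n * y) -> exists y, b = a * y.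
Proof.
move=> a0 x0 h.
have AF0 y : y != 0 -> AF y != 0.
  by move=> y0; apply: contraNneq y0 => e; apply/eqP/hA.1; rewrite e rmorph0.
have [y ey] : exists y, AF y = AF b / AF a.
  apply/(hA.2 _) => w hw hwi; set g := AF b / AF a.
  have [->|g0] := eqVneq g 0; first by rewrite (Defs.val0 hw).
  rewrite leNgt; apply/negP => hneg.
  pose n := `|w (AF x)|%N.+1; have [y ey] := h n.
  have ey' : AF y = g ^+ n * AF x.
    have := congr1 AF ey; rewrite !rmorphM !rmorphXn /g exprMn exprVn => e.
    apply: (mulfI (expf_neq0 n (AF0 _ a0))); rewrite -e.
    by rewrite mulrA mulrCA divff ?mulr1 // expf_neq0 // AF0.
  have : 0 <= w (AF y) by apply: (hA.2 (AF y)).1 => //; exists y.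
  rewrite ey' (Defs.valM hw) ?expf_neq0 ?AF0 // (val_ofX hw) //.
  have : w g *+ n <= - n%:Z.
    have h1 : w g <= -1 by lia.
    by rewrite (_ : - n%:Z = (-1) *+ n) ?lerMn2r ?h1 ?orbT // mulNrn natz.
  by rewrite /n; lia.
by exists y; apply: hA.1; rewrite rmorphM ey mulrC divfK // AF0.
Qed.

End CoordinateRing.

Section UnramifiedGenerator.
Variables (k : finFieldType) (A : comNzRingType) (kA : {rmorphism k -> A}).
Variables (K : fieldType) (kK : {rmorphism k -> K}) (v : K -> int).
Hypothesis hv : normalized_valuation v.
Variables (phi : A -> {poly K}) (hphi : drinfeld_module kA kK phi).
Hypothesis hres : finite_residual_char v phi.
Variables (p : idealr A) (hp : maximal_ideal p).

Lemma residual_charB a b : residual_char v phi a -> residual_char v phi b ->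
  residual_char v phi (a - b).
Proof.
by rewrite /residual_char (drinfeld_coef0B hphi); apply: (val_geB hv).
Qed.

Lemma residual_charM a b : residual_char v phi b -> residual_char v phi (a * b).
Proof.
rewrite /residual_char (drinfeld_coef0M hphi) => hb.
by have := val_geM hv (hres a) hb; rewrite add0r.
Qed.

(** By maximality [p] is not contained in the residual characteristic, so some [a] in [p] lies
    outside it. If neither [pi] nor [a] satisfies both conditions, then [a] lies in [p ^ 2] and [pi]
    in the residual characteristic, and [a + pi] works. *)
Lemma unramified_generator (pi : A) :
  ~ (forall a, a \in p <-> residual_char v phi a) -> pi \in p -> ~ ideal_pow p 2 pi ->
  exists rho, [/\ rho \in p, ~ ideal_pow p 2 rho, (phi rho)`_0 != 0 & v (phi rho)`_0 = 0].
Proof.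
move=> hpp0 pip pi2.
have r0 : residual_char v phi 0 by rewrite /residual_char (drinfeld0 hphi) coef0; left.
have [a [ap na]] : exists a, a \in p /\ ~ residual_char v phi a.
  apply: contrapT => h; apply: hpp0.
  pose J : {pred A} := fun x => `[< residual_char v phi x >].
  have JP x : reflect (residual_char v phi x) (x \in J) by apply: asboolP.
  have Jc : idealr_closed J.
    split; first exact/JP.
      apply/JP; rewrite /residual_char (drinfeld1 hphi) coefC eqxx => -[/eqP|].
        by rewrite oner_eq0.
      by rewrite (val_of1 hv).
    move=> c x y /JP hx /JP hy; apply/JP; rewrite -[y]opprK.
    apply: residual_charB; first exact: residual_charM.
    by rewrite -sub0r; apply: residual_charB.
  pose m := isIdealr.Build A J Jc.
  pose I : idealr A := HB.pack J m.
  have pI : {subset p <= I}.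
    by move=> x xp; apply/JP; apply: contrapT => nx; apply: h; exists x.
  by move=> x; split=> [/pI/JP//|hx]; apply: (hp pI); apply/JP.
have [rho [h1 h2 h3]] : exists rho, [/\ rho \in p, ~ ideal_pow p 2 rho & ~ residual_char v phi rho].
  have [hpi|hpi] := pselect (residual_char v phi pi); last by exists pi.
  have [ha2|ha2] := pselect (ideal_pow p 2 a); last by exists a.
  exists (a + pi); split; first exact: rpredD.
    by move=> h; apply: pi2; rewrite -[pi](addrK a) addrC [pi + a]addrC; apply: ideal_powD => //; apply: ideal_powN.
  by move=> h; apply: na; rewrite -[a](addrK pi); apply: residual_charB.
exists rho; split=> //.
  by apply/eqP => h; apply: h3; rewrite /residual_char h; left.
apply/eqP; rewrite eq_le; have /val_ge0P -> // := hres rho; rewrite andbT leNgt.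
by apply/negP => h; apply: h3; right; lia.
Qed.

End UnramifiedGenerator.

(** * The image of inertia *)

Section FiniteCover.
Variables (T : eqType) (Q : T -> T -> Prop) (C : nat).
Hypothesis Qsym : forall x y, Q x y -> Q y x.

(** A pairwise unrelated sequence cannot reach length [C.+1], so choosing elements greedily
    stops. *)
Lemma finite_cover : (forall xs : 'I_C.+1 -> T, exists a b, a != b /\ Q (xs a) (xs b)) ->
  exists ys : seq T, forall x, exists2 y, y \in ys & Q x y.
Proof.
move=> h; apply: contrapT => hno.
have [xs sxs hxs] : exists2 xs : seq T, size xs = C.+1 & pairwise (fun x y => ~~ `[< Q x y >]) xs.
  elim: C.+1 => [|n [xs sxs hxs]]; first by exists [::].
  have [x hx] : exists x, forall y, y \in xs -> ~ Q x y.
    apply: contrapT => hx; apply: hno; exists xs => x; apply: contrapT => hx'.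
    by apply: hx; exists x => y hy hQ; apply: hx'; exists y.
  exists (x :: xs); rewrite /= ?sxs // hxs andbT; apply/allP => y hy.
  by apply/asboolPn/hx.
have [x0 _] : exists x0, x0 \in xs by case: xs sxs {hxs} => // x xs _; exists x; rewrite mem_head.
have nQ a b : (a < b)%N -> (b < C.+1)%N -> ~ Q (nth x0 xs a) (nth x0 xs b).
  move=> ab bC; apply/asboolPn; apply: (pairwiseP x0 hxs); rewrite ?inE ?sxs //.
  exact: ltn_trans ab bC.
have [a [b [ab hQ]]] := h (fun a => nth x0 xs a).
by case: (ltngtP a b) => hab; [apply: nQ hQ | apply: nQ (Qsym hQ) | by case/eqP: ab; apply: val_inj].
Qed.

End FiniteCover.

Section InertiaGroup.
Variables (K Ks : fieldType) (v : K -> int) (i : {rmorphism K -> Ks}).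
Hypotheses (hK : local_field v) (hKs : separable_closure i).
Variables (t : K) (t0 : t != 0) (vt : v t = 1).
Variables (ell : nat) (hell : ell \in [pchar Ks]).
Implicit Types (s u : {rmorphism Ks -> Ks}).

Lemma inertia_id : inertia_aut v i (idfun : {rmorphism Ks -> Ks}).
Proof.
split; first exact: (galois_id hKs).
move=> x _; rewrite /= subrr; exact: (max0 i hK).
Qed.

Lemma inertia_comp s u : inertia_aut v i s -> inertia_aut v i u ->
  inertia_aut v i (s \o u : {rmorphism Ks -> Ks}).
Proof.
move=> [gs hs] [gu hu]; split; first exact: galois_comp.
move=> x Ox; rewrite /= (_ : s (u x) - x = s (u x - x) + (s x - x)); last first.
  by rewrite rmorphB addrA subrK.
apply: (maxD hK t0 vt (sepclosure_alg hKs) hell); last exact: hs.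
by apply: galois_max => //; apply: hu.
Qed.

Lemma inertia_inv s : inertia_aut v i s ->
  exists u, [/\ inertia_aut v i u, cancel s u & cancel u s].
Proof.
move=> [gs hs]; have [u [gu su us]] := galois_inv hKs gs; exists u; split=> //; split=> // x Ox.
have -> : u x - x = - u (s x - x) by rewrite rmorphB su opprB.
apply: (maxN hK).
by apply: galois_max => //; apply: hs.
Qed.

End InertiaGroup.

Lemma integral_drinfeld (k : finFieldType) (A : comNzRingType) (kA : {rmorphism k -> A})
  (K : fieldType) (kK : {rmorphism k -> K}) (v : K -> int) (Ks : fieldType)
  (i : {rmorphism K -> Ks}) (L : {pred Ks}) (D : A -> {poly Ks}) :
  integral_drinfeld_module kA kK v i L D -> drinfeld_module kA (i \o kK) D.
Proof. by case. Qed.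

(** * Inertia acting on the torsion of a uniformized Drinfeld module *)

Section Uniformization.
Variables (k : finFieldType) (A : comNzRingType) (kA : {rmorphism k -> A}).
Variables (K : fieldType) (kK : {rmorphism k -> K}) (v : K -> int).
Hypothesis hK : local_field v.
Variables (Ks : fieldType) (i : {rmorphism K -> Ks}).
Hypothesis hKs : separable_closure i.
Local Notation O := (sep_integer v i).
Local Notation P := (sep_maximal v i).
Local Notation ounit := (ounit v i).
Variables (t : K) (t0 : t != 0) (vt : v t = 1).
Variables (ell e0 : nat) (hell : ell \in [pchar Ks]).
Hypotheses (hq : #|k| = (ell ^ e0)%N) (e0_gt0 : (0 < e0)%N).
Local Notation q := #|k|.
Let halg := sepclosure_alg hKs.
Implicit Types (s : {rmorphism Ks -> Ks}).

Hypothesis domA : forall a b : A, a * b = 0 -> a = 0 \/ b = 0.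
Variables (p : idealr A) (hp : maximal_ideal p).
Variables (rho w : A) (hrho : local_generator p rho w) (rho0 : rho != 0).
Hypothesis capA : forall a : A, a != 0 -> exists n, ~ ideal_pow p n a.

Variables (phi : A -> {poly K}) (hphi : drinfeld_module kA kK phi).
Local Notation E := (fun a => map_poly i (phi a)).
Let hE : drinfeld_module kA (i \o kK) E := drinfeld_map i hphi.
Local Notation ME := (dmod hE).
Hypothesis rho_unit : ounit (i (phi rho)`_0).

Variables (L : {pred Ks}) (D : A -> {poly Ks}) (Lam : Ks -> Prop).
Hypothesis hL : finite_subext i L.
Hypothesis hDint : integral_drinfeld_module kA kK v i L D.
Hypothesis hper : period_lattice k v i L D Lam.
Hypothesis hrk : lattice_rank k D Lam 1.
Let hD := integral_drinfeld hDint.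
Local Notation MD := (dmod hD).
Variables (co : nat -> Ks) (e : Ks -> Ks).
Hypothesis coL : forall j, co j \in L.
Hypothesis co1 : co 1%N != 0.
Hypothesis elim : forall x, sep_limit v i (fun n => \sum_(j < n) co j * x ^+ j) (e x).
Hypothesis eDr : {morph e : x y / x + y}.
Hypothesis eact : forall a x, e (tau_eval q (D a) x) = tau_eval q (E a) (e x).
Hypothesis esurj : forall y, exists x, e x = y.
Hypothesis eker : forall x, e x = 0 <-> Lam x.

Let rho_reg x : rho * x = 0 -> x = 0.
Proof. by move=> /domA[h|//]; move: rho0; rewrite h eqxx. Qed.

Let rhoX_neq0 n : rho ^+ n != 0.
Proof.
elim: n => [|n IH]; first by rewrite expr0 oner_neq0.
by rewrite exprS; apply: contraNneq IH => /rho_reg ->.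
Qed.

Let e_0 : e 0 = 0.
Proof. by apply: (@addrI _ (e 0)); rewrite -eDr !addr0. Qed.

(** [e] as a linear map between the two module structures on [Ks]. *)
Definition eM (x : MD) : ME := e x.

Lemma eMD x y : eM (x + y) = eM x + eM y. Proof. exact: eDr. Qed.
Lemma eMZ a x : eM (a *: x) = a *: eM x. Proof. exact: eact. Qed.
Lemma eM0 : eM 0 = 0. Proof. exact: e_0. Qed.
Lemma eMN x : eM (- x) = - eM x.
Proof. by apply/eqP; rewrite -addr_eq0 -eMD addNr eM0. Qed.
Lemma eMB x y : eM (x - y) = eM x - eM y.
Proof. by rewrite eMD eMN. Qed.
Lemma eM_sum I (r : seq I) (Q : pred I) (f : I -> MD) :
  eM (\sum_(j <- r | Q j) f j) = \sum_(j <- r | Q j) eM (f j).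
Proof. exact: (big_morph eM eMD eM0). Qed.
Lemma eM_ker x : eM x = 0 <-> Lam x. Proof. exact: eker. Qed.
Lemma eM_surj (y : ME) : exists x : MD, eM x = y. Proof. exact: esurj. Qed.
Lemma eM_tors n x : tors p n x -> tors p n (eM x).
Proof. by move=> hx a ha; rewrite -eMZ hx // eM0. Qed.

Let D_int a j : O (D a)`_j. Proof. by case: hDint => _ h _; case: (h a j). Qed.
Let D_L a j : (D a)`_j \in L. Proof. by case: hDint => _ h _; case: (h a j). Qed.
Let D_lead a : a != 0 -> ounit (lead_coef (D a)).
Proof.
case: hDint => _ _ h a0; have [l0 l1] := h a a0.
split=> //; rewrite lead_coefE; exact: D_int.
Qed.

Let D_coef0 a : (D a)`_0 = (E a)`_0.
Proof.
exact: (analytic_linear_coef hK t0 vt halg (finNzRing_gt1 k) co1 elim e_0 (eact a)).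
Qed.

Let D_rho : ounit (D rho)`_0.
Proof. by rewrite D_coef0 coef_map. Qed.

Let D_rhoX n : ounit (D (rho ^+ n))`_0.
Proof. by rewrite (drinfeld_coef0X hD); apply: (ounitX hK). Qed.

Let surjD : forall x : MD, exists y, rho *: y = x.
Proof. by apply: act_surj; [exact: hKs.2 | case: D_rho]. Qed.

Let surjE : forall x : ME, exists y, rho *: y = x.
Proof. by apply: act_surj; [exact: hKs.2 | rewrite -D_coef0; case: D_rho]. Qed.

Let sE_D s (x y : ME) : s (x + y) = s x + s y :> ME. Proof. exact: rmorphD. Qed.
Let sE_sum s I (r : seq I) (Q : pred I) (f : I -> ME) :
  s (\sum_(j <- r | Q j) f j) = (\sum_(j <- r | Q j) (s (f j) : ME)) :> ME.
Proof. exact: rmorph_sum. Qed.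

Let s_tau s (f : {poly Ks}) x : (forall j, s f`_j = f`_j) ->
  s (tau_eval q f x) = tau_eval q f (s x).
Proof.
move=> h; rewrite /tau_eval rmorph_sum; apply: eq_bigr => j _.
by rewrite rmorphM rmorphXn h.
Qed.

Let sE_Z s a (x : ME) : galois_aut i s -> s (a *: x) = a *: (s x : ME) :> ME.
Proof. by move=> hs; apply: s_tau => j; rewrite coef_map; apply: hs.2. Qed.

(** Such automorphisms commute with the action of [D] and with [e], whose coefficients lie in
    [L]. *)
Definition fixL s := galois_aut i s /\ forall x, x \in L -> s x = x.

Let sD_Z s a (x : MD) : fixL s -> s (a *: x) = a *: (s x : MD) :> MD.
Proof. by move=> hs; apply: s_tau => j; apply: hs.2; apply: D_L. Qed.

Let s_eM s (x : MD) : fixL s -> s (eM x) = eM (s x) :> ME.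
Proof.
move=> hs; apply/esym; apply: (analytic_galois hK t0 vt halg hKs elim hs.1) => j.
exact/hs.2/coL.
Qed.

(* [s x - x] is a torsion point in the maximal ideal, hence zero as [rho] acts with unit
   linear coefficient. *)
Lemma inertia_torsion s n (x : MD) : inertia_aut v i s -> fixL s ->
  rho ^+ n *: x = 0 -> s x = x.
Proof.
move=> hs hsL hx; have Ox : O x.
  exact: (tau_kernel_integral hK hKs t0 vt hell hq e0_gt0 (D_int _) (D_lead (rhoX_neq0 n)) hx).
apply/eqP; rewrite -subr_eq0; apply/eqP.
apply: (tau_kernel_max hK hKs t0 vt hell hq e0_gt0 (D_int _) (D_rhoX n)); last exact: hs.2.
have h : rho ^+ n *: ((s x : MD) - x) = 0.
  rewrite scalerBr -sD_Z // hx subr0; exact: rmorph0.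
exact: h.
Qed.

Let LamB (x y : MD) : Lam x -> Lam y -> Lam (x - y). Proof. exact: (latticeB hper). Qed.
Let LamZ a (x : MD) : Lam x -> Lam (a *: x). Proof. exact: (latticeZ hper). Qed.
Let Lam_proj : exists (n : nat) (g : 'I_n -> MD) (sec : MD -> 'rV[A]_n),
    [/\ forall j, Lam (g j),
        forall x y : MD, Lam x -> Lam y -> sec (x + y) = sec x + sec y,
        forall a (x : MD), Lam x -> sec (a *: x) = a *: sec x &
        forall x : MD, Lam x -> x = \sum_j (sec x 0 j *: g j)].
Proof. exact: (lattice_proj hper). Qed.

Let Lam_tf (a : A) (x : MD) : Lam x -> a != 0 -> a *: x = 0 -> x = 0.
Proof. exact: (lattice_torsion_free domA (M := MD) LamB Lam_proj). Qed.

Let rank_ge1 : exists2 x : MD, Lam x & forall c : A, c *: x = 0 -> c = 0.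
Proof.
have [[x hx hi] _] := hrk; exists (x ord0) => // c hc.
have := hi (fun=> c); rewrite big_ord1 => /(_ hc); exact: (fun h => h ord0).
Qed.

Let rank_le1 (x y : MD) : Lam x -> Lam y ->
  exists a b : A, (a != 0 \/ b != 0) /\ a *: x = b *: y.
Proof.
move=> hx hy; apply: contrapT => h; have [_] := hrk.
move/(_ (fun j : 'I_2 => if j == ord0 then x else y)); apply.
  by move=> j; case: eqP.
move=> c hc; have {}hc : c ord0 *: x + c (lift ord0 ord0) *: y = 0.
  by move: hc; rewrite big_ord_recl big_ord1 eqxx.
have hc' : c ord0 *: x = (- c (lift ord0 ord0)) *: y.
  by rewrite scaleNr; apply/eqP; rewrite -addr_eq0 hc.
have c0 : c ord0 = 0.
  by apply/eqP/negPn/negP => ne; apply: h; do 2 eexists; split; [left; exact: ne | exact: hc'].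
have c1 : c (lift ord0 ord0) = 0.
  apply/eqP/negPn/negP => ne; apply: h; exists (c ord0), (- c (lift ord0 ord0)).
  by split; [right; rewrite oppr_eq0|].
move=> j; case: (unliftP ord0 j) => [l ->|->] //.
by rewrite (ord1 l).
Qed.

Let act_iter a (x : MD) n : a ^+ n.+1 *: x = tau_eval q (D a) (a ^+ n *: x).
Proof. by rewrite exprS -scalerA. Qed.

(** [rho] has unit linear coefficient and does not contract, so contracting elements are built from
    it: residues repeat along the [rho]-orbit, which brings a multiple [y] of [x] into [P], and some
    [b] has linear coefficient in [P]. Then [b ^+ n *: y] tends to 0 and vanishes for some [n] by
    discreteness, while [Lam] is torsion free. *)
Lemma lattice_nonintegral (x : MD) : Lam x -> x != 0 -> ~ O x.
Proof.
move=> hx x0 Ox.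
have p1 : (1 < ell)%N by apply/prime_gt1/(pcharf_prime hell).
have rhoB_neq0 m n : (m < n)%N -> rho ^+ m - rho ^+ n != 0.
  move=> mn; apply/eqP => h; have [hr _ _] := hrho.
  have h2 : rho ^+ m * (1 - rho ^+ (n - m)) = 0.
    by rewrite mulrBr mulr1 -exprD subnKC // ltnW.
  case: (domA h2) => [h3|h3]; first by have := rhoX_neq0 m; rewrite h3 eqxx.
  have : 1 \in p.
    rewrite -[1](subrK (rho ^+ (n - m))) h3 add0r.
    by rewrite -subn_gt0 in mn; case: (n - m)%N mn => // l _; rewrite exprSr; apply: idealMr.
  by rewrite (negbTE (notin_ideal1 p)).
have Ox0 : O (rho ^+ 0 *: x) by rewrite expr0 scale1r.
have [m [n [mn hP]]] := tau_residue_pigeonhole hK hKs t0 vt hell hq e0_gt0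
  (x := fun n => rho ^+ n *: x) (D_int rho) Ox0 (act_iter rho x).
pose a := rho ^+ m - rho ^+ n; have a0 : a != 0 by apply: rhoB_neq0.
pose y : MD := a *: x.
have Py : P y by rewrite /y scalerBl.
have Ly : Lam y by apply: LamZ.
have [l l0 hl] := max_residue hK t0 vt hell (D_int rho 0%N).
(* By the choice of [l] the residue of the linear coefficient of [rho] equals its own [ell ^ l]-th
   power. *)
pose b := rho ^+ 1 - rho ^+ (ell ^ l).
have b0 : b != 0 by apply: rhoB_neq0; rewrite -(expn0 ell) ltn_exp2l.
have Pb : P (D b)`_0.
  rewrite (drinfeld_coef0B hD) !(drinfeld_coef0X hD) expr1 -opprB.
  exact: (maxN hK).
have [c c0 hc] := lattice_discrete hper.
have [s hs] := val_unit_decomp hK t0 vt c0.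
have Py0 : P (b ^+ 0 *: y) by rewrite expr0 scale1r.
have [n' hn'] := tau_contracting hK hKs t0 vt hell hq e0_gt0 (x := fun n => b ^+ n *: y)
  (D_int b) Pb Py0 (act_iter b y) s.
have bn0 : b ^+ n' != 0.
  elim: n' {hn'} => [|n' IH]; first by rewrite expr0 oner_neq0.
  by rewrite exprS; apply/eqP => /domA[h|h]; [move: b0 | move: IH]; rewrite h eqxx.
have z0 : b ^+ n' *: y = 0.
  apply: hc; first exact: LamZ.
  rewrite /sep_ball; have -> : (b ^+ n' *: y : Ks) / i c =
     ((b ^+ n' *: y : Ks) / i t ^+ s) * i (t ^+ s / c).
    rewrite fmorph_div rmorphXn mulrA divfK // expf_neq0 // fmorph_eq0 //.
  by apply: (OM hK) => //; apply: (O_iota i hK).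
by move/eqP: x0; apply; apply: (Lam_tf hx a0); apply: (Lam_tf Ly bn0).
Qed.

(** The lattice is finitely generated over [A], which acts with coefficients in the finite extension
    [L]; generators of both form [X]. *)
Lemma fixing_finite : exists X : seq Ks, forall s, galois_aut i s ->
  {in X, forall x, s x = x} -> fixL s /\ forall x, Lam x -> s x = x.
Proof.
have [_ _ [sL sLL hsL]] := hL; have [n [g [sec [hg _ _ hs]]]] := Lam_proj.
exists (sL ++ [seq (g j : Ks) | j <- enum 'I_n]) => s gs hX.
have fL : fixL s.
  split=> // x /hsL[c ->]; rewrite rmorph_sum; apply: eq_bigr => j _.
  by rewrite rmorphM gs.2 hX // mem_cat mem_nth.
split=> // x hx; rewrite (hs x hx).
have hg1 j : s (sec x 0 j *: g j) = sec x 0 j *: g j.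
  have e1 : (s (g j) : MD) = g j.
    by apply: hX; rewrite mem_cat; apply/orP; right; apply: map_f; rewrite mem_enum.
  by rewrite sD_Z // e1.
transitivity (\sum_j (s (sec x 0 j *: g j) : MD)); first exact: rmorph_sum.
by apply: eq_bigr.
Qed.

Lemma prim_generator_exists : exists lam : MD, [/\ Lam lam, lam != 0,
  forall (mu : MD) c, Lam mu -> c \notin p -> c *: lam <> rho *: mu &
  forall mu : MD, Lam mu -> exists c c', c \notin p /\ c *: mu = c' *: lam].
Proof.
exact: (lattice_local_generator domA hp hrho rho0 capA (M := MD) LamB LamZ Lam_proj rank_ge1 rank_le1).
Qed.

Section Generator.
Variables (lam : MD) (Llam : Lam lam) (lam0 : lam != 0).
Hypothesis lam_prim : forall (mu : MD) c, Lam mu -> c \notin p -> c *: lam <> rho *: mu.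
Hypothesis lam_gen : forall mu : MD, Lam mu ->
  exists c c', c \notin p /\ c *: mu = c' *: lam.
Variables (X : seq Ks).
Hypothesis hX : forall s, galois_aut i s ->
  {in X, forall x, s x = x} -> fixL s /\ forall x, Lam x -> s x = x.
Variables (x_ : nat -> MD) (hx_ : forall n, rho ^+ n *: x_ n = lam).
(** Other maximal ideals may contain [rho]. Multiplication by [sn n] carries the kernel of
    [rho ^+ n] into the [p ^ n]-torsion and is the identity on that torsion. *)
Variables (sn : nat -> A).
Hypothesis sn1 : forall n, ideal_pow p n (1 - sn n).
Hypothesis sn2 : forall n a, ideal_pow p n a -> exists z, a * sn n = rho ^+ n * z.

Variables (y_ : nat -> MD) (hy_ : forall n, y_ n = sn n *: x_ n).

Let sn_tors n (z : MD) : rho ^+ n *: z = 0 -> tors p n (sn n *: z).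
Proof. by move=> hz a /sn2[b e1]; rewrite scalerA e1 mulrC -scalerA hz scaler0. Qed.

Let sn_id (M : lmodType A) n (x : M) : tors p n x -> sn n *: x = x.
Proof.
by move=> hx; rewrite -[RHS]scale1r; apply/esym; apply: tors_mod (sn1 n) hx.
Qed.

Lemma lattice_root_tors n : tors p n (eM (y_ n)).
Proof.
move=> a /sn2[z e1]; rewrite -eMZ; apply/eM_ker.
by rewrite hy_ scalerA e1 mulrC -scalerA hx_; apply: LamZ.
Qed.

(* [E[p ^ n]] is an extension of [Lam / p ^ n Lam], generated by [lam], by [D[p ^ n]]. *)
Lemma torsion_extension n (x : ME) : tors p n x ->
  exists a (del : MD), tors p n del /\ x = a *: eM (y_ n) + eM del.
Proof.
move=> hx; have [y ey] := eM_surj x.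
have hmu : Lam (rho ^+ n *: y).
  apply/eM_ker; rewrite eMZ ey; apply: hx; apply: ideal_powX.
  by case: hrho.
have [c [c' [hc ec]]] := lam_gen hmu.
(* [c *: y] and [c' *: x_ n] have the same image under [rho ^+ n], so [z] is a torsion point of
   [D]. *)
pose z : MD := c *: y - c' *: x_ n.
have hz : rho ^+ n *: z = 0.
  rewrite scalerBr !scalerA ![rho ^+ n * _]mulrC -!scalerA hx_ ec.
  exact: subrr.
have [f hf] := tors_inverse ME hp n hc.
have [f' hf'] := tors_inverse MD hp n hc.
exists (f * c'), (f *: (sn n *: z)); split; first by apply/torsZ/sn_tors.
rewrite eMZ -scalerA -scalerDr -[LHS](hf x) //; congr (_ *: _).
have -> : sn n *: z = c *: (sn n *: y) - c' *: y_ n.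
  by rewrite /z hy_ scalerBr !scalerA ![sn n * _]mulrC.
by rewrite eMB !eMZ subrKC ey sn_id.
Qed.

(** The Kummer cocycle of [lam]: [s] fixes [lam], so it moves [x_ n] by an element of the kernel of
    [rho ^+ n]. *)
Lemma inertia_shift s n : inertia_aut v i s -> {in X, forall x, s x = x} ->
  rho ^+ n *: ((s (x_ n) : MD) - x_ n) = 0 /\
  s (eM (y_ n)) = eM (y_ n) + eM (sn n *: ((s (x_ n) : MD) - x_ n)) :> ME.
Proof.
move=> hs sX; have [fL fLam] := hX hs.1 sX; split.
  rewrite scalerBr -sD_Z // hx_; apply/eqP; rewrite subr_eq0; apply/eqP.
  exact: fLam.
by rewrite s_eM // -eMD hy_ sD_Z // scalerBr subrKC.
Qed.

Lemma inertia_tors_extension s n (x : ME) : inertia_aut v i s -> {in X, forall x, s x = x} ->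
  tors p n x -> exists del : MD, tors p n del /\ s x = x + eM del :> ME.
Proof.
move=> hs sX /torsion_extension[a [del [hdel ->]]].
have [h1 h2] := inertia_shift n hs sX; have [fL fLam] := hX hs.1 sX.
exists (a *: (sn n *: ((s (x_ n) : MD) - x_ n))); split; first by apply/torsZ/sn_tors.
rewrite sE_D sE_Z ?h2; last exact: hs.1.
rewrite s_eM // (@inertia_torsion s n del) //; last first.
  by apply: hdel; apply: ideal_powX; case: hrho.
by rewrite eMZ scalerDr addrAC.
Qed.

Variables (d : nat) (be : 'I_d -> MD).
Hypothesis be1 : forall j, tors p 1 (be j).
Hypothesis be_span : forall x : MD, tors p 1 x -> exists a : 'I_d -> A, x = \sum_j a j *: be j.
Hypothesis be_indep : forall a : 'I_d -> A, \sum_j a j *: be j = 0 -> forall j, a j \in p.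

Definition beE (j : 'I_d.+1) : ME :=
  if unlift ord_max j is Some l then eM (be l) else eM (y_ 1).

Lemma beE_sum (a : 'I_d.+1 -> A) : \sum_j a j *: beE j =
  eM (\sum_(l < d) a (lift ord_max l) *: be l + a ord_max *: y_ 1).
Proof.
rewrite (bigD1_ord ord_max) //= eMD eM_sum addrC eMZ; congr (_ + _).
  by apply: eq_bigr => l _; rewrite /beE liftK eMZ.
by rewrite /beE unlift_none.
Qed.

Lemma beE_tors j : tors p 1 (beE j).
Proof. by rewrite /beE; case: unlift => [l|]; [apply/eM_tors | apply: lattice_root_tors]. Qed.

Lemma beE_span x : tors p 1 x -> exists a, x = \sum_j a j *: beE j.
Proof.
move=> /torsion_extension[a [del [hdel ->]]]; have [c ->] := be_span hdel.
exists (fun j => if unlift ord_max j is Some l then c l else a).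
rewrite beE_sum unlift_none eMD eMZ addrC; congr (eM _ + _).
by apply: eq_bigr => l _; rewrite liftK.
Qed.

Lemma beE_indep a : \sum_j a j *: beE j = 0 -> forall j, a j \in p.
Proof.
have [hr _ _] := hrho.
have k1 (x : MD) : tors p 1 x -> rho *: x = 0 by apply; apply/mem_ideal_pow1.
set del := fun a : 'I_d.+1 -> A => \sum_(l < d) a (lift ord_max l) *: be l.
have hdel b : tors p 1 (del b) by apply: tors_sum => l _; apply: torsZ.
move=> e1; have := e1; rewrite beE_sum => /eM_ker hmu.
(* Otherwise applying [rho] to the relation would write a multiple of [lam], with factor outside
   [p], as [rho] times a lattice element. *)
have am : a ord_max \in p.
  apply/negPn/negP => am.
  apply: (@lam_prim _ (a ord_max * sn 1) hmu).
    apply: maximal_notinM => //; apply/negP => h; case/negP: (notin_ideal1 p).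
    by rewrite -(subrK (sn 1) 1); apply: rpredD => //; apply/mem_ideal_pow1/sn1.
  rewrite scalerDr k1; last exact: (hdel a).
  rewrite add0r hy_ !scalerA [rho * _]mulrC -!mulrA -[in LHS](hx_ 1) expr1.
  by rewrite !scalerA; congr (_ *: _); ring.
have d0 : del a = 0.
  have hdL : Lam (del a).
    apply/eM_ker; have := e1; rewrite beE_sum eMD eMZ.
    by rewrite (lattice_root_tors (n := 1)) ?addr0 //; apply/mem_ideal_pow1.
  exact: (Lam_tf hdL rho0 (k1 _ (hdel a))).
move=> j; case: (unliftP ord_max j) => [l|] -> //.
exact: (be_indep (a := fun l => a (lift ord_max l)) d0).
Qed.

Variables (pi u : A) (hpi : local_generator p pi u).
Variables (bD : 'I_d -> nat -> MD) (bD_tate : forall j, tate p pi (bD j)).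
Hypothesis bD1 : forall j, bD j 1%N = be j.
Variables (bL : nat -> ME) (bL_tate : tate p pi bL) (bL1 : bL 1%N = eM (y_ 1)).

Definition tbasis (j : 'I_d.+1) (n : nat) : ME :=
  if unlift ord_max j is Some l then eM (bD l n) else bL n.
Local Notation b := tbasis.
Local Notation R := (completion p).

Lemma eM_tate c : tate p pi c -> tate p pi (fun n => eM (c n)).
Proof.
by move=> hc n; split; [apply: eM_tors; case: (hc n) | rewrite -eMZ (hc n).2].
Qed.

Lemma tbasis_tate j : tate p pi (b j).
Proof.
have -> : b j = (fun n => if unlift ord_max j is Some l then eM (bD l n) else bL n) by [].
by case: unlift => [l|] //; apply: eM_tate.
Qed.

Lemma tbasis1 j : b j 1%N = beE j.
Proof. by rewrite /tbasis /beE; case: unlift => [l|]; rewrite ?bD1. Qed.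

Let span1 (x : ME) : tors p 1 x -> exists a : 'I_d.+1 -> A, x = \sum_j a j *: b j 1%N.
Proof.
by move=> /beE_span[a ->]; exists a; apply: eq_bigr => j _; rewrite tbasis1.
Qed.
Let indep1 (a : 'I_d.+1 -> A) : \sum_j a j *: b j 1%N = 0 -> forall j, a j \in p.
Proof.
move=> h; apply: beE_indep; rewrite -[RHS]h; apply: eq_bigr => j _; by rewrite tbasis1.
Qed.
Let spanD1 (x : MD) : tors p 1 x -> exists a : 'I_d -> A, x = \sum_j a j *: bD j 1%N.
Proof.
by move=> /be_span[a ->]; exists a; apply: eq_bigr => j _; rewrite bD1.
Qed.

Lemma tbasis_coordinates x : tate p pi x -> exists! al : 'cV[R]_d.+1,
  forall n, x n = \sum_j residue (al j 0) n *: b j n.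
Proof. exact: (tate_coordinates hp hpi tbasis_tate span1 indep1). Qed.

Definition lincomb (g : 'M[R]_d.+1) (j : 'I_d.+1) (n : nat) : ME :=
  \sum_l residue (g l j) n *: b l n.

Definition image_mx s (g : 'M[R]_d.+1) := forall j n, s (b j n) = lincomb g j n :> ME.

Lemma image_mx_exists s : galois_aut i s -> exists g, image_mx s g.
Proof.
move=> hs.
have H j : exists al : 'cV[R]_d.+1, forall n, s (b j n) = \sum_l residue (al l 0) n *: b l n :> ME.
  have [|al [h _]] := tbasis_coordinates (x := fun n => s (b j n)); last by exists al.
  move=> n; have [h1 h2] := tbasis_tate j n; split.
    by move=> a /h1 h; rewrite -sE_Z // h; exact: rmorph0.
  by rewrite -sE_Z // h2.
have [g hg] := choice H; exists (\matrix_(l, j) g j l 0) => j n.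
by rewrite hg; apply: eq_bigr => l _; rewrite mxE.
Qed.

Lemma image_mx_inj s g h : image_mx s g -> image_mx s h -> g = h.
Proof.
move=> hg hh; apply/matrixP => l j; apply: residue_inj => n.
move: l; apply: (tate_coord hp hpi tbasis_tate indep1).
exact: etrans (esym (hg j n)) (hh j n).
Qed.

Lemma image_mx_comp s s' g h : galois_aut i s -> image_mx s g -> image_mx s' h ->
  image_mx (s \o s' : {rmorphism Ks -> Ks}) (g *m h).
Proof.
move=> gs hg hh j n; rewrite /= (hh j n) /lincomb sE_sum.
transitivity (\sum_l (\sum_m residue (g l m) n * residue (h m j) n) *: b l n).
  transitivity (\sum_m \sum_l (residue (g l m) n * residue (h m j) n) *: b l n).
    apply: eq_bigr => m _; rewrite sE_Z // hg /lincomb scaler_sumr.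
    by apply: eq_bigr => l _; rewrite scalerA mulrC.
  by rewrite exchange_big; apply: eq_bigr => l _; rewrite scaler_suml.
apply: (tate_comb_mod tbasis_tate) => l; rewrite mxE -opprB; apply: ideal_powN.
elim/big_rec2: _ => [|m x y _ IH]; first exact: residue0.
have -> : residue (g l m * h m j + y) n - (residue (g l m) n * residue (h m j) n + x) =
  (residue (g l m * h m j + y) n - (residue (g l m * h m j) n + residue y n)) +
  (residue (g l m * h m j) n - residue (g l m) n * residue (h m j) n) + (residue y n - x).
  ring.
by apply: ideal_powD => //; apply: ideal_powD; [apply: residueD | apply: residueM].
Qed.

(** Level [n] of the element of the Tate module of [D] with coordinates [x]; its image under [e] is
    the displacement of [bL n] by a matrix with last column [x]. *)
Definition wx (x : 'rV[R]_d) (n : nat) : MD := \sum_l residue (x 0 l) n *: bD l n.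

Lemma wx_tors x n : tors p n (wx x n).
Proof. by apply: tors_sum => l _; apply: torsZ; case: (bD_tate l n). Qed.

Lemma wx_tate x : tate p pi (wx x).
Proof.
move=> n; split; first exact: wx_tors.
rewrite /wx scaler_sumr -(tate_comb_mod bD_tate (fun l => residue_coherent (x 0 l) n)).
by apply: eq_bigr => l _; rewrite scalerA mulrC -scalerA (bD_tate l n).2.
Qed.

Lemma wxB x x' n : wx (x - x') n = wx x n - wx x' n.
Proof.
rewrite /wx -sumrB.
transitivity (\sum_l (residue (x 0 l) n - residue (x' 0 l) n) *: bD l n); last first.
  by apply: eq_bigr => l _; rewrite scalerBl.
apply: (tate_comb_mod bD_tate) => l; rewrite !mxE.
have -> : residue (x 0 l - x' 0 l) n - (residue (x 0 l) n - residue (x' 0 l) n) =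
  (residue (x 0 l - x' 0 l) n - (residue (x 0 l) n + residue (- x' 0 l) n)) +
  (residue (- x' 0 l) n - - residue (x' 0 l) n) by ring.
by apply: ideal_powD; [apply: residueD | apply: residueN].
Qed.

Lemma tbasis_sum (a : 'I_d.+1 -> A) n : \sum_j a j *: b j n =
  a ord_max *: bL n + eM (\sum_l a (lift ord_max l) *: bD l n).
Proof.
rewrite (bigD1_ord ord_max) //= eM_sum; congr (_ + _).
  by rewrite /tbasis unlift_none.
by apply: eq_bigr => l _; rewrite /tbasis liftK eMZ.
Qed.

Lemma last_column_image s x :
  (forall l n, s (eM (bD l n)) = eM (bD l n)) ->
  (forall n, s (bL n) = bL n + eM (wx x n) :> ME) ->
  image_mx s (last_column_mx (R := R^o) x).
Proof.
move=> h1 h2 j n; rewrite /lincomb; case: (unliftP ord_max j) => [l|] ->.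
  transitivity (\sum_m (m == lift ord_max l)%:R *: b m n).
    rewrite (bigD1 (lift ord_max l)) //= eqxx scale1r big1 ?addr0; last first.
      by move=> m /negbTE ->; rewrite scale0r.
    by rewrite /tbasis liftK.
  apply: (tate_comb_mod tbasis_tate) => m; rewrite mxE -opprB; apply: ideal_powN.
  rewrite [lift _ _ == _]eq_sym (negbTE (neq_lift _ _)) mul0r addr0.
  by case: eqP => _; [apply: residue1 | apply: residue0].
transitivity (\sum_m (if unlift ord_max m is Some l then residue (x 0 l) n else 1) *: b m n).
  rewrite tbasis_sum unlift_none scale1r /tbasis unlift_none h2; congr (_ + eM _).
  by apply: eq_bigr => l _; rewrite liftK.
apply: (tate_comb_mod tbasis_tate) => m; rewrite mxE -opprB; apply: ideal_powN.
rewrite eqxx mul1r /last_column_coord; case: unliftP => [l|] ->.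
  rewrite eq_sym (negbTE (neq_lift _ _)) add0r subrr; exact: ideal_pow0.
by rewrite eqxx addr0; apply: residue1.
Qed.

(** Inertia fixing [X] is trivial on the torsion of [D] and displaces [bL n] by such torsion, whose
    coordinates form the last column. *)
Lemma image_last_column s g : inertia_aut v i s -> {in X, forall x, s x = x} ->
  image_mx s g -> exists x : 'rV[R]_d, last_column_mx (R := R^o) x = g.
Proof.
move=> hs sX hg; have [fL _] := hX hs.1 sX.
have fD l n : s (eM (bD l n)) = eM (bD l n).
  rewrite s_eM // (@inertia_torsion s n) //; have [h _] := bD_tate l n; apply: h.
  by apply: ideal_powX; case: hrho.
have gL n : exists c : 'I_d -> A, s (bL n) = bL n + eM (\sum_l c l *: bD l n) :> ME.
  have [del [hdel e1]] := inertia_tors_extension hs sX (bL_tate n).1.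
  by have [c ec] := tate_span hp hpi bD_tate spanD1 hdel; exists c; rewrite e1 ec.
pose x : 'rV[R]_d := \row_l g (lift ord_max l) ord_max.
exists x; apply: (image_mx_inj (s := s)) => //; apply: last_column_image => // n.
have [c ec] := gL n; rewrite ec; congr (_ + eM _).
apply: (tate_comb_mod bD_tate) => l; rewrite mxE.
have := hg ord_max n; rewrite /lincomb {1}/tbasis unlift_none ec.
have -> : bL n + eM (\sum_l c l *: bD l n) =
   \sum_j (if unlift ord_max j is Some l then c l else 1) *: b j n.
  rewrite tbasis_sum unlift_none scale1r; congr (_ + eM _).
  by apply: eq_bigr => m _; rewrite liftK.
by move=> /(tate_coord hp hpi tbasis_tate indep1)/(_ (lift ord_max l)); rewrite liftK.
Qed.

(** Fixing [Fbar] forces membership in inertia, and fixing [X] forces triviality on [L] and [Lam].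
    Both are pointwise conditions, the form that orbits and gluing require. *)
Let W1 : Ks -> Prop := fun z => Fbar ell z \/ z \in X.

Let W1_X s : fixing i W1 s -> {in X, forall x, s x = x}.
Proof. by move=> [_ h] x hx; apply: h; right. Qed.

Let W1_inertia s : fixing i W1 s -> inertia_aut v i s.
Proof.
move=> [gs h]; apply: (Fbar_fix_inertia hK hKs t0 vt hell gs) => z hz.
by apply: h; left.
Qed.

Definition level_realized (x : 'rV[R]_d) n :=
  exists2 s, fixing i W1 s & s (bL n) = bL n + eM (wx x n) :> ME.

Let realized_le s x m n : galois_aut i s -> (m <= n)%N ->
  s (bL n) = bL n + eM (wx x n) :> ME -> s (bL m) = bL m + eM (wx x m) :> ME.
Proof.
move=> gs; elim: n => [|n IH]; first by rewrite leqn0 => /eqP ->.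
rewrite leq_eqVlt => /orP[/eqP -> //|mn] h; apply: IH => //.
by rewrite -(bL_tate n).2 sE_Z // h scalerDr -eMZ (wx_tate x n).2.
Qed.

Lemma level_realized_le x m n : (m <= n)%N -> level_realized x n -> level_realized x m.
Proof. by move=> mn [s hs h]; exists s => //; apply: realized_le mn h; case: hs. Qed.

(* Compactness: the realizations at the finite levels agree on the subfields fixed by
   the stabilizers of the [bL n], so they glue to an automorphism of their union. *)
Lemma realization x : (forall n, level_realized x n) ->
  exists2 s, fixing i W1 s & forall n, s (bL n) = bL n + eM (wx x n) :> ME.
Proof.
move=> hR; have H n : exists s, fixing i W1 s /\ s (bL n) = bL n + eM (wx x n) :> ME.
  by have [s] := hR n; exists s.
have [sg hsg] := choice H.
(* The field generated over [K] by [W1] and [bL n], described through its automorphisms. On it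
   [sg n] agrees with every later [sg m], because their quotient fixes [bL n]. *)
pose Z n z := forall s, fixing i W1 s -> s (bL n) = bL n -> s z = z.
have ZS n m z : (n <= m)%N -> Z n z -> Z m z /\ sg m z = sg n z.
  move=> nm hz; split.
    move=> s hs e1; apply: hz => //.
    have e2 : s (bL m) = bL m + eM (wx 0 m) :> ME.
      rewrite e1 -(subrr 0) wxB subrr eM0; apply/esym; exact: (addr0 (bL m)).
    have := realized_le hs.1 nm e2.
    rewrite -(subrr 0) wxB subrr eM0 => ->; exact: (addr0 (bL n)).
  have [tau [hu su us]] := fixing_inv hKs (hsg n).1.
  have h := hz _ (fixing_comp hKs hu (hsg m).1).
  rewrite -[sg m z]us; congr (sg n _); apply: h.
  have e1 : sg m (bL n) = sg n (bL n).
    exact: etrans (realized_le (hsg m).1.1 nm (hsg m).2) (esym (hsg n).2).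
  by rewrite /= e1 su.
pose G (z : Ks * Ks) := exists2 n, Z n z.1 & z.2 = sg n z.1.
have hop (op : Ks -> Ks -> Ks) : (forall s (a b : Ks), s (op a b) = op (s a) (s b)) ->
    forall x y : Ks * Ks, G x -> G y -> G (op x.1 y.1, op x.2 y.2).
  move=> hop z z' [n h1 h2] [n' h1' h2']; exists (maxn n n').
    have [a1 a2] := ZS _ _ _ (leq_maxl n n') h1.
    have [b1 b2] := ZS _ _ _ (leq_maxr n n') h1'.
    by move=> s hs e1; rewrite /= hop a1 // b1.
  have [a1 a2] := ZS _ _ _ (leq_maxl n n') h1.
  have [b1 b2] := ZS _ _ _ (leq_maxr n n') h1'.
  by rewrite /= hop a2 b2 h2 h2'.
have hG : field_graph i G.
  split.
  - move=> c; exists 0%N => [s [gs _] _|] /=; first exact: gs.2.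
    by have [[gs _] _] := hsg 0%N; rewrite gs.2.
  - apply: (hop (fun a b => a - b)) => s a b; exact: rmorphB.
  - apply: (hop (fun a b => a * b)) => s a b; exact: rmorphM.
  - by move=> c [n _ /= ->]; exact: rmorph0.
have [s gs hs] := field_graph_aut hKs hG; exists s.
  split=> // y hy; apply: hs; exists 0%N => [tau [_ hu] _|] /=; first exact: hu.
  by have [[_ h] _] := hsg 0%N; rewrite h.
move=> n; rewrite -(hsg n).2; apply: hs; exists n => //=.
Qed.

Let wx_ker x n : rho ^+ n *: wx x n = 0.
Proof. by apply: wx_tors; apply: ideal_powX; case: hrho. Qed.

(** If [al] lay in [p], multiplication by [pi ^+ n] would carry [bL n.+1] into the image of [D[p]],
    making [bL 1] dependent on the other basis vectors. The descent ends at level 1, hence the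
    successor. *)
Lemma last_generator n : exists (al : A) (del : MD),
  [/\ al \notin p, tors p n.+1 del & bL n.+1 = al *: eM (y_ n.+1) + eM del].
Proof.
have [al [del [hdel e1]]] := torsion_extension (bL_tate n.+1).1.
exists al, del; split=> //; apply/negP => alp; have [pip _ _] := hpi.
have e2 : pi ^+ n *: bL n.+1 = bL 1%N by rewrite -addn1; apply: tate_scaleX.
have h1 : tors p 1 (pi ^+ n *: del).
  move=> a ha; rewrite scalerA; apply: hdel; by apply: ideal_powS (ideal_powX n pip); apply: ideal_pow1.
have [c ec] := be_span h1.
have e3 : bL 1%N = eM (\sum_l c l *: be l).
  rewrite -e2 e1 scalerDr -ec eMZ -[RHS]add0r; congr (_ + _).
  by rewrite scalerA; apply: lattice_root_tors; rewrite mulrC; apply: ideal_powS (ideal_powX n pip).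
have h2 := beE_indep (a := fun j => if unlift ord_max j is Some l then - c l else 1).
apply: (negP (notin_ideal1 p)); rewrite (_ : 1 = if unlift (@ord_max d) ord_max is Some l then - c l else 1);
  last by rewrite unlift_none.
apply: h2.
rewrite beE_sum unlift_none scale1r eMD -bL1 e3 -eMD -big_split /= big1 ?eM0 // => l _.
by rewrite liftK scaleNr addNr.
Qed.

Let sub_swap (V : zmodType) (a c o o' x : V) : a + (o - x) = c + (o' - x) -> o' = o + (a - c).
Proof.
move=> h; have -> : o' = c + (o' - x) - c + x by rewrite (addrC c) addrK subrK.
by rewrite -h addrAC -(addrA a) subrK addrAC addrC.
Qed.

(** [C] is the ramification bound: the kernel of [rho ^+ N] on [D] has at most [C] times as many
    points as the orbit of [x_ N]. If no difference were realized, the points [g a o] of this kernel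
    would be distinct, [C.+1] times as many as the orbit. *)
Lemma realization_bound : exists C, forall n (xs : 'I_C.+1 -> 'rV[R]_d),
  exists a b : 'I_C.+1, a != b /\ level_realized (xs a - xs b) n.
Proof.
have [m [c [m0 vc hc]]] := nonintegral_power hK hKs t0 vt hell (lattice_nonintegral Llam lam0).
have [M M0 hM] := ramification_bound hK hKs t0 vt hell X.
exists (`|v c| * M)%N => n xs; set C := (`|v c| * M)%N.
suff [a [b' [ab h]]] : exists a b : 'I_C.+1, a != b /\ level_realized (xs a - xs b) n.+1.
  by exists a, b'; split=> //; apply: level_realized_le (leqnSn n) h.
have [al [del [hal hdel eL]]] := last_generator n.
set N := n.+1 in hdel eL *.
have [f hf] := tors_inverse MD hp N hal.
have [os uos hos] := orbit_seq hKs (J := fixing i W1) (x_ N) (fun s h => h.1).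
have xn0 : (x_ N : Ks) != 0.
  apply: contra_neq lam0 => e1; rewrite -(hx_ N) (_ : x_ N = 0 :> MD) ?scaler0 //; exact: e1.
have hdom := tau_dominant hK hKs t0 vt hell hq e0_gt0 (D_int (rho ^+ N)) (D_lead (rhoX_neq0 N))
   (x := x_ N).
have exl : tau_eval q (D (rho ^+ N)) (x_ N) = lam by exact: hx_.
rewrite exl in hdom; have {}hdom := hdom (lattice_nonintegral Llam lam0).
have q0 : (0 < q ^ (size (D (rho ^+ N))).-1)%N by rewrite expn_gt0 (ltnW (finNzRing_gt1 k)).
have hle := hM _ _ _ _ _ _ xn0 m0 q0 vc hdom hc uos hos.
have rN0 : (D (rho ^+ N))`_0 != 0 by case: (D_rhoX N).
have [ks uks [hks sks]] := tau_kernel_eq hell hq e0_gt0 hKs.2 rN0.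
have hks' (z : MD) : (z : Ks) \in ks <-> rho ^+ N *: z = 0 by apply: hks.
(* The factor [f] inverts [al], the coefficient of [y_ N] in [bL N]. Thus a collision for distinct
   indices yields an automorphism that moves [bL N] exactly by the difference of the two [wx]. *)
pose g (a : 'I_C.+1) (o : Ks) : MD := f *: wx (xs a) N + ((o : MD) - x_ N).
have hos_ker o : o \in os -> rho ^+ N *: ((o : MD) - x_ N) = 0.
  move=> /hos[s hs ->]; exact: (inertia_shift N (W1_inertia hs) (W1_X hs)).1.
apply: contrapT => hno.
have ug : uniq [seq (g a o : Ks) | a <- enum 'I_C.+1, o <- os].
  apply: allpairs_uniq; [exact: enum_uniq | exact: uos |].
  move=> [a o] [b' o'] /allpairsP[[a1 o1] [_ ho [-> ->]]] /allpairsP[[a2 o2] [_ ho' [-> ->]]].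
  rewrite /= in ho ho' *; rewrite /g => eg.
  have [e1|ne] := eqVneq a1 a2.
    by move: eg; rewrite e1 => /addrI/addIr ->.
  case: hno; exists a1, a2; split=> //.
  have [s hs eo] := (hos o1).1 ho; have [s' hs' eo'] := (hos o2).1 ho'.
  have [tau [htau su us]] := fixing_inv hKs hs.
  have hst := fixing_comp hKs htau hs'.
  set w' : MD := f *: (wx (xs a1) N - wx (xs a2) N).
  have ew : (o2 : MD) = o1 + w'.
    by rewrite /w' scalerBr; apply: sub_swap eg.
  have w'ker : rho ^+ N *: w' = 0 by rewrite /w' !scalerBr !scalerA mulrC -!scalerA !wx_ker scaler0 subrr.
  have tw : (tau w' : MD) = w'.
    apply: (@inertia_torsion tau N) => //; first exact: W1_inertia htau.
    exact: (hX htau.1 (W1_X htau)).1.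
  have ex : ((tau \o s' : {rmorphism Ks -> Ks}) (x_ N) : MD) - x_ N = w'.
    rewrite /= -eo' ew; apply/eqP; rewrite subr_eq [w' + _]addrC; apply/eqP.
    transitivity ((tau o1 : MD) + (tau w' : MD)); first exact: rmorphD.
    by rewrite tw eo su.
  have [_ h2] := inertia_shift N (W1_inertia hst) (W1_X hst).
  have w't : tors p N w' by apply/torsZ/torsB; apply: wx_tors.
  have [fL _] := hX hst.1 (W1_X hst).
  exists (tau \o s' : {rmorphism Ks -> Ks}) => //.
  rewrite eL sE_D (sE_Z _ _ hst.1) h2 ex (sn_id w't) (s_eM _ fL).
  rewrite (inertia_torsion (W1_inertia hst) fL (n := N)); last first.
    by apply: hdel; apply: ideal_powX; case: hrho.
  rewrite scalerDr addrAC; congr (_ + _); rewrite -eMZ; congr (eM _).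
  by rewrite /w' wxB scalerA mulrC -scalerA hf //; apply: torsB; apply: wx_tors.
have os0 : (0 < size os)%N.
  have h : x_ N \in os by apply/hos; exists idfun => //; apply: fixing_id.
  by case: (os) h.
have sub : {subset [seq (g a o : Ks) | a <- enum 'I_C.+1, o <- os] <= ks}.
  move=> _ /allpairsP[[a o] [_ /= ho ->]]; apply/hks'.
  by rewrite /g scalerDr hos_ker // addr0 scalerA mulrC -scalerA wx_ker scaler0.
have := leq_trans (uniq_leq_size ug sub) _.
rewrite sks size_allpairs size_enum_ord => /(_ _ hle).
by rewrite mulSn -[X in (_ <= X)%N]add0n leq_add2r leqNgt os0.
Qed.

Let fix_tors s : inertia_aut v i s -> {in X, forall x, s x = x} ->
  forall n (x : MD), tors p n x -> s (eM x) = eM x.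
Proof.
move=> hs sX n x hx; have [fL _] := hX hs.1 sX.
rewrite s_eM // (inertia_torsion hs fL (n := n)) //; apply: hx.
by apply: ideal_powX; case: hrho.
Qed.

Lemma level_realizedN x n : level_realized x n -> level_realized (- x) n.
Proof.
move=> [s hs e1]; have [tau [ht su us]] := fixing_inv hKs hs; exists tau => //.
have wx0 : wx 0 n = 0 by rewrite -(subrr 0) wxB subrr.
rewrite -sub0r wxB wx0 eMB eM0 sub0r.
have := congr1 tau e1; rewrite su sE_D (fix_tors (W1_inertia ht) (W1_X ht) (@wx_tors x n)).
by move=> e2; rewrite [X in _ = X - _]e2 addrK.
Qed.

(** The bound holds at each level separately. If each pair failed at some level, all would fail at
    the largest of these finitely many levels, since realizability passes to lower levels. *)
Lemma realization_finite : exists ys : seq 'rV[R]_d, forall x,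
  exists2 y, y \in ys & forall n, level_realized (x - y) n.
Proof.
have [C hC] := realization_bound.
apply: (finite_cover (C := C)) => [x y h n | xs].
  by rewrite -opprB; apply: level_realizedN.
apply: contrapT => hno.
have H (ab : 'I_C.+1 * 'I_C.+1) : exists n, ab.1 != ab.2 -> ~ level_realized (xs ab.1 - xs ab.2) n.
  have [e1|ne] := eqVneq ab.1 ab.2; first by exists 0%N.
  apply: contrapT => h; apply: hno; exists ab.1, ab.2; split=> // n.
  by apply: contrapT => h2; apply: h; exists n.
have [N hN] := choice H.
have [a [b' [ab h]]] := hC (\max_ab N ab)%N xs.
apply: (hN (a, b')) => //; apply: level_realized_le h; exact: leq_bigmax.
Qed.

Definition inertia_mx g := exists2 s, inertia_aut v i s & image_mx s g.
Definition unipotent_mx g := exists x : 'rV[R]_d, last_column_mx (R := R^o) x = g.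

(** Automorphisms with the same restriction to [X] differ by one fixing [X], whose matrix is
    unipotent. *)
Lemma inertia_mx_index : finite_index inertia_mx (fun g => inertia_mx g /\ unipotent_mx g).
Proof.
have [T [u' [hu1 hu2]]] := finite_cosets hKs X (inertia_id hK hKs) (fun s h => h.1).
have [gm hgm] := choice (fun a => image_mx_exists (hu1 a).1).
exists [seq gm a | a <- enum T].
  by move=> _ /mapP[a _ ->]; exists (u' a).
move=> h [s hs ih]; have [a ha] := hu2 _ hs.
have [tau [ht cu uc]] := inertia_inv hK hKs (hu1 a).
have h' := inertia_comp hK hKs t0 vt hell ht hs.
have [g' hg'] := image_mx_exists h'.1.
exists (gm a), g'; split; first by apply: map_f; rewrite mem_enum.
  split; first by exists (tau \o s : {rmorphism Ks -> Ks}).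
  by apply: image_last_column hg' => // x xX /=; rewrite ha // cu.
apply: (image_mx_inj ih) => j n; rewrite -(image_mx_comp (hu1 a).1 (hgm a) hg') /=.
by rewrite uc.
Qed.

(** [realization] turns realizability at all levels into an element of inertia, so the finite list
    [ys] meets every coset. *)
Lemma unipotent_mx_index : finite_index unipotent_mx (fun g => inertia_mx g /\ unipotent_mx g).
Proof.
have [ys hys] := realization_finite.
exists [seq last_column_mx (R := R^o) y | y <- ys]; first by move=> _ /mapP[y _ ->]; exists y.
move=> _ [x <-]; have [y hy /realization[s hs e1]] := hys x.
exists (last_column_mx (R := R^o) y), (last_column_mx (R := R^o) (x - y)); split.
- exact: map_f.
- split; last by exists (x - y).
  exists s; first exact: W1_inertia hs.
  apply: last_column_image => // l n.
  exact: (fix_tors (W1_inertia hs) (W1_X hs) (bD_tate l n).1).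
- by rewrite -last_column_mxD subrKC.
Qed.

End Generator.

Variables (pi u : A) (hpi : local_generator p pi u).

(** The basis [be] of [E[p]] is returned because the rank is not compared here: [torsion_rank]
    applied to it identifies [d.+1] with [r]. *)
Lemma tate_commensurable : exists (d : nat) (be : 'I_d.+1 -> ME) (b : 'I_d.+1 -> nat -> ME),
  [/\ [/\ forall j, tors p 1 (be j),
          forall x, tors p 1 x -> exists a : 'I_d.+1 -> A, x = \sum_j a j *: be j &
          forall a : 'I_d.+1 -> A, \sum_j a j *: be j = 0 -> forall j, a j \in p],
      forall j, tate p pi (b j),
      forall x, tate p pi x -> exists! al : 'cV[completion p]_d.+1,
        forall n, x n = \sum_j residue (al j 0) n *: b j n &
      commensurable (fun g : 'M[completion p]_d.+1 =>
          exists2 s : {rmorphism Ks -> Ks}, inertia_aut v i s &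
            forall j n, s (b j n) = \sum_l residue (g l j) n *: b l n :> ME)
        (fun g => exists x : 'rV_d, last_column_mx (R := (completion p)^o) x = g)].
Proof.
have [X hX] := fixing_finite.
have [lam [Llam lam0 lam_prim lam_gen]] := prim_generator_exists.
have /choice[x_ hx_] n : exists y : MD, rho ^+ n *: y = lam.
  apply: act_surj; first exact: hKs.2.
  by case: (D_rhoX n).
have /choice[sn hsn] n : exists s : A, ideal_pow p n (1 - s) /\
    forall a, ideal_pow p n a -> exists z, a * s = rho ^+ n * z.
  have [_ hw _] := hrho.
  have [c hc] := ideal_pow_inverse hp n (maximal_notinX hp n hw).
  (* [w ^+ n] turns elements of [p ^ n] into multiples of [rho ^+ n], and [c] normalizes it to 1
     modulo [p ^ n]. *)
  exists (w ^+ n * c); split=> // a /(local_generator_pow hrho)[z ez]; exists (z * c).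
  by rewrite mulrA [a * _]mulrC ez mulrA [z * _]mulrC.
pose y_ n : MD := sn n *: x_ n.
have sn1 n : ideal_pow p n (1 - sn n) := (hsn n).1.
have sn2 n := (hsn n).2.
have hy_ n : y_ n = sn n *: x_ n by [].
have Drho0 : D rho != 0.
  by case: D_rho => h _ _; apply: contraNneq h => ->; rewrite coef0.
have [ks hks _] := tau_kernel_le hell hq e0_gt0 Drho0.
have hks' (x : MD) : tors p 1 x -> x \in (ks : seq MD).
  by move=> hx; apply: hks; apply: hx; have [hr _ _] := hrho; apply/mem_ideal_pow1.
have [d [be [be1 be_span be_indep]]] := torsion_basis hp hks'.
have /choice[bD hbD] j : exists c : nat -> MD, tate p pi c /\ c 1%N = be j.
  by have [c hc e1] := tate_lift hpi (tors_div hp hpi hrho surjD) (be1 j); exists c.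
have y1 : tors p 1 (eM (y_ 1%N)) := lattice_root_tors Llam hx_ sn2 hy_ (n := 1).
have [bL bL_tate bL1] := tate_lift hpi (tors_div hp hpi hrho surjE) y1.
exists d, (beE y_ be), (tbasis bD bL); split; first split.
- exact: (beE_tors Llam hx_ sn2 hy_ be1).
- exact: (beE_span lam_gen hx_ sn1 sn2 hy_ be_span).
- exact: (beE_indep Llam lam_prim hx_ sn1 sn2 hy_ be1 be_indep).
- exact: (tbasis_tate (fun j => (hbD j).1) bL_tate).
- exact: (tbasis_coordinates Llam lam_prim lam_gen hx_ sn1 sn2 hy_ be1 be_span be_indep hpi
    (fun j => (hbD j).1) (fun j => (hbD j).2) bL_tate bL1).
split.
- exact: (inertia_mx_index Llam lam_prim lam_gen hX hx_ sn1 sn2 hy_ be1 be_span be_indep hpi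
    (fun j => (hbD j).1) (fun j => (hbD j).2) bL_tate bL1).
- exact: (unipotent_mx_index Llam lam0 lam_prim lam_gen hX hx_ sn1 sn2 hy_ be1 be_span be_indep hpi
    (fun j => (hbD j).1) bL_tate bL1).
Qed.

End Uniformization.

Theorem theorem3
  (k : finFieldType)
  (F : fieldType) (A : comNzRingType)
  (kA : {rmorphism k -> A}) (AF : {rmorphism A -> F}) (vinf : F -> int)
  (hF : global_function_field (AF \o kA))
  (hinf : normalized_valuation vinf)
  (hA : regular_outside AF vinf)
  (K : fieldType) (kK : {rmorphism k -> K}) (v : K -> int)
  (hK : local_field v)
  (Ks : fieldType) (KKs : {rmorphism K -> Ks})
  (hKs : separable_closure KKs)
  (r : nat) (phi : A -> {poly K})
  (hphi : drinfeld_module kA kK phi)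
  (hrank : drinfeld_rank k phi r)
  (hres : finite_residual_char v phi)
  (hlat : local_period_lattice_rank kA kK v KKs phi 1)
  (p : idealr A) (hp : maximal_ideal p)
  (hpp0 : ~ (forall a, a \in p <-> residual_char v phi a))
  (pi : A) (hpi : pi \in p /\ ~ ideal_pow p 2 pi) :
  exists b : 'I_r -> nat -> Ks, tate_basis k KKs phi p pi b /\
  exists U : GL_poly (completion p) r -> Prop,
    [/\ subgroup_scheme U,
        isomorphic_to_Ga U r.-1 &
        commensurable (@inertia_image k A K Ks v KKs phi p r b)
          (fun g => @GL_points _ _ U ((completion p)^o) g)].
Proof.
have hv := local_val hK.
have domA := regular_outside_domain hA.
have finA (a : A) : a != 0 -> exists N, quotient_card a N by move=> /hrank[N h _]; exists N.
have [hpi1 hpi2] := hpi.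
have [u hu] := local_generator_exists domA finA (regular_outside_closed hA) hp hpi1 hpi2.
have [rho [rp rp2 hrho0 vrho]] := unramified_generator hv hphi hres hp hpp0 hpi1 hpi2.
have [w hw] := local_generator_exists domA finA (regular_outside_closed hA) hp rp rp2.
have rho0 : rho != 0 by apply: contraNneq hrho0 => ->; rewrite (drinfeld0 hphi) coef0.
have [T1 [f1 [hT1 T1gt1]]] := residue_field_system finA rho0 rp.
have capA a : a != 0 -> exists n, ~ ideal_pow p n a.
  by move=> /finA[N]; apply: (ideal_pow_separated domA hp hw rho0 hT1 T1gt1).
have [t t0 vt] := uniformizer_exists hK.
have [ell [e0 [hell hq e0_gt0]]] := finField_card (KKs \o kK : {rmorphism k -> Ks}).
have [L [D [Lam [hL hDint hper [co [e [[coL co1 elim] [eDr eact esurj eker]]]] hrk]]]] := hlat.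
have rho_unit : ounit v KKs (KKs (phi rho)`_0).
  split; first by rewrite fmorph_eq0.
    by apply: (O_iota KKs hK); rewrite vrho.
  by rewrite -fmorphV; apply: (O_iota KKs hK); rewrite (val_ofV hv hrho0) vrho.
have [d [be [b [[be1 be_span be_indep] hb hcoord hcomm]]]] :=
  tate_commensurable hK hKs t0 vt hell hq e0_gt0 domA hp hw rho0 capA hphi
    rho_unit hL hDint hper hrk coL co1 elim eDr eact esurj eker hu.
have hE := drinfeld_map KKs hphi.
have hrankE : drinfeld_rank k (fun a => map_poly KKs (phi a)) r.
  by move=> a /hrank[N h1 h2]; exists N => //; rewrite size_map_poly.
have hrhoE : (map_poly KKs (phi rho))`_0 != 0 by rewrite coef_map fmorph_eq0.
(* This is [d.+1 = r]; after substitution [r.-1] becomes [d]. *)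
have er := torsion_rank hrankE domA hKs.2 hp hw hrhoE hT1 T1gt1 be1 be_span be_indep.
case: r / er {hrank hrankE}.
exists b; split; first by split; [exact: hb | exact: hcoord].
exists (last_column_eqs (B := completion p) (d := d)); split.
- exact: last_column_subgroup.
- exact: last_column_Ga.
- have -> : (fun g : 'M[completion p]_d.+1 =>
      @GL_points _ _ (last_column_eqs (d := d)) ((completion p)^o) g) =
    (fun g => exists x : 'rV_d, last_column_mx (R := (completion p)^o) x = g).
    by apply/funext => g; apply/propext/last_column_points.
  exact: hcomm.
Qed.
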